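(* Let $I=(a,\infty)$, $t_0\in I$, $\Omega=(t_0,\infty)$, let $D\subset\mathbb R^n$ be open, $f:D\to\mathbb R^n$ and $g:D\to\mathbb R^{n\times n}$ Lipschitz in $D$, and consider in $\mathcal T_n'(I)$ the equation $$\dot x=f(x)+g(x)v,\qquad v=\dot u,\quad u\in s\mathbb{BV}_n^{\mathrm{loc}}(I),\qquad( * )$$ where $\sigma_\tau(u)\neq0$ for all $\tau\in T(u)$. Suppose that $x^*\in D$ is an equilibrium point of $( * )$, and $$\bigl(x-x^*,f(x)+g(x)v\bigr)\le0$$ in $\mathcal T'(\Omega)$ for any $x\in D$ such that $|x-x^*|_2=1/l$, $l\in\mathbb N$, where $|\cdot|_2$ is the Euclidean norm in $\mathbb R^n$. Then $x^*$ is uniformly stable.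
   Context: Basic notation. $I=(a,b)$ (here $b=\infty$), $J=[-\frac12,\frac12]$; $(\cdot,\cdot)$ is the inner product in $\mathbb R^n$. $\mathbb G(I)$: bounded functions $g:I\to\mathbb R$ having one-sided limits at every point (including $g(a+)$, $g(b-)$), functions with the same one-sided limits being identified; $\mathbb{BV}(I)\subset\mathbb G(I)$: those with $\mathrm{var}_I(g)=\sup\sum_k|g(\tau_{k+1}-)-g(\tau_k+)|<\infty$ (sup over finite partitions $a<\tau_1<\dots<\tau_m<b$); $g_c$ is the continuous part of $g\in\mathbb{BV}$ (that is, $g$ minus its jump part); $\mathbb{AC}$, $\mathbb L$: absolutely continuous and Lebesgue summable functions; $\mathrm{loc}$ denotes local versions (the restriction to $(c,d)$ is in the space for each $[c,d]\subset I$); subscript $n$ denotes vector-valued versions, all operations componentwise. The same definitions are used on $J$ and on open subintervals of $I$. Dynamic functions. A dynamic function is a map $f$ assigning to each $t\in I$ a function $f(t)(\cdot):J\to\mathbb R$ (its dynamic value at $t$). If $f(t)(\cdot)$ is constant it is called an ordinary value, denoted $f(t)$; ordinary functions are dynamic functions with all values ordinary. $f(\tau+)=c$ means: for each $\varepsilon>0$ there is $\eta>0$ with $\sup_{t\in(\tau,\tau+\eta)}\sup_{s\in J}|f(t)(s)-c|\le\varepsilon$; similarly $f(\tau-)$. $f$ is continuous at $\tau$ if $f(\tau)(\cdot)$ is an ordinary value and $f(\tau)=f(\tau+)=f(\tau-)$; $T(f)$ is the set of points of discontinuity; $\sigma_\tau(f)=f(\tau+)-f(\tau-)$. $f\ge0$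 means $f(t)(s)\ge 0$ for all $t,s$. $\mathrm{supp}(f)$ is the closure of the set of $t$ where $f(t)(\cdot)$ is not identically $0$. $d\mathbb G(I)$: dynamic functions $g$ with $g(t)(\cdot)\in\mathbb G(J)$ for all $t$ and with one-sided limits at all $t\in I$ and at $a+,b-$, with norm $\|g\|=\sup_{t,s}|g(t)(s)|$; such $g$ has at most countable $T(g)$, and its ordinary part $\hat g=\mathrm{ord}(g)\in\mathbb G(I)$ is $\hat g(t)=g(t)$ at points where the value is ordinary. $s\mathbb G(I)$: those $g\in d\mathbb G(I)$ with $g(t)(\cdot)\in\mathbb{AC}(J)$, $g(t)(-1/2)=g(t-)$, $g(t)(1/2)=g(t+)$ for all $t$. $s\mathbb{BV}(I)$: those $g\in s\mathbb G(I)$ with $\mathrm{ord}(g)\in\mathbb{BV}(I)$ and $\sum_{t\in T(g)}\mathrm{var}_{s\in J}(g(t)(s))<\infty$. Distributions. $\mathcal T(I)$: elements $\varphi\in d\mathbb G(I)$ with compact support in $I$; $\varphi_k\to\varphi$ in $\mathcal T$ if $\varphi_k\to\varphi$ in $d\mathbb G$ and all supports lie in one compact subset of $I$. $\mathcal T'(I)$: continuous linear functionals on $\mathcal T(I)$; $\mathcal T_n'(I)$: vectors of such. For an open interval $\Omega\subset I$, $\mathcal T(\Omega)$ and $\mathcal T'(\Omega)$ are defined in the same way with $\Omega$ in place of $I$. Product with a dynamic function $g$ (locally in $d\mathbb G$): $(gf,\varphi)=(f,g\varphi)$. $f\in\mathbb L^{\mathrm{loc}}$ defines the regular distribution $(f,\varphi)=\int_I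 f\hat\varphi\,dt$, $\hat\varphi=\mathrm{ord}(\varphi)$. Derivative of $g\in s\mathbb{BV}^{\mathrm{loc}}$: $(\dot g,\varphi)=\int_I\hat\varphi\,dg_c+\sum_{\tau\in T(g)}\int_J\varphi(\tau)(s)\frac{d}{ds}\bigl(g(\tau)(s)\bigr)ds$, where $g_c$ is the continuous part of $\mathrm{ord}(g)$. ''$F\le0$ in $\mathcal T'(\Omega)$'' means $(F,\varphi)\le0$ for every $\varphi\in\mathcal T(\Omega)$ with $\varphi\ge0$. Equation. For a dynamic function $x$, $f(x)$ is the regular distribution of $t\mapsto f(\hat x(t))$ and $g(x)$ is the dynamic function with dynamic values $s\mapsto g(x(t)(s))$; for fixed $x\in D$ these are constants. A solution on an open interval $\Omega'\subset I$ is $x\in s\mathbb{BV}_n^{\mathrm{loc}}(\Omega')$ with $x(t)(s)\in D$ for all $t\in\Omega'$, $s\in J$, satisfying the equation in $\mathcal T_n'(\Omega')$. An equilibrium point is a point $x^*\in D$ such that the function identically equal to $x^*$ is a solution. Viability and stability. A solution $x$ (defined on an open interval containing $\Omega\cup\{t_0\}$) with $x(t_0-)\in M$ is viable in a closed set $M$ on $\Omega$ if $x(t)(s)\in M$ for all $t\in\Omega\cup\{t_0\}$, $s\in J$. An equilibrium point $x^*$ is uniformly stable if there exists a sequence of closed subsets $M_{k+1}\subset M_k\subset D$ ($k\in\mathbb N$), where each $M_k$ contains an open neighbourhood of $x^*$ and is also contained in another open neighbourhood of $x^*$, such that for any $l\in\mathbb N$ there exists $k\ge l$ having the property: any solution $x$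 of $( * )$ with $x(t_0-)\in M_k$ is viable in $M_l$ on $\Omega=(t_0,\infty)$. *)

(* Defs.v *)
From HB Require Import structures.
From mathcomp Require Import all_boot all_order all_algebra.
From mathcomp Require Import all_classical all_reals all_analysis.

Set Implicit Arguments.
Unset Strict Implicit.
Unset Printing Implicit Defensive.

Import Order.TTheory GRing.Theory Num.Theory.
Import numFieldNormedType.Exports.

Local Open Scope classical_set_scope.
Local Open Scope ring_scope.

(* An interval (al, be) has extended real end points. Functions on it are total
   functions on R whose values outside of it are never used. *)

Definition oitv (R : realType) (al be : \bar R) : set R :=
  [set t | (al < t%:E)%E /\ (t%:E < be)%E].

Definition J (R : realType) : set R := `[- 2^-1, 2^-1]%classic.

(* The filters of the one-sided limits al+ and be-, finite or not. *)
Definition at_start (R : realType) (al : \bar R) : set_system R :=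
  if al is a%:E%E then a^'+ else ninfty_nbhs R.

Definition at_end (R : realType) (be : \bar R) : set_system R :=
  if be is b%:E%E then b^'- else pinfty_nbhs R.

Definition llim (R : realType) (h : R -> R) (t : R) : R := lim (h @ t^'-).

Definition rlim (R : realType) (h : R -> R) (t : R) : R := lim (h @ t^'+).

(* Functions with the same one-sided limits are not quotiented out: everything
   below that is applied to elements of G depends on one-sided limits only, or
   is insensitive to changing the function at countably many points. *)
Definition isG (R : realType) (al be : \bar R) (h : R -> R) : Prop :=
  [/\ exists M, forall t, oitv al be t -> `|h t| <= M,
      forall t, oitv al be t -> cvg (h @ t^'-) /\ cvg (h @ t^'+),
      cvg (h @ at_start al) & cvg (h @ at_end be)].

Definition var (R : realType) (al be : \bar R) (h : R -> R) : \bar R :=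
  ereal_sup [set y | exists (m : nat) (tau : nat -> R),
    [/\ forall k, (k <= m)%N -> oitv al be (tau k),
        forall k, (k < m)%N -> tau k < tau k.+1 &
        y = (\sum_(k < m) `|llim h (tau k.+1) - rlim h (tau k)|)%:E]].

Definition isBV (R : realType) (al be : \bar R) (h : R -> R) : Prop :=
  isG al be h /\ (var al be h < +oo)%E.

Definition isACJ (R : realType) (h : R -> R) : Prop :=
  forall e, 0 < e -> exists2 d, 0 < d &
    forall (N : nat) (p q : nat -> R),
      (forall k, (k < N)%N -> [/\ J (p k), J (q k) & p k <= q k]) ->
      (forall k, (k.+1 < N)%N -> q k <= p k.+1) ->
      \sum_(k < N) (q k - p k) < d ->
      \sum_(k < N) `|h (q k) - h (p k)| < e.

(* Meaningful for absolutely summable families. *)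
Definition ssum (R : realType) (A : set R) (F : R -> R) : R :=
  fine (\esum_(t in A) (Num.max (F t) 0)%:E)
  - fine (\esum_(t in A) (Num.max (- F t) 0)%:E).

(* The continuous part on [c, +oo[ of a function of locally bounded variation:
   with the representative t |-> h(t-), the jump part is the sum of the jumps
   at the points of [c, t[. Another choice of c adds a constant. *)
Definition cont_part (R : realType) (c : R) (h : R -> R) (t : R) : R :=
  llim h t - ssum `[c, t[%classic (fun tau => rlim h tau - llim h tau).

(* Riemann-Stieltjes integral of p with respect to h over [c, d]: limit of the
   tagged sums as the mesh tends to 0. It exists, and agrees with the
   Lebesgue-Stieltjes one, for p regulated and h continuous of bounded
   variation. *)
Definition is_RS_integral (R : realType) (p h : R -> R) (c d L : R) : Prop :=
  forall e, 0 < e -> exists2 del, 0 < del &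
    forall (N : nat) (tau xi : nat -> R),
      tau 0%N = c -> tau N = d ->
      (forall k, (k < N)%N ->
        [/\ tau k <= xi k, xi k <= tau k.+1 & tau k.+1 - tau k < del]) ->
      `|\sum_(k < N) p (xi k) * (h (tau k.+1) - h (tau k)) - L| < e.

(* The integral of p dh_c over (al, be), for p vanishing off a compact subset.
   The value does not depend on the compact interval [c, d]. *)
Definition int_dcont (R : realType) (al be : \bar R) (p h : R -> R) : R :=
  xget 0 [set L | exists c d,
    [/\ c < d, `[c, d]%classic `<=` oitv al be,
        forall t, oitv al be t -> p t != 0 -> c <= t <= d &
        is_RS_integral p (cont_part c h) c d L]].

Definition dynfun (R : realType) := R -> R -> R.

Definition ordinary (R : realType) (h : R -> R) : Prop :=
  forall s, J s -> h s = h 0.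

Definition dyn_cvg (R : realType) (F : set_system R) (f : dynfun R) (c : R) :
  Prop :=
  forall e, 0 < e -> \forall t \near F, forall s, J s -> `|f t s - c| <= e.

Definition dyn_lim (R : realType) (F : set_system R) (f : dynfun R) : R :=
  xget 0 [set c | dyn_cvg F f c].

Definition dyn_continuous_at (R : realType) (f : dynfun R) (tau : R) : Prop :=
  [/\ ordinary (f tau), dyn_cvg tau^'- f (f tau 0) &
      dyn_cvg tau^'+ f (f tau 0)].

Definition disc (R : realType) (al be : \bar R) (f : dynfun R) : set R :=
  [set tau | oitv al be tau /\ ~ dyn_continuous_at f tau].

Definition is_dG (R : realType) (al be : \bar R) (g : dynfun R) : Prop :=
  [/\ forall t, oitv al be t -> isG (- 2^-1)%:E (2^-1)%:E (g t),
      forall t, oitv al be t ->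
        (exists c, dyn_cvg t^'- g c) /\ (exists c, dyn_cvg t^'+ g c),
      exists c, dyn_cvg (at_start al) g c &
      exists c, dyn_cvg (at_end be) g c].

(* At the (at most countably many) points where the value is not ordinary, the
   ordinary part is left unspecified as an element of G; g(t-) is used. *)
Definition ord (R : realType) (g : dynfun R) (t : R) : R :=
  if `[< ordinary (g t) >] then g t 0 else dyn_lim t^'- g.

Definition is_sG (R : realType) (al be : \bar R) (g : dynfun R) : Prop :=
  is_dG al be g /\
  forall t, oitv al be t ->
    [/\ isACJ (g t), dyn_cvg t^'- g (g t (- 2^-1)) &
        dyn_cvg t^'+ g (g t 2^-1)].

Definition is_sBV (R : realType) (al be : \bar R) (g : dynfun R) : Prop :=
  [/\ is_sG al be g, isBV al be (ord g) &
      (\esum_(t in disc al be g) var (- 2^-1)%:E (2^-1)%:E (g t) < +oo)%E].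

Definition is_sBVloc (R : realType) (al be : \bar R) (g : dynfun R) : Prop :=
  forall c d : R, c < d -> (al < c%:E)%E -> (d%:E < be)%E ->
    is_sBV c%:E d%:E g.

Definition supp (R : realType) (al be : \bar R) (f : dynfun R) : set R :=
  closure [set t | oitv al be t /\ exists2 s, J s & f t s != 0].

Definition is_test (R : realType) (al be : \bar R) (p : dynfun R) : Prop :=
  [/\ is_dG al be p, compact (supp al be p) & supp al be p `<=` oitv al be].

(* Distributions are used through their values on test functions only. All the
   functionals built below from admissible data are linear and continuous on
   test functions, so that no membership condition is needed. *)
Definition functional (R : realType) := dynfun R -> R.

Definition eq_distr (R : realType) (al be : \bar R) (F G : functional R) :
  Prop := forall p, is_test al be p -> F p = G p.

Definition distr_le0 (R : realType) (al be : \bar R) (F : functional R) :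
  Prop :=
  forall p, is_test al be p ->
    (forall t s, oitv al be t -> J s -> 0 <= p t s) -> F p <= 0.

Definition mul_distr (R : realType) (g : dynfun R) (F : functional R) :
  functional R := fun p => F (fun t s => g t s * p t s).

Definition regular (R : realType) (al be : \bar R) (h : R -> R) :
  functional R :=
  fun p => (\int[lebesgue_measure]_(t in oitv al be) (h t * ord p t))%R.

Definition deriv_distr (R : realType) (al be : \bar R) (g : dynfun R) :
  functional R :=
  fun p => int_dcont al be (ord p) (ord g) +
    ssum (disc al be g) (fun tau =>
      (\int[lebesgue_measure]_(s in @J R) (p tau s * derive1 (g tau) s))%R).

Definition dynvec (R : realType) (n : nat) := R -> R -> 'cV[R]_n.

Definition comp (R : realType) (n : nat) (x : dynvec R n) (i : 'I_n) :
  dynfun R := fun t s => x t s i 0.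

Definition ordv (R : realType) (n : nat) (x : dynvec R n) (t : R) : 'cV[R]_n :=
  \col_i ord (comp x i) t.

Definition left_val (R : realType) (n : nat) (x : dynvec R n) (t : R) :
  'cV[R]_n := \col_i dyn_lim t^'- (comp x i).

Definition right_val (R : realType) (n : nat) (x : dynvec R n) (t : R) :
  'cV[R]_n := \col_i dyn_lim t^'+ (comp x i).

Definition sigma (R : realType) (n : nat) (x : dynvec R n) (t : R) :
  'cV[R]_n := right_val x t - left_val x t.

Definition discv (R : realType) (n : nat) (al be : \bar R) (x : dynvec R n) :
  set R := [set tau | exists i, disc al be (comp x i) tau].

Definition is_sBVloc_vec (R : realType) (n : nat) (al be : \bar R)
  (x : dynvec R n) : Prop := forall i, is_sBVloc al be (comp x i).

Definition cst_dyn (R : realType) (n : nat) (x : 'cV[R]_n) : dynvec R n :=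
  fun _ _ => x.

(* The i-th component of f(x) + g(x) v on (al, be), with v the derivative of
   u. *)
Definition rhs (R : realType) (n : nat) (al be : \bar R)
  (f : 'cV[R]_n -> 'cV[R]_n) (g : 'cV[R]_n -> 'M[R]_n) (u x : dynvec R n)
  (i : 'I_n) : functional R :=
  fun p => regular al be (fun t => f (ordv x t) i 0) p +
    \sum_(j < n)
      mul_distr (fun t s => g (x t s) i j) (deriv_distr al be (comp u j)) p.

Definition is_solution (R : realType) (n : nat) (D : set 'cV[R]_n)
  (f : 'cV[R]_n -> 'cV[R]_n) (g : 'cV[R]_n -> 'M[R]_n) (u : dynvec R n)
  (al be : \bar R) (x : dynvec R n) : Prop :=
  [/\ is_sBVloc_vec al be x,
      forall t s, oitv al be t -> J s -> D (x t s) &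
      forall i, eq_distr al be (deriv_distr al be (comp x i))
                               (rhs al be f g u x i)].

Definition is_equilibrium (R : realType) (n : nat) (D : set 'cV[R]_n)
  (f : 'cV[R]_n -> 'cV[R]_n) (g : 'cV[R]_n -> 'M[R]_n) (u : dynvec R n)
  (a : \bar R) (xs : 'cV[R]_n) : Prop :=
  D xs /\ is_solution D f g u a +oo%E (cst_dyn xs).

Definition norm2 (R : realType) (n : nat) (x : 'cV[R]_n) : R :=
  Num.sqrt (\sum_(i < n) x i 0 ^+ 2).

(* Viability on (t0, +oo), whose union with {t0} is [t0, +oo[. *)
Definition viable (R : realType) (n : nat) (M : set 'cV[R]_n) (t0 : R)
  (x : dynvec R n) : Prop :=
  forall t s, t0 <= t -> J s -> M (x t s).

Definition uniformly_stable (R : realType) (n : nat) (D : set 'cV[R]_n)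
  (f : 'cV[R]_n -> 'cV[R]_n) (g : 'cV[R]_n -> 'M[R]_n) (u : dynvec R n)
  (a : \bar R) (t0 : R) (xs : 'cV[R]_n) : Prop :=
  exists M : nat -> set 'cV[R]_n,
    [/\ forall k, closed (M k),
        forall k, M k.+1 `<=` M k /\ M k `<=` D,
        forall k, exists U V : set 'cV[R]_n,
          [/\ open U, U xs, U `<=` M k, open V & V xs /\ M k `<=` V] &
        forall l, exists2 k, (l <= k)%N &
          forall (al : \bar R) (x : dynvec R n),
            (a <= al)%E -> (al < t0%:E)%E ->
            is_solution D f g u al +oo%E x ->
            M k (left_val x t0) -> viable (M l) t0 x].

(* Main.v *)
From HB Require Import structures.
Require Import Defs.
From mathcomp Require Import all_boot all_order all_algebra.
From mathcomp Require Import all_classical all_reals all_analysis.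
From mathcomp Require Import measurable_realfun zify ring lra.
Import Order.TTheory GRing.Theory Num.Theory.
Import numFieldNormedType.Exports.
Local Open Scope classical_set_scope.
Local Open Scope ring_scope.

Set Implicit Arguments.
Unset Strict Implicit.
Unset Printing Implicit Defensive.

(** Why the theorem is true.

Take for M_k the closed Euclidean ball around xs of radius 1/(k + m + 1), with m
so large that the ball of radius 1/(m + 1) lies in D. All these radii are among
those of the spheres on which the hypothesis bears.

The hypothesis, turned into increments. Among the nonnegative test functions are
the indicator of a time interval (c, d) and, at a fixed time tau, the indicator
of an interval (s1, s2) of the variable s of the dynamic value. Tested against
them, f(z) + g(z) v becomes the increment that the equation would produce with
its state frozen at z: (d - c) f(z) + g(z) (u(d-) - u(c+)) over (c, d)
(itv_drift) and g(z) (u(tau)(s2) - u(tau)(s1)) inside the jump at tau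
(jump_drift). Hence for z on one of the spheres both increments have a
nonpositive inner product with z - xs (dot_itv_drift, dot_jump_drift). The same
tests, applied to a solution x that stays within e of z, show that the true
increment of x differs from the frozen one by at most L e w in each entry, where
L is a Lipschitz constant and w the variation of t and u over the same stretch
(increment_itv, increment_jump). This is where the derivative distribution has
to be computed (deriv_itv, deriv_jump): it requires that the Riemann-Stieltjes
integral against the continuous part of u exists (RS_regulated), and that an
absolutely continuous function is the integral of its derivative
(abs_cont_density, jump_integral).

The trap. Fix a radius r, let N be the distance of x to xs, and let the clock W
measure the variation of t and u spent since t0, including the part of a jump
already run through; instants are pairs (t, s), ordered lexicographically. For
every eps > 0 the barrier N <= r + eps exp(C W) is never crossed. Indeed, if at
some instant N = r + dl with dl > 0, compare x with its projection z on the
sphere of radius r, which is at distance dl. Over a short stretch the frozen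
increment at z does not increase N to first order, the error is O(dl w), and the
second order term is negligible when w is small; so N grows by at most C dl w
(sphere_step), which is slower than the barrier (barrier_step). Real induction
on t, and on s inside the jumps, concludes (sphere_trap), after letting eps tend
to 0. Differentiating N is out of the question here, as u is only of bounded
variation; and the excess dl has to enter multiplicatively, because f + g v is
only controlled on the spheres themselves.

The jump at t0. The initial condition bears on x(t0-), whereas the hypothesis
bears on times after t0, so the jump at t0 needs another argument: as xs is an
equilibrium, the increment frozen at xs vanishes during that jump
(equilibrium_jump), so that N is multiplied by at most a constant depending only
on L and on the variation of u(t0) (jump_growth). The index k is chosen large
enough to absorb this constant. *)

(** * Integrals of functions squeezed between integrable ones *)

Section sandwich.
Context d (T : measurableType d) (R : realType).
Variable mu : {measure set T -> \bar R}.

Import HBNNSimple.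

(** The integral of a nonnegative function is a supremum of integrals of simple
functions, and a simple function below f is pushed below g by killing it on the
null set N. *)
Lemma ge0_ae_le_integral (D N : set T) (f g : T -> \bar R) :
  measurable N -> mu N = 0%E ->
  (forall x, D x -> (0 <= f x)%E) -> (forall x, D x -> (0 <= g x)%E) ->
  (forall x, D x -> ~ N x -> (f x <= g x)%E) ->
  (\int[mu]_(x in D) f x <= \int[mu]_(x in D) g x)%E.
Proof.
move=> mN N0 f0 g0 fg; rewrite !ge0_integralE//.
apply: ge_ereal_sup => _ [h/= hf <-].
have mNC : measurable (~` N) by exact: measurableC.
pose h' : {nnsfun T >-> R} := proj_nnsfun h mNC.
apply: le_ereal_sup_tmp; exists (sintegral mu h').
  exists h' => //= x; rewrite measurable_realfun.mindicE.
  have [Nx|Nx] := boolP (x \in ~` N); last first.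
    by rewrite mulr0 /patch; case: ifPn => // /[!inE] /g0.
  rewrite mulr1; have := hf x; rewrite /patch; case: ifPn => // /[!inE] Dx hx.
  by apply: (le_trans hx); apply: fg => //; rewrite inE in Nx.
have int_off_N (k : {nnsfun T >-> R}) :
    (\int[mu]_x (k x)%:E = \int[mu]_(x in ~` N) (k x)%:E)%E.
  rewrite (ge0_negligible_integral mN)// ?setTD//.
    exact/measurable_EFinP.
  by move=> x _; rewrite lee_fin.
rewrite -!integralT_nnsfun !int_off_N.
rewrite [X in (_ <= X)%E](eq_integral (fun x => (h x)%:E))// => x.
rewrite inE => Nx /=; rewrite measurable_realfun.mindicE.
by rewrite mem_set// mulr1.
Qed.

(** Here F may fail to be measurable, and that is the point: the integrands
met below contain the dynamic values of an arbitrary test function or the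
derivative of a function that is differentiable almost everywhere only. *)
Lemma ae_le_Rintegral_sandwich (D N : set T) (lo hi F : T -> R) :
  measurable D -> measurable N -> mu N = 0%E ->
  mu.-integrable D (EFin \o lo) -> mu.-integrable D (EFin \o hi) ->
  (forall x, D x -> ~ N x -> lo x <= F x <= hi x) ->
  \int[mu]_(x in D) lo x <= \int[mu]_(x in D) F x <= \int[mu]_(x in D) hi x.
Proof.
move=> mD mN N0 ilo ihi H.
set pos := fun f : T -> R => (\int[mu]_(x in D) ((EFin \o f)^\+ x))%E.
set neg := fun f : T -> R => (\int[mu]_(x in D) ((EFin \o f)^\- x))%E.
have pos_le f g : (forall x, D x -> ~ N x -> f x <= g x) -> (pos f <= pos g)%E.
  move=> fg; apply: (ge0_ae_le_integral mN N0) => // x Dx Nx.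
  by rewrite !funeposE/= ge_max !le_max lexx orbT andbT lee_fin fg.
have neg_le f g : (forall x, D x -> ~ N x -> f x <= g x) -> (neg g <= neg f)%E.
  move=> fg; apply: (ge0_ae_le_integral mN N0) => // x Dx Nx.
  by rewrite !funenegE/= ge_max !le_max lexx orbT andbT lee_fin lerN2 fg.
have pos0 f : (0 <= pos f)%E by apply: integral_ge0.
have neg0 f : (0 <= neg f)%E by apply: integral_ge0.
have loF : forall x, D x -> ~ N x -> lo x <= F x.
  by move=> x Dx Nx; have /andP[] := H x Dx Nx.
have Fhi : forall x, D x -> ~ N x -> F x <= hi x.
  by move=> x Dx Nx; have /andP[] := H x Dx Nx.
have phi : pos hi \is a fin_num.
  by rewrite ge0_fin_numE//; exact: integral_funepos_lt_pinfty.
have nlo : neg lo \is a fin_num.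
  by rewrite ge0_fin_numE//; exact: integral_funeneg_lt_pinfty.
have finp f : (pos f <= pos hi)%E -> pos f \is a fin_num.
  by move=> h; rewrite ge0_fin_numE//; apply: le_lt_trans h _; rewrite -ge0_fin_numE.
have finn f : (neg f <= neg lo)%E -> neg f \is a fin_num.
  by move=> h; rewrite ge0_fin_numE//; apply: le_lt_trans h _; rewrite -ge0_fin_numE.
have pF := finp _ (pos_le _ _ Fhi).
have nF := finn _ (neg_le _ _ loF).
have plo := finp _ (le_trans (pos_le _ _ loF) (pos_le _ _ Fhi)).
have nhi := finn _ (le_trans (neg_le _ _ Fhi) (neg_le _ _ loF)).
have E f : pos f \is a fin_num -> neg f \is a fin_num ->
    \int[mu]_(x in D) f x = fine (pos f) - fine (neg f).
  by move=> pf nf; rewrite /Rintegral integralE fineB.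
rewrite !E//; apply/andP; split; apply: lerB; apply: fine_le => //.
- exact: pos_le.
- exact: neg_le.
- exact: pos_le.
- exact: neg_le.
Qed.

End sandwich.

(** * Chains of intervals and absolute continuity *)

Section chain.
Context {R : realType}.
Implicit Types (a b c d : R) (l : seq (R * R)) (u : R * R).

(** Nonoverlapping intervals, listed from left to right between a and b. *)
Fixpoint chain a b l : Prop :=
  if l is u :: l' then [/\ a <= u.1, u.1 <= u.2 & chain u.2 b l'] else a <= b.

Lemma chain_le a b l : chain a b l -> a <= b.
Proof.
elim: l a => //= u l IH a [au uu /IH ub].
by rewrite (le_trans au)// (le_trans uu).
Qed.

Lemma chain_lel a' a b l : a' <= a -> chain a b l -> chain a' b l.
Proof.
case: l => [|u l] /=; first exact: le_trans.
by move=> aa' [au uu cl]; split => //; exact: le_trans au.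
Qed.

Lemma chain_cat a b l1 l2 :
  chain a b (l1 ++ l2) <-> exists2 c, chain a c l1 & chain c b l2.
Proof.
elim: l1 a => /= [a|u l1 IH a].
  split=> [H|[c ac]]; first by exists a.
  by case: l2 => /= [|v l2]; [exact: le_trans|case=> cv ? ?; split=> //; exact: le_trans cv].
split=> [[? ? /IH[c ? ?]]|[c [? ? H] ?]]; first by exists c.
by split=> //; apply/IH; exists c.
Qed.

Lemma chain_map (f : R -> R) a b l : {homo f : x y / x <= y} ->
  chain a b l -> chain (f a) (f b) [seq (f u.1, f u.2) | u <- l].
Proof.
move=> hf; elim: l a => /= [a|u l IH a [au uu /IH H]]; first exact: hf.
by split => //=; exact: hf.
Qed.

Definition cells l : set R := \big[setU/set0]_(u <- l) `]u.1, u.2]%classic.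

Lemma cells_cons u l : cells (u :: l) = `]u.1, u.2]%classic `|` cells l.
Proof. by rewrite /cells big_cons. Qed.

Lemma cells_cat l1 l2 : cells (l1 ++ l2) = cells l1 `|` cells l2.
Proof. by rewrite /cells big_cat. Qed.

Lemma cells_chain a b l : chain a b l -> cells l `<=` `]a, b].
Proof.
elim: l a => [a _|u l IH a /= [au uu cl]]; first by rewrite /cells big_nil.
rewrite cells_cons => x [|/(IH _ cl)]; rewrite /= !in_itv/= => /andP[h1 h2].
  by rewrite (le_lt_trans au h1) (le_trans h2)// (chain_le cl).
by rewrite h2 andbT (le_lt_trans au)// (le_lt_trans uu).
Qed.

Lemma measurable_cells l : measurable (cells l).
Proof. by apply: bigsetU_measurable => u _; exact: measurable_itv. Qed.

Lemma cells_minr c l :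
  cells [seq (Num.min u.1 c, Num.min u.2 c) | u <- l] = cells l `&` `]-oo, c].
Proof.
elim: l => [|u l IH]; first by rewrite /cells !big_nil set0I.
rewrite /= !cells_cons setIUl IH; congr (_ `|` _).
apply/seteqP; split=> x /=; rewrite !in_itv/=.
  by rewrite gt_min le_min; lra.
by rewrite gt_min le_min; lra.
Qed.

Lemma cells_maxr d l :
  cells [seq (Num.max u.1 d, Num.max u.2 d) | u <- l] = cells l `&` `]d, +oo[.
Proof.
elim: l => [|u l IH]; first by rewrite /cells !big_nil set0I.
rewrite /= !cells_cons setIUl IH; congr (_ `|` _).
by apply/seteqP; split=> x /=; rewrite !in_itv/= gt_max le_max; lra.
Qed.

(** The cells of a new interval are made disjoint from those of a chain by
truncating the chain at both ends of the new interval. *)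
Lemma cells_disjointify a b l : a <= b ->
  (forall u, u \in l -> [/\ a <= u.1, u.1 <= u.2 & u.2 <= b]) ->
  exists2 l', chain a b l' & cells l' = cells l.
Proof.
move=> ab; elim: l => [_|[c d] l IH H]; first by exists [::].
have [|l' cl' E] := IH; first by move=> u ul; apply: H; rewrite inE ul orbT.
have /= [ac cd db] := H (c, d) (mem_head _ _).
exists ([seq (Num.min u.1 c, Num.min u.2 c) | u <- l'] ++
    (c, d) :: [seq (Num.max u.1 d, Num.max u.2 d) | u <- l']).
  apply/chain_cat; exists c => /=.
    have /chain_map := cl' => /(_ (fun x => Num.min x c)).
    rewrite (min_l ac) (min_r (le_trans cd db)); apply=> x y xy.
    by rewrite le_min !ge_min xy lexx orbT.
  split=> //; have /chain_map := cl' => /(_ (fun x => Num.max x d)).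
  rewrite (max_r (le_trans ac cd)) (max_l db); apply=> x y xy.
  by rewrite ge_max !le_max xy lexx orbT.
rewrite cells_cat !cells_cons cells_minr cells_maxr E /=.
apply/seteqP; split=> x /=; rewrite !in_itv/=; first tauto.
move=> [|lx]; first tauto.
have [xc|cx] := leP x c; first by left.
by have [xd|dx] := leP x d; [right; left|right; right; rewrite andbT].
Qed.

Lemma measure_cells (mu : {measure set (measurableTypeR R) -> \bar R})
    (G : R -> R) a b l :
  (forall x y, a <= x -> x <= y -> y <= b -> mu `]x, y]%classic = (G y - G x)%:E) ->
  chain a b l -> mu (cells l) = (\sum_(u <- l) (G u.2 - G u.1))%:E.
Proof.
elim: l a => [a _ _|u l IH a muE /= [au uu cl]].
  by rewrite /cells !big_nil measure0.
rewrite cells_cons big_cons measureU//; last 2 first.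
- exact: measurable_cells.
- apply/seteqP; split=> // x /= [] + /(cells_chain cl); rewrite /= !in_itv/=.
  by move=> /andP[_ xu] /andP[ux _]; move: xu; rewrite leNgt ux.
rewrite EFinD; congr (_ + _)%E; first by apply: muE => //; exact: chain_le cl.
apply: (IH u.2) => // x y ux xy yb.
by rewrite muE// (le_trans au)// (le_trans uu).
Qed.

Definition pairs a (s : seq R) := [seq (x.2, x.1) | x <- zip s (a :: s)].

Lemma chain_pairs a b s : itv_partition a b s -> chain a b (pairs a s).
Proof.
rewrite /itv_partition /pairs; elim: s a => /= [a [_ /eqP ->]//|x s IH a].
by move=> [/andP[ax xs] sb]; split=> //; [exact: ltW|exact: IH].
Qed.

Lemma variation_pairs a b s (h : R -> R) : itv_partition a b s ->
  variation a b h s = \sum_(u <- pairs a s) `|h u.2 - h u.1|.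
Proof. by move=> /variation_zip ->; rewrite big_map. Qed.

Lemma sum_pairs a b s : itv_partition a b s ->
  \sum_(u <- pairs a s) (u.2 - u.1) = b - a.
Proof.
rewrite /itv_partition /pairs; elim: s a => /= [a [_ /eqP ->]|x s IH a].
  by rewrite big_nil subrr.
by move=> [/andP[ax xs] sb]; rewrite big_cons IH//=; ring.
Qed.

(** The weight w p q stands for the variation over [p, q], measured by an
increment or by a total variation. *)
Definition abs_cont a b (w : R -> R -> R) := forall e, 0 < e ->
  exists2 d, 0 < d & forall l, chain a b l ->
    \sum_(u <- l) (u.2 - u.1) < d -> \sum_(u <- l) w u.1 u.2 <= e.

Lemma chain_nth a b l : chain a b l ->
  (forall k, (k < size l)%N -> let u := nth (0, 0) l k in
    [/\ a <= u.1, u.1 <= u.2 & u.2 <= b]) /\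
  (forall k, (k.+1 < size l)%N -> (nth (0, 0) l k).2 <= (nth (0, 0) l k.+1).1).
Proof.
elim: l a => //= u l IH a [au uu cl]; have [H1 H2] := IH _ cl; split.
  move=> [_|k]; first by split=> //; exact: chain_le cl.
  rewrite ltnS => /H1[H3 H4 H5]; split=> //.
  by rewrite (le_trans au)// (le_trans uu).
move=> [|k]; rewrite ltnS; last exact: H2.
by case: l {IH H1 H2} cl => //= v l [].
Qed.

Lemma isACJ_abs_cont (h : R -> R) : isACJ h ->
  abs_cont (- 2^-1) 2^-1 (fun p q => `|h q - h p|).
Proof.
move=> ac e e0; have [d d0 H] := ac e e0; exists d => // l cl sl.
have [H1 H2] := chain_nth cl.
rewrite (big_nth (0, 0)) big_mkord.
apply/ltW/(H (size l) (fun k => (nth (0, 0) l k).1)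
  (fun k => (nth (0, 0) l k).2)) => //.
  move=> k /H1 /= [h1 h2 h3]; rewrite /J /= !in_itv/= h1 h2 h3.
  by rewrite (le_trans h2)// (le_trans h1).
by move: sl; rewrite (big_nth (0, 0)) big_mkord.
Qed.

(** The total variation over a chain is approximated by refining its cells one at
a time: pre holds the cells already refined, on which increments are summed, and
l those on which the total variation is still to be replaced. *)
Lemma abs_cont_total_variation a b (h : R -> R) :
  bounded_variation a b h -> abs_cont a b (fun p q => `|h q - h p|) ->
  abs_cont a b (fun p q => fine (total_variation p q h)).
Proof.
move=> bv ac e e0; have [d d0 H] := ac e e0; exists d => // l0.
suff {l0} G l pre : chain a b (pre ++ l) ->
    \sum_(u <- pre ++ l) (u.2 - u.1) < d ->
    \sum_(u <- pre) `|h u.2 - h u.1| +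
      \sum_(u <- l) fine (total_variation u.1 u.2 h) <= e.
  by move=> cl sl; have := G l0 [::] cl sl; rewrite big_nil add0r.
elim: l pre => [pre|[p q] l IH pre].
  by rewrite cats0 big_nil addr0 => *; exact: H.
move=> /chain_cat[c cpre /= [cp pq cl]] sl.
have ap : a <= p by rewrite (le_trans (chain_le cpre)).
have bvpq : bounded_variation p q h.
  apply: (bounded_variationl pq (chain_le cl)).
  by apply: (bounded_variationr ap _ bv); rewrite (le_trans pq)// (chain_le cl).
rewrite big_cons /= addrCA -lerBrDr -lee_fin fineK; last first.
  exact/bounded_variationP.
apply: ge_ereal_sup => _ [_ [s sp <-] <-]; rewrite lee_fin lerBrDr.
apply: le_trans (IH (pre ++ pairs p s) _ _).
- by rewrite (variation_pairs h sp) big_cat/= addrA [X in X + _ <= _]addrC.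
- rewrite -catA; apply/chain_cat; exists c => //; apply/chain_cat; exists q => //.
  exact: chain_lel cp (chain_pairs sp).
move: sl; rewrite !big_cat/= big_cons/= (sum_pairs sp).
by rewrite addrA.
Qed.

End chain.

(** * Density of an absolutely continuous Stieltjes measure *)

Section density.
Context {R : realType}.
Variable F : cumulative R R.
Local Notation ls := (lebesgue_stieltjes_measure F).
Local Notation leb := (@lebesgue_measure R).

Lemma stieltjes_ocitv (x y : R) : x <= y -> ls `]x, y]%classic = (F y - F x)%:E.
Proof.
move=> xy; rewrite /lebesgue_stieltjes_measure /measure_extension.
rewrite measurable_mu_extE/=; last exact: is_ocitv.
by rewrite wlength_itv_bnd//; exact: cumulative_is_nondecreasing.
Qed.

(** Only finite subfamilies of the cover are used, which allows the absolute
continuity of F to be applied to finitely many intervals. *)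
Lemma lebesgue_measure_null_cover (N : set R) (e : R) :
  leb N = 0%E -> 0 < e ->
  exists2 A : nat -> set R, (forall i, ocitv (A i)) /\ N `<=` \bigcup_i A i &
   forall m, (leb (\big[setU/set0]_(i < m) A i) < e%:E)%E.
Proof.
move=> N0 e0; have : (leb N < e%:E)%E by rewrite N0 lte_fin.
move=> /ereal_inf_lt[z [/= A covA sA zE]].
have ocA i : ocitv (A i) by case: covA => /(_ i).
have mA i : measurable (A i : set (measurableTypeR R)) by have /ocitvP[->|[x _ ->]] := ocA i; [exact: measurable0|exact: measurable_itv].
exists A; first by split=> //; case: covA.
move=> m; apply: le_lt_trans zE.
apply: (@le_trans _ _ (\sum_(i < m) leb (A i))%E).
  by apply: (Boole_inequality lebesgue_measure) => i _; exact: mA.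
rewrite -sA.
apply: (@le_trans _ _ (\sum_(0 <= i < m) wlength idfun (A i))%E).
  rewrite big_mkord lee_sum// => i _.
  rewrite /lebesgue_measure /lebesgue_stieltjes_measure /measure_extension.
  by rewrite measurable_mu_extE//=; case: covA => /(_ i).
by apply: nneseries_lim_ge => k _ _; exact: wlength_ge0.
Qed.

Variables (a b : R).
Hypothesis ab : a < b.

Let D : set (measurableTypeR R) := `]a, b]%classic.
Let mD : measurable D. Proof. exact: measurable_itv. Qed.
Let lsD : (ls D < +oo)%E. Proof. by rewrite stieltjes_ocitv ?ltW ?ltry. Qed.
Let nu : {finite_measure set (measurableTypeR R) -> \bar R} := mfrestr mD lsD.

Let clamp x : R := Num.max a (Num.min x b).

Let clamp_ge x : a <= clamp x. Proof. by rewrite le_max lexx. Qed.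
Let clamp_le x : clamp x <= b.
Proof. by rewrite ge_max ge_min lexx orbT (ltW ab). Qed.
Let clamp_homo : {homo clamp : x y / x <= y}.
Proof.
move=> x y xy; rewrite ge_max !le_max lexx/= le_min !ge_min xy lexx !orbT.
by [].
Qed.

Lemma ocitvI_cells (A : set R) : ocitv A -> exists u : R * R,
  [/\ a <= u.1, u.1 <= u.2, u.2 <= b & A `&` D = `]u.1, u.2]%classic].
Proof.
move=> /ocitvP[->|[[x y] /= /ltW xy ->]].
  exists (a, a); split=> //=; first exact: ltW.
  by rewrite set0I set_itvoc0.
exists (clamp x, clamp y); split=> //=; first exact: clamp_homo.
apply/seteqP; split=> t /=; rewrite /D /clamp /= !in_itv/= !(gt_max, le_max, gt_min, le_min).
  by case=> /andP[-> ->] /andP[-> ->]; rewrite orbT.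
move=> /andP[/andP[at_ /orP h1] /orP h2].
by case: h2 => [|/andP[ty tb]]; [lra|split; rewrite ?at_ ?tb ?ty ?andbT //; lra].
Qed.

(** A null set is covered by half-open intervals of small total length; finitely
many of them are made into a chain, on which F has a small increment, and the
bound passes to the limit. *)
Lemma stieltjes_dominated : abs_cont a b (fun p q => F q - F p) -> nu `<< leb.
Proof.
move=> ac; apply/null_content_dominatesP => N mN N0.
apply/eqP; rewrite eq_le measure_ge0 andbT.
apply/lee_addgt0Pr => e e0; rewrite add0e.
have [d d0 H] := ac e e0.
have [A [ocA NA] lebA] := lebesgue_measure_null_cover N0 d0.
have mA i : measurable (A i : set (measurableTypeR R)) by have /ocitvP[->|[x _ ->]] := ocA i; [exact: measurable0|exact: measurable_itv].
apply: (@le_trans _ _ (nu (\bigcup_i A i))).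
  by apply: le_measure; rewrite ?inE//; exact: bigcup_measurable.
pose B m := \big[setU/set0]_(i < m.+1) A i.
have mB m : measurable (B m : set (measurableTypeR R)) by apply: bigsetU_measurable => i _; exact: mA.
have -> : \bigcup_i A i = \bigcup_m B m by rewrite bigcup_bigsetU_bigcup.
have ndB : nondecreasing_seq B.
  by move=> m n mn; apply/subsetPset; exact: subset_bigsetU.
have cvgB := @nondecreasing_cvg_mu _ _ _ nu B mB
  (bigcup_measurable (fun k _ => mB k)) ndB.
rewrite -(cvg_lim _ cvgB)//.
apply: lime_le; first by apply/cvg_ex; eexists; exact: cvgB.
apply: nearW => m /=.
have [u_ Hu] := choice (fun i => ocitvI_cells (ocA i)).
pose L := [seq u_ i | i <- iota 0 m.+1].
have BE : B m `&` D = cells L.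
  rewrite /B -bigcup_mkord setI_bigcupl /cells -bigcup_seq.
  apply/seteqP; split=> x [].
    move=> i im; have [_ _ _ ->] := Hu i => xi; exists (u_ i) => //=.
    by rewrite map_f// mem_iota.
  move=> u /= /mapP[i]; rewrite mem_iota add0n => im -> xi; exists i => //.
  by have [_ _ _ ->] := Hu i.
have [||l cl lE] := @cells_disjointify R a b L; first exact: ltW.
  by move=> u /mapP[i _ ->]; have [] := Hu i.
rewrite /nu /= /mfrestr /mrestr BE -lE.
rewrite (@measure_cells _ _ F a b)//; last first.
  by move=> x y _ xy _; exact: stieltjes_ocitv.
rewrite lee_fin; apply: H => //.
rewrite -lte_fin -(@measure_cells _ leb idfun a b)//; last first.
  move=> x y _ xy _; apply: etrans (lebesgue_measure_itv `]x, y]) _; rewrite /= lte_fin.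
  by case: ltgtP xy => // -> _; rewrite subrr.
apply: le_lt_trans (lebA m.+1); rewrite lE -BE.
by apply: le_measure; rewrite ?inE; [exact: measurableI (mB m) mD|exact: mB|exact: subIsetl].
Qed.

(** Radon-Nikodym gives a density, and Lebesgue differentiation identifies it with
the derivative of F. *)
Lemma stieltjes_density : abs_cont a b (fun p q => F q - F p) ->
  exists f : R -> R,
  [/\ forall x, 0 <= f x,
      leb.-integrable setT (EFin \o f),
      forall x y, a <= x -> x <= y -> y <= b ->
        \int[leb]_(t in `]x, y]) f t = F y - F x &
      {ae leb, forall x, a < x < b -> is_derive x 1 (F : R -> R) (f x)}].
Proof.
move=> ac.
have [g [g0 gfin ig gE]] := radon_nikodym_sigma_finite (stieltjes_dominated ac).
pose f x := fine (g x).
have fE : EFin \o f = g by apply/funext => x /=; rewrite fineK.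
have intf : leb.-integrable setT (EFin \o f) by rewrite fE.
have intE x y : a <= x -> x <= y -> y <= b ->
    \int[leb]_(t in `]x, y]) f t = F y - F x.
  move=> ax xy yb; rewrite /Rintegral -[RHS]/(fine (F y - F x)%:E).
  congr fine; rewrite -(stieltjes_ocitv xy).
  transitivity (nu `]x, y]%classic).
    rewrite gE; last exact: measurable_itv.
    by apply: eq_integral => t _; rewrite /f fineK.
  rewrite /nu /= /mfrestr /mrestr setIidl// => t /=; rewrite !in_itv/=.
  move=> /andP[xt ty]; apply/andP; split; first exact: le_lt_trans xt.
  exact: le_trans yb.
have intS A : measurable A -> leb.-integrable A (EFin \o f).
  by move=> mA; exact: integrableS intf.
exists f; split => //; first by move=> x; rewrite fine_ge0.
have /FTC1Ny : forall y : R, leb.-integrable `]-oo, y] (EFin \o f).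
  by move=> y; apply: intS; exact: measurable_itv.
move=> /(_ (open_integrable_locally openT intf)) /=.
apply: filterS; first exact: (ae_filter_ringOfSetsType leb).
pose G (x : R) := \int[leb]_(t in `]-oo, x]) f t.
move=> x [] /=; rewrite -/G => dG Gx /andP[ax xb].
have GF : \near x, G x + (F a - G a) = F x.
  have xab : x \in `]a, b[ by rewrite in_itv/= ax.
  near=> y.
  have : y \in `]a, b[ by near: y; exact: near_in_itvoo.
  rewrite in_itv/= => /andP[ay yb].
  rewrite addrCA /G Rintegral_itvB ?bnd_simp ?ltW//; last first.
    by apply: intS; exact: measurable_itv.
  by rewrite (intE _ _ (lexx a) (ltW ay) (ltW yb)) addrC subrK.
apply: near_eq_is_derive GF _.
rewrite -[f x]addr0; apply: is_deriveD.
by apply: DeriveDef; [exact: dG|rewrite -derive1E; exact: Gx].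
Unshelve. all: by end_near. Qed.

End density.

(** * Density of an absolutely continuous function *)

Section ac_density.
Context {R : realType}.
Local Notation leb := (@lebesgue_measure R).
Variables (a b : R).
Hypothesis ab : a < b.

Let clamp x : R := Num.max a (Num.min x b).

Let clampE x : a <= x -> x <= b -> clamp x = x.
Proof. by move=> ax xb; rewrite /clamp min_l// max_r. Qed.

Let clamp_itv x : a <= clamp x <= b.
Proof. by rewrite /clamp le_max lexx ge_max ge_min lexx orbT (ltW ab). Qed.

Let clamp_homo : {homo clamp : x y / x <= y}.
Proof.
by move=> x y xy; rewrite ge_max !le_max lexx/= le_min !ge_min xy lexx !orbT.
Qed.

Let clamp_lip x y : x <= y -> clamp y - clamp x <= y - x.
Proof.
move=> xy; rewrite /clamp; have [xb|xb] := leP x b; have [yb|yb] := leP y b;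
  do 2?[case: (leP a _) => ?]; move: ab; lra.
Qed.

(** Reduced to Stieltjes measures by extending P with constants outside of [a, b],
so that it becomes a cumulative function on the whole line. *)
Lemma monotone_density (P : R -> R) :
  (forall x y, a <= x -> x <= y -> y <= b -> P x <= P y) ->
  abs_cont a b (fun p q => P q - P p) ->
  exists f : R -> R,
  [/\ forall x, 0 <= f x,
      leb.-integrable setT (EFin \o f),
      forall x y, a <= x -> x <= y -> y <= b ->
        \int[leb]_(t in `]x, y]) f t = P y - P x &
      {ae leb, forall x, a < x < b -> is_derive x 1 (P : R -> R) (f x)}].
Proof.
move=> ndP ac; pose Q : R -> R := P \o clamp.
have ndQ : nondecreasing Q.
  move=> x y xy; have /andP[ax _] := clamp_itv x; have /andP[_ yb] := clamp_itv y.
  by apply: ndP => //; exact: clamp_homo.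
have rcQ : forall x, Q @ x^'+ --> Q x.
  move=> x; apply/cvgrPdist_le => e e0; have [d d0 H] := ac e e0.
  near=> y; have xy : x < y by near: y; exact: nbhs_right_gt.
  have xQy : Q x <= Q y by apply: ndQ; exact: ltW.
  rewrite distrC ger0_norm ?subr_ge0//.
  have /andP[ax _] := clamp_itv x; have /andP[_ yb] := clamp_itv y.
  have := H [:: (clamp x, clamp y)]; rewrite !big_seq1 /=; apply.
    by split=> //; apply: clamp_homo; exact: ltW.
  apply: le_lt_trans (clamp_lip (ltW xy)) _; rewrite ltrBlDl.
  by near: y; apply: nbhs_right_lt; rewrite ltrDl.
pose cumQ : cumulative R R := HB.pack Q (isCumulative.Build R _ R Q ndQ rcQ).
have QE x : a <= x -> x <= b -> cumQ x = P x by move=> ax xb; rewrite /= /Q /= clampE.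
have acQ : abs_cont a b (fun p q => cumQ q - cumQ p).
  move=> e e0; have [d d0 H] := ac e e0; exists d => // l cl sl.
  have := H l cl sl; congr (_ <= _); rewrite !big_seq; apply: eq_bigr => u ul.
  move: (ul) => /(nthP (0, 0))[k kl ukE].
  have [/(_ k kl) + _] := chain_nth cl; rewrite ukE => -[au uu ub].
  by rewrite !QE// ?(le_trans au)// ?(le_trans uu).
have [f [f0 intf fE df]] := stieltjes_density ab acQ.
exists f; split => // [x y ax xy yb|].
  by rewrite fE// !QE// ?(le_trans ax)// ?(le_trans xy).
apply: filterS df; first exact: (ae_filter_ringOfSetsType leb).
move=> x dQ /andP[ax xb]; have := dQ; rewrite ax xb => /(_ isT).
apply: near_eq_is_derive.
have xab : x \in `]a, b[ by rewrite in_itv/= ax.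
near=> y; have : y \in `]a, b[ by near: y; exact: near_in_itvoo.
by rewrite in_itv/= => /andP[ay yb]; apply: QE; exact: ltW.
Unshelve. all: by end_near. Qed.

(** With T the total variation function, (T + h) / 2 and (T - h) / 2 are
nondecreasing and absolutely continuous. If p and q are their densities, then
p - q is a density of h and p + q one of T, which is why the former is bounded
by the latter. *)
Lemma abs_cont_density (h : R -> R) (T := fun x => fine (total_variation a x h)) :
  bounded_variation a b h -> abs_cont a b (fun p q => `|h q - h p|) ->
  exists f g : R -> R,
  [/\ leb.-integrable setT (EFin \o f) /\ leb.-integrable setT (EFin \o g),
      forall x, `|f x| <= g x,
      forall x y, a <= x -> x <= y -> y <= b ->
        \int[leb]_(t in `]x, y]) f t = h y - h x,
      forall x y, a <= x -> x <= y -> y <= b ->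
        \int[leb]_(t in `]x, y]) g t = T y - T x &
      {ae leb, forall x, a < x < b -> derive1 h x = f x}].
Proof.
move=> bv ac.
have TB x y : a <= x -> x <= y -> y <= b ->
    T y - T x = fine (total_variation x y h).
  move=> ax xy yb; rewrite /T (total_variationD _ ax xy) fineD.
  - by rewrite addrAC subrr add0r.
  - apply/bounded_variationP => //; apply: bounded_variationl ax _ bv.
    exact: le_trans yb.
  - apply/bounded_variationP => //; apply: (bounded_variationl xy yb).
    by apply: bounded_variationr ax _ bv; exact: le_trans yb.
have Th x y : a <= x -> x <= y -> y <= b -> `|h y - h x| <= T y - T x.
  move=> ax xy yb; rewrite TB// -lee_fin fineK ?total_variation_ge//.
  apply/bounded_variationP => //; apply: (bounded_variationl xy yb).
  by apply: bounded_variationr ax _ bv; exact: le_trans yb.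
have acT := abs_cont_total_variation bv ac.
have mono (s : R) : `|s| <= 1 -> let P := fun x => 2^-1 * (T x + s * h x) in
   (forall x y, a <= x -> x <= y -> y <= b -> P x <= P y) /\
   abs_cont a b (fun p q => P q - P p).
  move=> s1 /=; have Ph x y : a <= x -> x <= y -> y <= b ->
      0 <= 2^-1 * (T y + s * h y) - 2^-1 * (T x + s * h x) <= T y - T x.
    move=> ax xy yb; have : `|s * (h y - h x)| <= T y - T x.
      by rewrite normrM (le_trans (ler_piMl _ s1))// Th.
    by rewrite mulrBr ler_norml; lra.
  split=> [x y ax xy yb|e e0].
    by have /andP[] := Ph x y ax xy yb; rewrite subr_ge0.
  have [d d0 H] := acT e e0; exists d => // l cl sl.
  apply: le_trans (H l cl sl); rewrite !big_seq; apply: ler_sum => u ul.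
  move: (ul) => /(nthP (0, 0))[k kl ukE].
  have [/(_ k kl) + _] := chain_nth cl; rewrite ukE => -[au uu ub].
  by rewrite -TB//; have /andP[] := Ph _ _ au uu ub.
have [ndp acp] := mono 1 (eq_ind_r (fun z => z <= 1) (lexx 1) (normr1 R)).
have [|ndn acn] := mono (-1); first by rewrite normrN1.
have [p [p0 ip pE dp]] := monotone_density ndp acp.
have [q [q0 iq qE dq]] := monotone_density ndn acn.
have intS (u : R -> R) A : measurable A -> leb.-integrable setT (EFin \o u) ->
    leb.-integrable A (EFin \o u).
  by move=> mA; exact: integrableS.
exists (p \- q), (p \+ q); split.
- split.
    by have := integrableB measurableT ip iq.
  by have := integrableD measurableT ip iq.
- by move=> x /=; rewrite ler_norml; have := p0 x; have := q0 x; lra.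
- move=> x y ax xy yb; rewrite RintegralB//; [|exact: intS..].
  by rewrite pE// qE//; lra.
- move=> x y ax xy yb; rewrite RintegralD//; [|exact: intS..].
  by rewrite pE// qE//; lra.
- apply: (filterS2 _ _ dp dq); first exact: (ae_filter_ringOfSetsType leb).
  move=> x dpx dqx xab; rewrite derive1E.
  have := is_deriveB (dpx xab) (dqx xab).
  set k := (X in is_derive _ _ X _) => dk.
  have -> : h = k.
    apply/funext => y.
    rewrite -[RHS]/(2^-1 * (T y + 1 * h y) - 2^-1 * (T y + -1 * h y)); lra.
  by have [] := dk.
Qed.

End ac_density.

(** * Integration against the derivative of a dynamic value *)

Section jump.
Context {R : realType}.
Local Notation leb := (@lebesgue_measure R).
Local Notation hlf := (2^-1 : R).
Local Notation Nhlf := (- 2^-1 : R).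

Lemma hlf_gt0 : 0 < hlf. Proof. by rewrite invr_gt0. Qed.

Lemma NhlfLhlf : Nhlf < hlf.
Proof. by have := hlf_gt0; lra. Qed.

Lemma JE (s : R) : J s = (Nhlf <= s <= hlf) :> Prop.
Proof. by rewrite /J /= in_itv. Qed.

Lemma isACJ_unif (h : R -> R) : isACJ h -> forall e, 0 < e ->
  exists2 d, 0 < d & forall p q, J p -> J q -> `|q - p| < d -> `|h q - h p| <= e.
Proof.
move=> /isACJ_abs_cont ac e e0; have [d d0 H] := ac e e0; exists d => //.
have {}H p q : J p -> J q -> p <= q -> q - p < d -> `|h q - h p| <= e.
  rewrite !JE => /andP[p1 p2] /andP[q1 q2] pq pqd.
  by have := H [:: (p, q)]; rewrite !big_seq1 /=; apply.
move=> p q Jp Jq; have [pq|/ltW qp] := leP p q.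
  by rewrite ger0_norm ?subr_ge0//; exact: H.
by rewrite ler0_norm ?subr_le0// opprB distrC; exact: H.
Qed.

Lemma isACJ_cvg (h : R -> R) s : isACJ h -> Nhlf < s < hlf -> h @ s --> h s.
Proof.
move=> ac sJ; apply/cvgrPdist_le => e e0; have [d d0 H] := isACJ_unif ac e0.
near=> y.
have : y \in `]Nhlf, hlf[ by near: y; apply: near_in_itvoo; rewrite in_itv.
rewrite in_itv/= => /andP[y1 y2]; apply: H.
- by rewrite JE !ltW.
- by rewrite JE; have /andP[/ltW -> /ltW ->] := sJ.
- by near: y; exact: cvgr_dist_lt.
Unshelve. all: by end_near. Qed.

Lemma isACJ_llim (h : R -> R) s : isACJ h -> Nhlf < s < hlf -> llim h s = h s.
Proof.
by move=> ac sJ; apply/cvg_lim => //; apply/cvg_at_left_filter/isACJ_cvg.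
Qed.

Lemma isACJ_rlim (h : R -> R) s : isACJ h -> Nhlf < s < hlf -> rlim h s = h s.
Proof.
by move=> ac sJ; apply/cvg_lim => //; apply/cvg_at_right_filter/isACJ_cvg.
Qed.

(** The variation that bounds elements of sBV is taken over the open interval,
with one-sided limits. Contracting a partition towards 0 by a factor z close to 1
moves its points inside, at an arbitrarily small cost by uniform continuity. *)
Lemma total_variation_J_le_var (h : R -> R) : isACJ h ->
  (total_variation Nhlf hlf h <= var Nhlf%:E hlf%:E h)%E.
Proof.
move=> ac; apply: ge_ereal_sup => _ [_ [s sp <-] <-].
apply/lee_addgt0Pr => e e0.
have [d d0 H] := isACJ_unif ac (divr_gt0 e0 (ltr0Sn R (2 * size s))).
(* contraction factor: it moves the points of J by less than d *)
pose z : R := 1 - Num.min hlf (d / 2).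
have z01 : 0 < z < 1.
  have : 0 < Num.min hlf (d / 2) by rewrite lt_min hlf_gt0 divr_gt0.
  have : Num.min hlf (d / 2) <= hlf by rewrite ge_min lexx.
  by rewrite /z; have := hlf_gt0; lra.
have zJ x : J x -> Nhlf < z * x < hlf.
  by rewrite JE => /andP[? ?]; have := hlf_gt0; case/andP: z01; nra.
have zd x : J x -> `|h x - h (z * x)| <= e / (2 * size s).+1%:R.
  move=> Jx; apply: H => //.
    by rewrite JE; have /andP[/ltW -> /ltW ->] := zJ x Jx.
  rewrite -[X in X - _]mul1r -mulrBl /z opprB addrC subrK normrM.
  have m0 : 0 <= Num.min hlf (d / 2) by rewrite le_min (ltW hlf_gt0) divr_ge0// ltW.
  have xh : `|x| <= hlf by move: Jx; rewrite JE ler_norml.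
  rewrite (ger0_norm m0).
  have : Num.min hlf (d / 2) <= d / 2 by rewrite ge_min lexx orbT.
  have := hlf_gt0; have : hlf <= 1 by lra.
  have := normr_ge0 x.
  by nra.
pose t k := nth hlf (Nhlf :: s) k.
have [sp1 /eqP sp2] := sp.
have t_lt k : (k < size s)%N -> t k < t k.+1.
  by move=> ks; have /(pathP hlf) := sp1; apply.
have t_le : {in [pred k | (k <= size s)%N] &, {homo t : i j / (i <= j)%N >-> i <= j}}.
  move=> i j; rewrite !inE => si sj ij.
  by rewrite /t (@lt_sorted_leq_nth _ _ hlf (Nhlf :: s) sp1).
have tJ k : (k <= size s)%N -> J (t k).
  move=> ks; rewrite JE; apply/andP; split.
    by apply: (t_le 0%N k); rewrite ?inE.
  have -> : hlf = t (size s) by rewrite -[LHS]sp2 (last_nth hlf).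
  by apply: (t_le k (size s)); rewrite ?inE.
apply: (@le_trans _ _ ((\sum_(k < size s) `|h (z * t k.+1) - h (z * t k)|)%:E + e%:E)%E).
  rewrite -EFinD lee_fin /variation big_mkord.
  apply: (@le_trans _ _ (\sum_(k < size s) (`|h (z * t k.+1) - h (z * t k)| +
      (e / (2 * size s).+1%:R) *+ 2))).
    apply: ler_sum => k _; rewrite -/(t k.+1) -/(t k).
    have h1 := zd _ (tJ k.+1 (ltn_ord k)); have h2 := zd _ (tJ k (ltnW (ltn_ord k))).
    rewrite /= -/(t k.+1) -/(t k).
    rewrite (_ : h (t k.+1) - h (t k) = (h (z * t k.+1) - h (z * t k)) +
      ((h (t k.+1) - h (z * t k.+1)) - (h (t k) - h (z * t k)))); last by ring.
    rewrite (le_trans (ler_normD _ _))// lerD2l mulr2n.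
    by rewrite (le_trans (ler_normB _ _))// lerD.
  rewrite big_split/= lerD2l sumr_const card_ord -mulrnA -[X in X <= _]mulr_natr -mulrA.
  rewrite ler_piMr ?(ltW e0)// mulrC ler_pdivrMr ?ltr0Sn// mul1r ler_nat.
  exact: leqnSn.
rewrite leeD2r//; apply: ereal_sup_ubound; exists (size s), (fun k => z * t k).
have zt k : (k <= size s)%N -> Nhlf < z * t k < hlf by move=> /tJ/zJ.
split.
- by move=> k /zt /andP[? ?]; rewrite /oitv /= !lte_fin.
- by move=> k /t_lt; rewrite ltr_pM2l//; case/andP: z01.
- congr EFin; apply: eq_bigr => k _; rewrite isACJ_llim ?isACJ_rlim//.
    by apply: zt; exact: ltnW.
  exact: zt.
Qed.

(** Off a null set the integrand is squeezed between b f - e g and b f + e g, with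
f and g the densities of h and of its total variation. Squeezing is the way to
deal with q, whose measurability is unknown. *)
Lemma jump_integral (h q F : R -> R) (s1 s2 b e : R)
    (T := fun x => fine (total_variation Nhlf x h)) :
  isACJ h -> bounded_variation Nhlf hlf h ->
  Nhlf <= s1 -> s1 <= s2 -> s2 <= hlf ->
  (forall s, s1 < s < s2 -> `|q s - b| <= e /\ F s = q s * derive1 h s) ->
  (forall s, J s -> s < s1 \/ s2 < s -> F s = 0) ->
  `|\int[leb]_(s in @J R) F s - b * (h s2 - h s1)| <= e * (T s2 - T s1).
Proof.
move=> ac bv s1J s12 s2J FE F0.
have [f [g [[intf intg] fg fE gE [N0 [mN0 N00 dfN]]]]] :=
  abs_cont_density NhlfLhlf bv (isACJ_abs_cont ac).
have mJ : measurable (@J R : set (measurableTypeR R)) by exact: measurable_itv.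
have mS : measurable (`]s1, s2]%classic : set (measurableTypeR R)).
  exact: measurable_itv.
have JS : @J R `&` `]s1, s2]%classic = `]s1, s2]%classic.
  rewrite setIidr// => x; rewrite JE /= in_itv/= => /andP[x1 x2].
  by rewrite (le_trans s1J (ltW x1)) (le_trans x2).
pose k (c : R) x := b * f x + c * g x.
have intk c A : measurable A -> leb.-integrable A (EFin \o k c).
  move=> mA; apply: (@integrableS _ _ _ _ setT) => //.
  rewrite (_ : EFin \o k c = (fun x => (b%:E * (f x)%:E + c%:E * (g x)%:E)%E))//.
  by apply: integrableD => //; apply: integrableZl.
have intkE c : \int[leb]_(s in @J R) ((k c) \_ `]s1, s2]%classic) s =
    b * (h s2 - h s1) + c * (T s2 - T s1).
  rewrite -Rintegral_mkcondr JS.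
  have intfS (u : R -> R) : leb.-integrable setT (EFin \o u) ->
      leb.-integrable `]s1, s2]%classic (EFin \o u).
    by move=> ?; apply: (@integrableS _ _ _ _ setT).
  rewrite RintegralD//.
  - by rewrite RintegralZl ?RintegralZl ?fE ?gE//; exact: intfS.
  - by have := integrableZl mS b (intfS _ intf).
  - by have := integrableZl mS c (intfS _ intg).
have intkr c : leb.-integrable (@J R) (EFin \o ((k c) \_ `]s1, s2]%classic)).
  rewrite (_ : EFin \o _ = (EFin \o k c) \_ `]s1, s2]%classic); last first.
    by apply/funext => x; rewrite /= /patch; case: ifP.
  apply/(integrable_restrict _ mS mJ); rewrite JS.
  exact: intk.
pose N := N0 `|` [set s1] `|` [set s2] `|` [set hlf].
have mN : measurable N.
  by do 3?[apply: measurableU; last exact: measurable_set1].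
have N0E : leb N = 0%E.
  by rewrite !null_set_setU//; do ?[apply: measurableU];
    rewrite //= ?lebesgue_measure_set1//; exact: measurable_set1.
have := ae_le_Rintegral_sandwich mJ mN N0E (intkr (- e)) (intkr e).
move=> /(_ F); rewrite !intkE ler_norml mulNr; move=> Hs.
suff /Hs : forall x : R, J x -> ~ N x ->
   (patch (fun=> 0) `]s1, s2]%classic (k (- e))) x <= F x <= (patch (fun=> 0) `]s1, s2]%classic (k e)) x.
  by move=> /andP[? ?]; apply/andP; split; lra.
move=> x Jx Nx.
have [x1|x1] := ltP x s1.
  rewrite F0; [|by []|by left].
  by rewrite /patch memNset ?lexx//= in_itv/= => /andP[]; lra.
have [x2|x2] := ltP s2 x.
  rewrite F0; [|by []|by right].
  by rewrite /patch memNset ?lexx//= in_itv/= => /andP[]; lra.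
have {}x1 : s1 < x.
  rewrite lt_neqAle x1 andbT; apply: contra_notN Nx => /eqP s1x.
  by left; left; right => /=; rewrite s1x.
have xS : x < s2.
  by rewrite lt_neqAle x2 andbT; apply: contra_notN Nx => /eqP ->; left; right.
have [|qb ->] := FE x; first by rewrite x1.
have xhlf : Nhlf < x < hlf by rewrite (le_lt_trans s1J) ?(lt_le_trans xS).
have -> : derive1 h x = f x.
  apply: contrapT => dx; apply: Nx; left; left; left; apply: dfN => /= /(_ xhlf).
  by [].
rewrite /patch mem_set /=; last by rewrite in_itv/= x1.
rewrite /k; have := fg x; move: qb; rewrite !ler_norml => /andP[q1 q2] /andP[f1 f2].
have g0 : 0 <= g x by lra.
suff : `|(q x - b) * f x| <= e * g x by rewrite ler_norml; lra.
by rewrite normrM ler_pM// ler_norml ?q1 ?q2 ?f1 ?f2.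
Qed.

End jump.

(** * Real induction and Riemann-Stieltjes integrals *)

Section real_induction.
Context {R : realType}.

(** The supremum of the points up to which P holds is reached by the second
hypothesis, and can only be d by the third one. *)
Lemma real_induction (P : R -> Prop) (c d : R) :
  (c <= d -> P c) ->
  (forall b, c < b -> b <= d -> (forall t, c <= t -> t < b -> P t) -> P b) ->
  (forall b, c <= b -> b < d -> (forall t, c <= t -> t <= b -> P t) ->
     exists2 eta, 0 < eta & forall t, b < t -> t < b + eta -> t <= d -> P t) ->
  forall t, c <= t -> t <= d -> P t.
Proof.
move=> Pc Pl Pr t ct td.
have {}Pc := Pc (le_trans ct td).
pose S := [set b | [/\ c <= b, b <= t & forall s, c <= s -> s <= b -> P s]].
have Sc : S c by split=> // s cs sc; have -> : s = c by apply/le_anti; rewrite sc.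
have supS : has_sup S by split; [exists c|exists t => b []].
pose b := sup S.
have cb : c <= b by apply: ub_le_sup => //; case: supS.
have bt : b <= t by apply: ge_sup => [|x []//]; exists c.
have Plt s : c <= s -> s < b -> P s.
  move=> cs sb; have [x [_ _ xP] sx] := sup_gt (ex_intro _ c Sc) sb.
  by apply: xP => //; exact: ltW.
have Pb s : c <= s -> s <= b -> P s.
  move=> cs; rewrite le_eqVlt => /predU1P[->|]; last exact: Plt.
  move: cb; rewrite le_eqVlt => /predU1P[<-//|cb].
  by apply: Pl => //; exact: le_trans td.
have [<-|btn] := eqVneq b t; first by apply: Pb.
have {}bt : b < t by rewrite lt_neqAle btn.
have [eta eta0 He] := Pr b cb (lt_le_trans bt td) Pb.
pose b' := Num.min t (b + eta / 2).
have bb' : b < b' by rewrite lt_min bt ltrDl divr_gt0.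
suff : S b' by move=> /(ub_le_sup (proj2 supS)); rewrite leNgt bb'.
split; first by rewrite (le_trans cb)// ltW.
  by rewrite ge_min lexx.
move=> s cs sb'; have [|bs] := leP s b; first exact: Pb.
apply: He => //; last by rewrite (le_trans sb')// ge_min td.
by rewrite (le_lt_trans sb')// gt_min ltrD2l gtr_pMr// orbC invf_lt1// ltr1n.
Qed.

Lemma near_at_leftP (P : R -> Prop) (b : R) : (\forall t \near b^'-, P t) <->
  exists2 eta, 0 < eta & forall t, b - eta < t -> t < b -> P t.
Proof.
split=> [/nbhs_ballP[eta /= eta0 H]|[eta eta0 H]].
  exists eta => // t bt tb; apply: H => //=.
  by rewrite /ball/= ger0_norm ?subr_ge0 ?ltW//; lra.
apply/nbhs_ballP; exists eta => //= t /=; rewrite /ball/= => bt tb; apply: H => //.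
by move: bt; rewrite ger0_norm ?subr_ge0 ?ltW//; lra.
Qed.

Lemma near_at_rightP (P : R -> Prop) (b : R) : (\forall t \near b^'+, P t) <->
  exists2 eta, 0 < eta & forall t, b < t -> t < b + eta -> P t.
Proof.
split=> [/nbhs_ballP[eta /= eta0 H]|[eta eta0 H]].
  exists eta => // t bt tb; apply: H => //=.
  by rewrite /ball/= ler0_norm ?subr_le0 ?ltW//; lra.
apply/nbhs_ballP; exists eta => //= t /=; rewrite /ball/= => bt tb; apply: H => //.
by move: bt; rewrite ler0_norm ?subr_le0 ?ltW//; lra.
Qed.

End real_induction.

Section RS.
Context {R : realType}.
Implicit Types (p q h : R -> R) (a b c d e L : R) (N : nat) (tau xi : nat -> R).

Definition RS_sum p h N tau xi : R :=
  \sum_(k < N) p (xi k) * (h (tau k.+1) - h (tau k)).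

Definition tagged c d del N tau xi : Prop := [/\ tau 0%N = c, tau N = d &
  forall k, (k < N)%N -> [/\ tau k <= xi k, xi k <= tau k.+1 & tau k.+1 - tau k < del]].

Lemma is_RS_integralP p h c d L : is_RS_integral p h c d L <->
  forall e, 0 < e -> exists2 del, 0 < del & forall N tau xi,
    tagged c d del N tau xi -> `|RS_sum p h N tau xi - L| < e.
Proof.
split=> H e e0; have [del del0 K] := H e e0; exists del => // N tau xi.
  by case=> *; exact: K.
by move=> *; apply: K.
Qed.

Lemma tagged_ex c d del : c < d -> 0 < del -> exists N tau xi,
  tagged c d del N tau xi /\ forall k, (k < N)%N -> c < xi k < d.
Proof.
move=> cd del0.
(* enough equal parts for a mesh below del, with tags at the midpoints *)
pose N := (Num.truncn ((d - c) / del)).+1.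
have N0 : 0 < N%:R :> R by rewrite ltr0n.
have Ndel : (d - c) / N%:R < del.
  rewrite ltr_pdivrMr// mulrC -ltr_pdivrMr//.
  by rewrite /N truncnS_gt.
pose w := (d - c) / N%:R.
have w0 : 0 < w by rewrite divr_gt0// subr_gt0.
have wN : w * N%:R = d - c by rewrite /w divfK// gt_eqF.
exists N, (fun k => c + w * k%:R), (fun k => c + w * k%:R + w / 2).
split; first split.
- by rewrite mulr0 addr0.
- by rewrite wN addrC subrK.
- move=> k _; rewrite -[k.+1%:R]natr1 mulrDr mulr1.
  by split; move: Ndel; rewrite -/w; lra.
- move=> k kN; have k1N : (k.+1)%:R <= N%:R :> R by rewrite ler_nat.
  have k0 : 0 <= k%:R :> R by rewrite ler0n.
  have h1 : 0 <= w * k%:R by rewrite mulr_ge0// ltW.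
  have h2 : w * k.+1%:R <= d - c by rewrite -wN ler_pM2l.
  by move: h2; rewrite -[k.+1%:R]natr1 mulrDr mulr1; lra.
Qed.

(** Both limits are approached along one common tagged partition, so the existence
of fine partitions matters. *)
Lemma RS_unique p h c d L1 L2 : c <= d ->
  is_RS_integral p h c d L1 -> is_RS_integral p h c d L2 -> L1 = L2.
Proof.
move=> cd /is_RS_integralP H1 /is_RS_integralP H2.
apply/eqP; rewrite -subr_eq0 -normr_le0; apply/ler_addgt0Pr => e e0; rewrite add0r.
have e20 : 0 < e / 2 by rewrite divr_gt0.
have [d1 d10 K1] := H1 _ e20; have [d2 d20 K2] := H2 _ e20.
have [N [tau [xi T]]] : exists N tau xi, tagged c d (Num.min d1 d2) N tau xi.
  move: cd; rewrite le_eqVlt => /predU1P[->|cd].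
    by exists 0%N, (fun=> d), (fun=> d); split.
  have [|N [tau [xi [T _]]]] := @tagged_ex c d (Num.min d1 d2) cd.
    by rewrite lt_min d10.
  by exists N, tau, xi.
have {}K1 : `|RS_sum p h N tau xi - L1| < e / 2.
  apply: K1; case: T => t1 t2 t3; split=> // k /t3[? ? +].
  by rewrite lt_min => /andP[].
have {}K2 : `|RS_sum p h N tau xi - L2| < e / 2.
  apply: K2; case: T => t1 t2 t3; split=> // k /t3[? ? +].
  by rewrite lt_min => /andP[].
move: K1 K2; rewrite !ltr_norml ler_norml; lra.
Qed.

Lemma tagged_cat a b c del N1 tau1 xi1 N2 tau2 xi2 p h :
  tagged a b del N1 tau1 xi1 -> tagged b c del N2 tau2 xi2 ->
  exists N tau xi, tagged a c del N tau xi /\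
    RS_sum p h N tau xi = RS_sum p h N1 tau1 xi1 + RS_sum p h N2 tau2 xi2.
Proof.
move=> [a1 b1 H1] [b2 c2 H2].
pose tau k := if (k <= N1)%N then tau1 k else tau2 (k - N1)%N.
pose xi k := if (k < N1)%N then xi1 k else xi2 (k - N1)%N.
have tauD k : tau (N1 + k)%N = tau2 k.
  rewrite /tau; case: ifPn => [|_]; last by rewrite addKn.
  by case: k => [|k]; [rewrite addn0 b1 b2|lia].
exists (N1 + N2)%N, tau, xi; split; first split.
- by rewrite /tau leq0n.
- by rewrite tauD.
- move=> k kN; have [k1|k1] := ltnP k N1.
    by rewrite /tau /xi k1 (ltnW k1); exact: H1.
  have -> : k = (N1 + (k - N1))%N by lia.
  rewrite -addnS !tauD /xi ltnNge leq_addr/= addKn.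
  by apply: H2; lia.
- rewrite /RS_sum big_split_ord/=; congr (_ + _); apply: eq_bigr => k _.
    by rewrite /tau /xi ltn_ord (ltnW (ltn_ord k)).
  by rewrite -addnS !tauD /xi ltnNge leq_addr/= addKn.
Qed.

Lemma tagged_le c d del del' N tau xi : del <= del' ->
  tagged c d del N tau xi -> tagged c d del' N tau xi.
Proof.
by move=> dd [t1 t2 t3]; split=> // k /t3[? ? h]; split=> //; exact: lt_le_trans dd.
Qed.

Lemma tagged_ex_le c d del : c <= d -> 0 < del -> exists N tau xi,
  tagged c d del N tau xi.
Proof.
rewrite le_eqVlt => /predU1P[-> _|cd del0].
  by exists 0%N, (fun=> d), (fun=> d); split.
by have [N [tau [xi [T _]]]] := tagged_ex cd del0; exists N, tau, xi.
Qed.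

Lemma RS_cat p h a b c L1 L2 L : a <= b -> b <= c ->
  is_RS_integral p h a b L1 -> is_RS_integral p h b c L2 ->
  is_RS_integral p h a c L -> L = L1 + L2.
Proof.
move=> ab bc /is_RS_integralP H1 /is_RS_integralP H2 /is_RS_integralP H.
apply/eqP; rewrite -subr_eq0 -normr_le0; apply/ler_addgt0Pr => e e0; rewrite add0r.
have e30 : 0 < e / 3 by rewrite divr_gt0.
have [d1 d10 K1] := H1 _ e30; have [d2 d20 K2] := H2 _ e30.
have [d3 d30 K3] := H _ e30.
pose del := Num.min d1 (Num.min d2 d3).
have del0 : 0 < del by rewrite !lt_min d10 d20.
have [N1 [tau1 [xi1 T1]]] := tagged_ex_le ab del0.
have [N2 [tau2 [xi2 T2]]] := tagged_ex_le bc del0.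
have [N [tau [xi [T E]]]] := tagged_cat p h T1 T2.
have {}K1 : `|RS_sum p h N1 tau1 xi1 - L1| < e / 3.
  by apply: K1; apply: tagged_le T1; rewrite ge_min lexx.
have {}K2 : `|RS_sum p h N2 tau2 xi2 - L2| < e / 3.
  by apply: K2; apply: tagged_le T2; rewrite !ge_min lexx orbT.
have {}K3 : `|RS_sum p h N tau xi - L| < e / 3.
  by apply: K3; apply: tagged_le T; rewrite !ge_min lexx !orbT.
move: K1 K2 K3; rewrite E !ltr_norml ler_norml; lra.
Qed.

Lemma RS_scaleD p q h c d L M (k : R) :
  is_RS_integral p h c d L -> is_RS_integral q h c d M ->
  is_RS_integral (fun t => p t + k * q t) h c d (L + k * M).
Proof.
move=> /is_RS_integralP H1 /is_RS_integralP H2; apply/is_RS_integralP => e e0.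
have k0 : 0 < `|k| + 1 by rewrite ltr_wpDl.
have e20 : 0 < e / 2 by rewrite divr_gt0.
have ek0 : 0 < e / 2 / (`|k| + 1) by rewrite divr_gt0.
have [d1 d10 K1] := H1 _ e20; have [d2 d20 K2] := H2 _ ek0.
exists (Num.min d1 d2); first by rewrite lt_min d10.
move=> N tau xi T.
have {}K1 : `|RS_sum p h N tau xi - L| < e / 2.
  by apply: K1; apply: tagged_le T; rewrite ge_min lexx.
have {}K2 : `|RS_sum q h N tau xi - M| < e / 2 / (`|k| + 1).
  by apply: K2; apply: tagged_le T; rewrite !ge_min lexx orbT.
have -> : RS_sum (fun t => p t + k * q t) h N tau xi =
    RS_sum p h N tau xi + k * RS_sum q h N tau xi.
  rewrite /RS_sum mulr_sumr -big_split/=; apply: eq_bigr => i _; ring.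
have -> : RS_sum p h N tau xi + k * RS_sum q h N tau xi - (L + k * M) =
  (RS_sum p h N tau xi - L) + k * (RS_sum q h N tau xi - M) by ring.
rewrite (le_lt_trans (ler_normD _ _))// [X in _ < X]splitr ltr_leD// normrM.
rewrite (le_trans (ler_wpM2l (normr_ge0 _) (ltW K2)))//.
by rewrite mulrCA ler_piMr ?(ltW e20)// ler_pdivrMr// mul1r lerDl.
Qed.

Lemma tagged_itv c d del N tau xi : tagged c d del N tau xi ->
  (forall i j, (i <= j)%N -> (j <= N)%N -> tau i <= tau j) /\
  (forall i, (i <= N)%N -> c <= tau i <= d).
Proof.
move=> [t1 t2 t3].
have t_le : {in [pred k | (k <= N)%N] &, {homo tau : i j / (i <= j)%N >-> i <= j}}.
  apply: homo_leq_in => // [y x z|i j|i].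
  - exact: le_trans.
  - by rewrite !inE => ? jN r /andP[_ /ltnW/leq_trans]; exact.
  - by rewrite !inE => _ /t3[h1 h2 _]; exact: le_trans h2.
split=> [i j ij jN|i iN]; first by rewrite t_le ?inE// (leq_trans ij).
by rewrite -t1 -t2 !t_le ?inE.
Qed.

Lemma sum_increments N (tau : nat -> R) (k : R -> R) :
  \sum_(i < N) (k (tau i.+1) - k (tau i)) = k (tau N) - k (tau 0%N).
Proof.
by rewrite -(big_mkord xpredT (fun i => k (tau i.+1) - k (tau i))) telescope_sumr.
Qed.

(** Only the increments of the integrator matter, hence it may be changed by an
additive constant; this absorbs the base point of the continuous part. *)
Lemma eq_RS p q h k c d L : (forall t, c <= t <= d -> p t = q t) ->
  (forall s t, c <= s <= d -> c <= t <= d -> h t - h s = k t - k s) ->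
  is_RS_integral p h c d L -> is_RS_integral q k c d L.
Proof.
move=> pq hk /is_RS_integralP H; apply/is_RS_integralP => e e0.
have [del del0 K] := H e e0; exists del => // N tau xi T.
suff <- : RS_sum p h N tau xi = RS_sum q k N tau xi by exact: K.
have [_ tc] := tagged_itv T; case: T => _ _ t3.
apply: eq_bigr => i _; have [h1 h2 _] := t3 i (ltn_ord i).
have /andP[h3 h4] := tc i (ltnW (ltn_ord i)); have /andP[h5 h6] := tc i.+1 (ltn_ord i).
by rewrite pq ?(le_trans h3)// ?(le_trans h2)// (hk (tau i))// ?h3// h5.
Qed.

End RS.

(** * Existence of Riemann-Stieltjes integrals *)

Section RS_existence.
Context {R : realType}.
Variables (c d : R) (h V : R -> R).
Hypothesis cd : c < d.
Hypothesis hV : forall x y, c <= x -> x <= y -> y <= d -> `|h y - h x| <= V y - V x.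

Lemma sum_increments_le del N tau xi : tagged c d del N tau xi ->
  \sum_(k < N) `|h (tau k.+1) - h (tau k)| <= V d - V c.
Proof.
move=> T; have [t_le tc] := tagged_itv T; case: T => t1 t2 _.
apply: (@le_trans _ _ (\sum_(k < N) (V (tau k.+1) - V (tau k)))).
  apply: ler_sum => k _; apply: hV.
  - by have /andP[] := tc k (ltnW (ltn_ord k)).
  - exact: t_le (ltn_ord k).
  - by have /andP[] := tc k.+1 (ltn_ord k).
by rewrite (sum_increments N tau V) t1 t2.
Qed.

Lemma V_nd x y : c <= x -> x <= y -> y <= d -> V x <= V y.
Proof. by move=> cx xy yd; rewrite -subr_ge0 (le_trans _ (hV cx xy yd)). Qed.

(** The tags can be chosen in the open interval, so that the values of p at c and
d are irrelevant. This matters for the indicator of (c, d), whose product with a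
function is close to b in the open interval only. *)
Lemma RS_bound (p : R -> R) L b e : is_RS_integral p h c d L ->
  (forall t, c < t < d -> `|p t - b| <= e) ->
  `|L - b * (h d - h c)| <= e * (V d - V c).
Proof.
move=> /is_RS_integralP H pb; apply/ler_addgt0Pr => r r0.
have [del del0 K] := H r r0; have [N [tau [xi [T xiI]]]] := tagged_ex cd del0.
have {}K := K _ _ _ T.
have e0 : 0 <= e.
  have := pb ((c + d) / 2); have -> : c < (c + d) / 2 < d by move: cd; lra.
  by move=> /(_ isT); exact: le_trans.
have : `|RS_sum p h N tau xi - b * (h d - h c)| <= e * (V d - V c).
  have [t1 t2 _] := T.
  have -> : h d - h c = \sum_(k < N) (h (tau k.+1) - h (tau k)).
    by rewrite (sum_increments N tau h) t1 t2.
  rewrite mulr_sumr /RS_sum -sumrB.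
  rewrite (le_trans (ler_norm_sum _ _ _))//.
  rewrite (le_trans _ (ler_wpM2l e0 (sum_increments_le T)))// mulr_sumr.
  by apply: ler_sum => k _; rewrite -mulrBl normrM ler_wpM2r// pb// xiI.
by move: K; rewrite !ler_norml ltr_norml; lra.
Qed.

Lemma RS_dist (p q : R -> R) L M e :
  is_RS_integral p h c d L -> is_RS_integral q h c d M ->
  (forall t, c <= t <= d -> `|p t - q t| <= e) -> `|L - M| <= e * (V d - V c).
Proof.
move=> Hp Hq pq; have H := RS_scaleD (-1) Hp Hq.
have := RS_bound H (b := 0) (e := e).
rewrite mul0r subr0 mulN1r; apply=> t /andP[/ltW ct /ltW td].
by rewrite subr0 mulN1r pq// ct.
Qed.

Hypothesis cV : forall t e, c <= t -> t <= d -> 0 < e ->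
  exists2 del, 0 < del &
    forall s, c <= s -> s <= d -> `|s - t| < del -> `|V s - V t| <= e.

(** Whatever the value at z: only the tagged intervals that meet z contribute an
error, and they lie in a small neighbourhood of z, where the continuous V
varies little. *)
Lemma RS_step (z : R) (Phi : R -> R) : c <= z -> z <= d ->
  (forall t, t < z -> Phi t = 1) -> (forall t, z < t -> Phi t = 0) ->
  Phi z = 0 \/ Phi z = 1 -> is_RS_integral Phi h c d (h z - h c).
Proof.
move=> cz zd P1 P0 Pz; apply/is_RS_integralP => e e0.
have e30 : 0 < e / 3 by rewrite divr_gt0.
have [del del0 K] := cV cz zd e30.
exists (del / 2); first by rewrite divr_gt0.
move=> N tau xi T; have [t_le tc] := tagged_itv T; have [t1 t2 t3] := T.
pose H t := h (Num.min t z).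
pose lo := Num.max c (z - del / 2); pose hi := Num.min d (z + del / 2).
have lohi : [/\ c <= lo, lo <= z, z <= hi & hi <= d].
  split; first by rewrite le_max lexx.
  - by rewrite ge_max cz /=; move: del0; lra.
  - by rewrite le_min zd /=; move: del0; lra.
  - by rewrite ge_min lexx.
have loP x : c <= x -> z - del / 2 <= x -> lo <= x by rewrite ge_max => -> ->.
have hiP x : x <= d -> x <= z + del / 2 -> x <= hi by rewrite le_min => -> ->.
have hiz : `|hi - z| < del.
  rewrite ger0_norm ?subr_ge0; last by case: lohi.
  have : hi <= z + del / 2 by rewrite ge_min lexx orbT.
  by move: del0; lra.
have loz' : `|lo - z| < del.
  rewrite ler0_norm ?subr_le0; last by case: lohi.
  have : z - del / 2 <= lo by rewrite le_max lexx orbT.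
  by move: del0; lra.
have [clo loz zhi hid] := lohi.
clearbody lo hi.
pose cl t := Num.max lo (Num.min t hi).
have cl_homo x y : x <= y -> cl x <= cl y.
  by move=> xy; rewrite /cl ge_max !le_max lexx /= le_min !ge_min xy lexx !orbT.
have cl_lo x : lo <= cl x by rewrite /cl le_max lexx.
have cl_hi x : cl x <= hi by rewrite /cl ge_max ge_min lexx orbT (le_trans loz).
have clE x : lo <= x -> x <= hi -> cl x = x.
  by move=> h1 h2; rewrite /cl (min_l h2) (max_r h1).
have Hsum : h z - h c = \sum_(k < N) (H (tau k.+1) - H (tau k)).
  by rewrite (sum_increments N tau H) t1 t2 /H (min_r zd) (min_l cz).
(* the errors of the intervals meeting z telescope inside [lo, hi] *)
apply: (@le_lt_trans _ _ (\sum_(k < N) (V (cl (tau k.+1)) - V (cl (tau k))))).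
  rewrite Hsum /RS_sum -sumrB (le_trans (ler_norm_sum _ _ _))//.
  apply: ler_sum => k _; have [h1 h2 h3] := t3 k (ltn_ord k).
  have /andP[h4 _] := tc k (ltnW (ltn_ord k)).
  have /andP[_ h5] := tc k.+1 (ltn_ord k).
  have h12 := le_trans h1 h2.
  have clV : 0 <= V (cl (tau k.+1)) - V (cl (tau k)).
    rewrite subr_ge0; apply: V_nd; last exact: le_trans hid.
      exact: le_trans (cl_lo _).
    exact: cl_homo.
  have [kz|zk] := ltP (tau k.+1) z.
    have kz' : tau k < z := le_lt_trans h12 kz.
    rewrite /H (min_l (ltW kz)) (min_l (ltW kz')) P1; last exact: le_lt_trans kz.
    by rewrite mul1r subrr normr0.
  have [zk'|kz'] := ltP z (tau k).
    rewrite /H (min_r zk) (min_r (ltW zk')) P0; last exact: lt_le_trans h1.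
    by rewrite mul0r subrr subr0 normr0.
  rewrite /H (min_r zk) (min_l kz').
  have lok : lo <= tau k.
    by apply: loP => //; lra.
  have hik : tau k.+1 <= hi by apply: hiP => //; lra.
  rewrite (clE _ (le_trans lok h12) hik) (clE _ lok (le_trans h12 hik)).
  have [-> | ->] : Phi (xi k) = 0 \/ Phi (xi k) = 1.
    have [xz|zx|->] := ltgtP (xi k) z; [|by left; exact: P0|exact: Pz].
    by right; exact: P1.
    rewrite mul0r sub0r normrN.
    have /le_trans := hV h4 kz' zd; apply.
    by rewrite lerD2r V_nd.
  rewrite mul1r (_ : _ - _ = h (tau k.+1) - h z); last by ring.
  have /le_trans := hV cz zk h5; apply.
  by rewrite lerD2l lerN2 V_nd.
rewrite (sum_increments N tau (V \o cl)) /= t1 t2.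
have : V (cl d) <= V hi by apply: V_nd => //; rewrite (le_trans clo).
have : V lo <= V (cl c) by apply: V_nd => //; rewrite (le_trans (cl_hi _)).
have lod : lo <= d := le_trans loz zd.
have chi : c <= hi := le_trans cz zhi.
have := K _ clo lod loz'; have := K _ chi hid hiz.
by rewrite !ler_norml; lra.
Qed.

(** The integrals of functions q within e of p are determined up to
e (V d - V c); their lower bounds have a supremum, which is the limit
sought. *)
Lemma RS_uniform_limit (p : R -> R) :
  (forall e, 0 < e -> exists q L, is_RS_integral q h c d L /\
     forall t, c <= t <= d -> `|p t - q t| <= e) ->
  exists L, is_RS_integral p h c d L.
Proof.
move=> H; have VV : 0 <= V d - V c by rewrite subr_ge0 V_nd// ltW.
pose S := [set x | exists e q L, [/\ 0 < e, is_RS_integral q h c d L,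
  forall t, c <= t <= d -> `|p t - q t| <= e & x = L - e * (V d - V c)]].
have Sub e q L : 0 < e -> is_RS_integral q h c d L ->
    (forall t, c <= t <= d -> `|p t - q t| <= e) -> ubound S (L + e * (V d - V c)).
  move=> e0 Hq pq _ [e' [q' [L' [e'0 Hq' pq' ->]]]].
  have : `|L' - L| <= (e' + e) * (V d - V c).
    apply: RS_dist Hq' Hq _ => t tcd.
    rewrite (_ : q' t - q t = (p t - q t) - (p t - q' t)); last by ring.
    by rewrite (le_trans (ler_normB _ _))// addrC lerD ?pq ?pq'.
  by rewrite ler_norml mulrDl; lra.
have [q1 [L1 [Hq1 pq1]]] := H 1 ltr01.
have S0 : S !=set0 by exists (L1 - 1 * (V d - V c)), 1, q1, L1.
have supS e q L : 0 < e -> is_RS_integral q h c d L ->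
    (forall t, c <= t <= d -> `|p t - q t| <= e) -> `|L - sup S| <= e * (V d - V c).
  move=> e0 Hq pq; have h1 := Sub _ _ _ e0 Hq pq.
  have h2 : sup S <= L + e * (V d - V c) by exact: ge_sup.
  have h3 : L - e * (V d - V c) <= sup S.
    by apply: ub_le_sup; [exists (L + e * (V d - V c))|exists e, q, L].
  by rewrite ler_norml; lra.
exists (sup S); apply/is_RS_integralP => r r0.
have W0 : 0 < V d - V c + 1 by lra.
pose e := r / 3 / (V d - V c + 1).
have e0 : 0 < e by rewrite !divr_gt0.
have eV : e * (V d - V c) < r / 3.
  by rewrite /e mulrAC ltr_pdivrMr// ltr_pM2l ?divr_gt0// ltrDl.
have [q [L [Hq pq]]] := H e e0.
have r30 : 0 < r / 3 by rewrite divr_gt0.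
have /is_RS_integralP/(_ _ r30)[del del0 K] := Hq.
exists del => // N tau xi T; have {}K := K _ _ _ T.
have := supS _ _ _ e0 Hq pq.
have : `|RS_sum p h N tau xi - RS_sum q h N tau xi| <= e * (V d - V c).
  rewrite /RS_sum -sumrB (le_trans (ler_norm_sum _ _ _))//.
  rewrite (le_trans _ (ler_wpM2l (ltW e0) (sum_increments_le T)))// mulr_sumr.
  apply: ler_sum => k _; rewrite -mulrBl normrM ler_wpM2r// pq//.
  have [t_le tc] := tagged_itv T; have [_ _ /(_ k (ltn_ord k))[h1 h2 _]] := T.
  have /andP[h4 _] := tc k (ltnW (ltn_ord k)).
  have /andP[_ h5] := tc k.+1 (ltn_ord k).
  by rewrite (le_trans h4)// (le_trans h2).
by move: K; rewrite !ler_norml !ltr_norml; lra.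
Qed.

(** A regulated function is a uniform limit of step functions. The step function
is built up to b by real induction, one-sided limits providing the room on both
sides of b. *)
Lemma RS_regulated (p : R -> R) :
  (forall t, c <= t -> t <= d -> cvg (p @ t^'-) /\ cvg (p @ t^'+)) ->
  exists L, is_RS_integral p h c d L.
Proof.
move=> rp; apply: RS_uniform_limit => e e0.
pose A b := exists q L, [/\ is_RS_integral q h c d L,
  forall t, c <= t <= b -> `|p t - q t| <= e & forall t, b < t -> q t = 0].
suff [q [L [Hq pq _]]] : A d by exists q, L.
pose lt_ind (z t : R) : R := (t < z)%R%:R.
pose le_ind (z t : R) : R := (t <= z)%R%:R.
have RSlt z : c <= z -> z <= d -> is_RS_integral (lt_ind z) h c d (h z - h c).
  move=> cz zd; apply: RS_step => // [t tz|t zt|]; rewrite /lt_ind.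
  - by rewrite tz.
  - by rewrite ltNge ltW.
  - by rewrite ltxx; left.
have RSle z : c <= z -> z <= d -> is_RS_integral (le_ind z) h c d (h z - h c).
  move=> cz zd; apply: RS_step => // [t tz|t zt|]; rewrite /le_ind.
  - by rewrite ltW.
  - by rewrite leNgt zt.
  - by rewrite lexx; right.
have step b b' l : c <= b' -> b' < b -> b <= d -> A b' ->
    (forall t, b' < t -> t < b -> `|p t - l| <= e) -> A b.
  move=> cb' b'b bd [q [L [Hq pq q0]]] pl.
  have cb : c <= b := le_trans cb' (ltW b'b).
  have b'd : b' <= d := le_trans (ltW b'b) bd.
  (* new step function: l on (b', b), p b at b, and q up to b' *)
  have := RS_scaleD (p b) (RS_scaleD (- p b) (RS_scaleD (- l) (RS_scaleD l Hq
    (RSlt b cb bd)) (RSle b' cb' b'd)) (RSlt b cb bd)) (RSle b cb bd).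
  set q' := (fun t => _); set L' := (X in is_RS_integral _ _ _ _ X) => Hq'.
  exists q', L'; split=> // [t /andP[ct tb]|t bt]; rewrite /q' /lt_ind /le_ind /=.
    have [tb'|b't] := leP t b'.
      have tb1 : t < b := le_lt_trans tb' b'b.
      rewrite tb1 (ltW tb1) /= [X in p t - X](_ : _ = q t) ?pq ?ct//; ring.
    rewrite q0// tb; move: tb; rewrite le_eqVlt => /predU1P[tb|tb].
      by rewrite tb ltxx /= [X in p b - X](_ : _ = p b) ?subrr ?normr0 ?(ltW e0)//=; ring.
    by rewrite tb /= [X in p t - X](_ : _ = l) ?pl//=; ring.
  have b't : b' < t := lt_trans b'b bt.
  rewrite q0// (lt_gtF bt) (lt_geF bt) (lt_geF b't) /=; ring.
apply: (@real_induction _ A c d) => //; [|move=> b cb bd IH|move=> b cb bd IH|exact: ltW].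
- move=> _; have cd' := ltW cd.
  have := RS_scaleD (p c) (RS_scaleD (- 1) (RSle c (lexx c) cd')
    (RSle c (lexx c) cd')) (RSle c (lexx c) cd').
  set q' := (fun t => _); set L' := (X in is_RS_integral _ _ _ _ X) => Hq'.
  exists q', L'; split=> // [t tc|t ct]; rewrite /q' /le_ind.
    have -> : t = c by apply/le_anti; rewrite andbC.
    rewrite lexx /= [X in p c - X](_ : _ = p c) ?subrr ?normr0 ?(ltW e0)//=; ring.
  by rewrite leNgt ct/=; ring.
- have [/cvg_ex[l /= /cvgrPdist_le/(_ e e0)/near_at_leftP[eta eta0 pl]] _] :=
    rp b (ltW cb) bd.
  pose b' := Num.max c (b - eta / 2).
  have cb' : c <= b' by rewrite le_max lexx.
  have b'b : b' < b by rewrite gt_max cb /=; lra.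
  apply: (step b b' l) => // [|t b't tb]; first exact: IH.
  rewrite distrC; apply: pl => //; apply: le_lt_trans b't.
  by rewrite le_max; apply/orP; right; lra.
- have [_ /cvg_ex[l /= /cvgrPdist_le/(_ e e0)/near_at_rightP[eta eta0 pl]]] :=
    rp b cb (ltW bd).
  exists eta => // t bt tb td; apply: (step t b l) => // [|s bs st]; first exact: IH.
  by rewrite distrC; apply: pl => //; exact: lt_trans tb.
Qed.

End RS_existence.

(** * Sums over arbitrary index sets *)

Section sums.
Context {R : realType}.
Implicit Types (A B : set R) (F G W : R -> R).

Definition abs_summable A F := (\esum_(t in A) `|F t|%:E < +oo)%E.

Definition psum A W : R := fine (\esum_(t in A) (W t)%:E).

Lemma psum_fin A W : (forall t, A t -> 0 <= W t) -> abs_summable A W ->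
  (\esum_(t in A) (W t)%:E = (psum A W)%:E)%E.
Proof.
move=> W0 sW; rewrite /psum fineK// ge0_fin_numE; last first.
  by apply: esum_ge0 => t /W0; rewrite lee_fin.
apply: le_lt_trans sW; apply: le_esum => t _; rewrite lee_fin; exact: ler_norm.
Qed.

Lemma abs_summable_le A F W : (forall t, A t -> `|F t| <= W t) ->
  abs_summable A W -> abs_summable A F.
Proof.
move=> FW; apply: le_lt_trans; apply: le_esum => t At; rewrite lee_fin.
by rewrite (le_trans (FW t At))// ler_norm.
Qed.

Lemma esum_subset A B (W : R -> \bar R) : A `<=` B ->
  (\esum_(t in A) W t <= \esum_(t in B) W t)%E.
Proof.
move=> AB; apply: ge_ereal_sup => _ [X [finX XA] <-].
by apply: ereal_sup_ubound; exists X => //; split=> //; exact: subset_trans XA AB.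
Qed.

Lemma abs_summable_sub A B F : A `<=` B -> abs_summable B F -> abs_summable A F.
Proof. by move=> AB; apply: le_lt_trans; exact: esum_subset. Qed.

Lemma psum_ge0 A W : (forall t, A t -> 0 <= W t) -> 0 <= psum A W.
Proof. by move=> W0; apply: fine_ge0; apply: esum_ge0 => t /W0; rewrite lee_fin. Qed.

Lemma psum_sub A B W : A `<=` B -> (forall t, B t -> 0 <= W t) ->
  abs_summable B W -> psum A W <= psum B W.
Proof.
move=> AB W0 sW; have sA := abs_summable_sub AB sW.
by rewrite -lee_fin -!psum_fin//; [exact: esum_subset|move=> t /AB/W0].
Qed.

Lemma psumU A B W : A `&` B = set0 -> (forall t, (A `|` B) t -> 0 <= W t) ->
  abs_summable (A `|` B) W -> psum (A `|` B) W = psum A W + psum B W.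
Proof.
move=> AB0 W0 sW.
have sA := abs_summable_sub (@subsetUl _ A B) sW.
have sB := abs_summable_sub (@subsetUr _ A B) sW.
have /eqP := psum_fin W0 sW; rewrite (esumID A); last by move=> t /W0; rewrite lee_fin.
rewrite setUK setIUl setICr set0U (_ : B `&` ~` A = B); last first.
  by apply/setIidl => t Bt At; have : (A `&` B) t by []; rewrite AB0.
rewrite !psum_fin//; [|by move=> t Bt; apply: W0; right|by move=> t At; apply: W0; left].
by rewrite -EFinD => /eqP[].
Qed.

Lemma ssumE A F : ssum A F =
  psum A (fun t => Num.max (F t) 0) - psum A (fun t => Num.max (- F t) 0).
Proof. by []. Qed.

Lemma maxr0_ge0 (x : R) : 0 <= Num.max x 0.
Proof. by rewrite le_max lexx orbT. Qed.

Lemma maxr0_le (x : R) : `|Num.max x 0| <= `|x|.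
Proof.
rewrite ger0_norm ?maxr0_ge0// ge_max normr_ge0 andbT; exact: ler_norm.
Qed.

Lemma maxr0B (x : R) : Num.max x 0 - Num.max (- x) 0 = x.
Proof. by have [?|?] := leP x 0; have [?|?] := leP (- x) 0; lra. Qed.

Lemma abs_summable_pos A F : abs_summable A F ->
  abs_summable A (fun t => Num.max (F t) 0).
Proof.
move=> sF; apply: (@abs_summable_le _ _ (fun t => `|F t|)) => [t _|].
  exact: maxr0_le.
by apply: le_lt_trans sF; apply: le_esum => t _; rewrite normr_id.
Qed.

Lemma abs_summableN A F : abs_summable A F -> abs_summable A (fun t => - F t).
Proof.
by apply: le_lt_trans; apply: le_esum => t _; rewrite normrN.
Qed.

Lemma eq_ssum A F G : (forall t, A t -> F t = G t) -> ssum A F = ssum A G.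
Proof.
move=> FG; rewrite /ssum; congr (fine _ - fine _);
  by apply: eq_esum => t At; rewrite FG.
Qed.

Lemma ssum_mkcond A F : ssum A F = ssum setT (patch (fun=> 0) A F).
Proof.
rewrite /ssum esum_mkcond [X in _ - fine X]esum_mkcond.
by congr (fine _ - fine _); apply: eq_esum => t _; rewrite /patch;
  case: ifP => // _; rewrite ?oppr0 maxxx.
Qed.

(** Lets a sum over the discontinuities be taken over an interval, as the other
points contribute 0. *)
Lemma ssum_widen A B F : A `<=` B -> (forall t, B t -> ~ A t -> F t = 0) ->
  ssum A F = ssum B F.
Proof.
move=> AB F0; rewrite ssum_mkcond [RHS]ssum_mkcond; apply: eq_ssum => t _.
rewrite /patch; have [tA|tA] := boolP (t \in A).
  by rewrite ifT// inE; apply: AB; rewrite inE in tA.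
case: ifPn => // tB; rewrite F0//; first by rewrite inE in tB.
by move=> At; move: tA; rewrite mem_set.
Qed.

Lemma ssumN A F : ssum A (fun t => - F t) = - ssum A F.
Proof.
rewrite /ssum opprB; congr (fine _ - fine _).
by apply: eq_esum => t At; rewrite opprK.
Qed.

Lemma ssumU A B F : A `&` B = set0 -> abs_summable (A `|` B) F ->
  ssum (A `|` B) F = ssum A F + ssum B F.
Proof.
move=> AB sF; rewrite !ssumE !psumU//; last 4 first.
- by move=> t _; exact: maxr0_ge0.
- exact/abs_summable_pos/abs_summableN.
- by move=> t _; exact: maxr0_ge0.
- exact: abs_summable_pos.
ring.
Qed.

Lemma abs_ssum_le A F W : (forall t, A t -> `|F t| <= W t) -> abs_summable A W ->
  `|ssum A F| <= psum A W.
Proof.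
move=> FW sW; rewrite ssumE.
have W0 t : A t -> 0 <= W t by move=> At; exact: le_trans (FW t At).
have sF := abs_summable_le FW sW.
have pm : forall K, (forall t, A t -> `|K t| <= W t) -> abs_summable A K ->
    0 <= psum A (fun t => Num.max (K t) 0) <= psum A W.
  move=> K KW sK; rewrite psum_ge0 => [|t _]; last exact: maxr0_ge0.
  rewrite -lee_fin -!psum_fin//.
  - by apply: le_esum => t At; rewrite lee_fin (le_trans _ (KW t At))//
      (le_trans _ (maxr0_le _))// ler_norm.
  - by move=> t _; exact: maxr0_ge0.
  - exact: abs_summable_pos.
have /andP[h1 h2] := pm _ FW sF.
have /andP[h3 h4] := pm (fun t => - F t) (fun t At => eq_ind_r (fun z => z <= W t) (FW t At) (normrN (F t))) (abs_summableN sF).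
by rewrite ler_norml; lra.
Qed.

Lemma abs_summableD A F G : abs_summable A F -> abs_summable A G ->
  abs_summable A (fun t => F t + G t).
Proof.
move=> sF sG; apply: le_lt_trans (lte_add_pinfty sF sG).
by rewrite -esumD// ; apply: le_esum => t At; rewrite -EFinD lee_fin ler_normD.
Qed.

Lemma psumD A F G : (forall t, A t -> 0 <= F t) -> (forall t, A t -> 0 <= G t) ->
  abs_summable A F -> abs_summable A G ->
  psum A (fun t => F t + G t) = psum A F + psum A G.
Proof.
move=> F0 G0 sF sG; apply/EFin_inj; rewrite EFinD -!psum_fin//.
- by rewrite -esumD.
- by move=> t At; rewrite addr_ge0 ?F0 ?G0.
- exact: abs_summableD.
Qed.

Lemma ssumD A F G : abs_summable A F -> abs_summable A G ->
  ssum A (fun t => F t + G t) = ssum A F + ssum A G.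
Proof.
move=> sF sG; rewrite !ssumE.
have p0 (K : R -> R) t : A t -> 0 <= Num.max (K t) 0 by move=> _; exact: maxr0_ge0.
have sp := abs_summable_pos.
have sFN := abs_summableN sF; have sGN := abs_summableN sG.
have sD := abs_summableD sF sG; have sDN := abs_summableN sD.
suff : psum A (fun t => Num.max (F t + G t) 0) +
    (psum A (fun t => Num.max (- F t) 0) + psum A (fun t => Num.max (- G t) 0)) =
   psum A (fun t => Num.max (- (F t + G t)) 0) +
    (psum A (fun t => Num.max (F t) 0) + psum A (fun t => Num.max (G t) 0)) by lra.
have pp t : A t -> 0 <= Num.max (F t) 0 + Num.max (G t) 0.
  by move=> _; rewrite addr_ge0 ?maxr0_ge0.
have nn t : A t -> 0 <= Num.max (- F t) 0 + Num.max (- G t) 0.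
  by move=> _; rewrite addr_ge0 ?maxr0_ge0.
rewrite -(psumD (p0 (fun t => - F t)) (p0 (fun t => - G t)) (sp _ _ sFN) (sp _ _ sGN)).
rewrite -(psumD (p0 F) (p0 G) (sp _ _ sF) (sp _ _ sG)).
rewrite -(psumD (p0 (fun t => F t + G t)) nn (sp _ _ sD)); last first.
  by apply: abs_summableD; exact: sp.
rewrite -(psumD (p0 (fun t => - (F t + G t))) pp (sp _ _ sDN)); last first.
  by apply: abs_summableD; exact: sp.
congr psum; apply/funext => t.
by have := maxr0B (F t); have := maxr0B (G t); have := maxr0B (F t + G t); lra.
Qed.

Lemma psumZ_le A W (c : R) : 0 <= c -> (forall t, A t -> 0 <= W t) ->
  abs_summable A W -> abs_summable A (fun t => c * W t) /\
  psum A (fun t => c * W t) <= c * psum A W.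
Proof.
move=> c0 W0 sW.
have cW0 t : A t -> 0 <= c * W t by move=> At; rewrite mulr_ge0// W0.
have H : (\esum_(t in A) (c * W t)%:E <= (c * psum A W)%:E)%E.
  apply: ge_ereal_sup => _ [X [finX XA] <-].
  rewrite EFinM -psum_fin//.
  rewrite [leLHS](_ : _ = (c%:E * \sum_(x \in X) (W x)%:E)%E); last first.
    by rewrite !fsbig_finite// !sumEFin -EFinM mulr_sumr.
  apply: lee_wpmul2l; first by rewrite lee_fin.
  by apply: ereal_sup_ubound; exists X.
have sc : abs_summable A (fun t => c * W t).
  apply: le_lt_trans (ltry (c * psum A W)); apply: le_trans H.
  by apply: le_esum => t At; rewrite ger0_norm// cW0.
by split=> //; rewrite -lee_fin -psum_fin.
Qed.

Lemma psumZ A W (c : R) : 0 <= c -> (forall t, A t -> 0 <= W t) ->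
  abs_summable A W -> psum A (fun t => c * W t) = c * psum A W.
Proof.
move=> c0 W0 sW; have [sc H] := psumZ_le c0 W0 sW.
have cW0 t : A t -> 0 <= c * W t by move=> At; rewrite mulr_ge0// W0.
move: c0; rewrite le_eqVlt => /predU1P[cE|c0].
  by apply/le_anti; rewrite H -cE mul0r psum_ge0// => t _; rewrite mul0r.
apply/le_anti; rewrite H/=.
have ci0 : 0 <= c^-1 by rewrite invr_ge0 ltW.
have [_] := psumZ_le ci0 cW0 sc.
rewrite (_ : (fun t => _) = W); last by apply/funext => t; rewrite mulKf ?gt_eqF.
by rewrite mulrC ler_pdivlMr// mulrC.
Qed.

Lemma abs_summableZ A F (b : R) : abs_summable A F ->
  abs_summable A (fun t => b * F t).
Proof.
move=> sF; have sF' : abs_summable A (fun t => `|F t|).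
  by apply: le_lt_trans sF; apply: le_esum => t _; rewrite normr_id.
have [+ _] := @psumZ_le A (fun t => `|F t|) _ (normr_ge0 b)
  (fun t _ => normr_ge0 (F t)) sF'.
by apply: le_lt_trans; apply: le_esum => t _; rewrite !normrM !normr_id.
Qed.

Lemma ssumZ A F (b : R) : abs_summable A F ->
  ssum A (fun t => b * F t) = b * ssum A F.
Proof.
move=> sF; have pos (c : R) (K : R -> R) : 0 <= c -> abs_summable A K ->
    ssum A (fun t => c * K t) = c * ssum A K.
  move=> c0 sK; rewrite !ssumE mulrBr.
  have p0 (H : R -> R) t : A t -> 0 <= Num.max (H t) 0 by move=> _; exact: maxr0_ge0.
  have sp := abs_summable_pos.
  rewrite -(psumZ c0 (p0 K) (sp _ _ sK)).
  rewrite -(psumZ c0 (p0 (fun t => - K t)) (sp _ _ (abs_summableN sK))).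
  congr (psum _ _ - psum _ _); apply/funext => t.
    by rewrite maxr_pMr// mulr0.
  by rewrite maxr_pMr// mulr0 mulrN.
have [b0|b0] := leP 0 b; first exact: pos.
rewrite -[b]opprK mulNr -[in RHS]pos ?oppr_ge0 ?(ltW b0)// -ssumN.
by apply: eq_ssum => t _; rewrite mulNr.
Qed.

(** A finite set almost exhausts the sum, so little is left outside of it. *)
Lemma psum_tail A W (e : R) : 0 < e -> (forall t, A t -> 0 <= W t) ->
  abs_summable A W -> exists2 X : set R, finite_set X &
    forall B, B `<=` A -> B `&` X = set0 -> psum B W <= e.
Proof.
move=> e0 W0 sW.
have : (((psum A W) - e)%:E < \esum_(t in A) (W t)%:E)%E.
  by rewrite psum_fin// lte_fin ltrBlDr ltrDl.
move=> /ereal_sup_gt[_ [X [finX XA] <-] eX].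
exists X => // B BA BX.
have sB := abs_summable_sub BA sW.
have sX := abs_summable_sub XA sW.
have sBX : abs_summable (B `|` X) W by apply: abs_summable_sub sW; rewrite subUset.
have W0' t : (B `|` X) t -> 0 <= W t by move=> [/BA|/XA]; exact: W0.
have := psumU BX W0' sBX.
have : psum (B `|` X) W <= psum A W by apply: psum_sub; rewrite // subUset.
have : psum A W - e < psum X W.
  rewrite -lte_fin -psum_fin//; last by move=> t /XA; exact: W0.
  by rewrite esum_fset// => t /[!inE] /XA /W0; rewrite lee_fin.
lra.
Qed.

Lemma finite_isolated (X : set R) (t : R) : finite_set X ->
  exists2 eta, 0 < eta & forall s, X s -> s != t -> eta <= `|s - t|.
Proof.
move=> /finite_seqP[l ->]; elim: l => [|x l [eta eta0 H]]; first by exists 1.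
have [xt|xt] := eqVneq x t.
  exists eta => // s; rewrite /= inE => /predU1P[->|/H//].
  by rewrite xt eqxx.
exists (Num.min eta `|x - t|); first by rewrite lt_min eta0 normr_gt0 subr_eq0.
move=> s; rewrite /= inE => /predU1P[->|sl] st; first by rewrite ge_min lexx orbT.
by rewrite ge_min H.
Qed.

(** Close to t, but away from t itself, there is none of the finitely many points
that carry most of the sum. *)
Lemma psum_local A W (t e : R) : 0 < e -> (forall s, A s -> 0 <= W s) ->
  abs_summable A W -> exists2 eta, 0 < eta &
    forall B, B `<=` A -> (forall s, B s -> 0 < `|s - t| < eta) -> psum B W <= e.
Proof.
move=> e0 W0 sW; have [X finX H] := psum_tail e0 W0 sW.
have [eta eta0 He] := finite_isolated t finX; exists eta => // B BA Bt.
apply: H => //; apply/seteqP; split=> // s [/Bt/andP[s0 seta] Xs].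
have := He s Xs; rewrite -subr_eq0 -normr_gt0 s0 => /(_ isT).
by rewrite leNgt seta.
Qed.

End sums.

(** * Dynamic functions of bounded variation *)

Section dyn.
Context {R : realType}.
Implicit Types (f g : dynfun R) (c t s e : R) (al : \bar R).
Local Notation hlf := (2^-1 : R).
Local Notation Nhlf := (- 2^-1 : R).

Lemma J0 : J (0 : R).
Proof. by rewrite JE; have := @hlf_gt0 R; lra. Qed.

Lemma Jhlf : J hlf.
Proof. by rewrite JE; have := @hlf_gt0 R; lra. Qed.

Lemma JNhlf : J Nhlf.
Proof. by rewrite JE; have := @hlf_gt0 R; lra. Qed.

Lemma dyn_cvg_unique (F : set_system R) (FF : ProperFilter F) f c1 c2 :
  dyn_cvg F f c1 -> dyn_cvg F f c2 -> c1 = c2.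
Proof.
move=> H1 H2; apply/eqP; rewrite -subr_eq0 -normr_le0.
apply/ler_addgt0Pr => e e0; rewrite add0r.
have e20 : 0 < e / 2 by rewrite divr_gt0.
have [t [/= K1 K2]] := filter_ex (filterI (H1 _ e20) (H2 _ e20)).
have := K1 0 J0; have := K2 0 J0.
by rewrite !ler_norml; lra.
Qed.

Lemma dyn_limE (F : set_system R) (FF : ProperFilter F) f c :
  dyn_cvg F f c -> dyn_lim F f = c.
Proof.
move=> H; rewrite /dyn_lim; case: xgetP => [y -> /= Hy|/(_ c)//].
exact: dyn_cvg_unique Hy H.
Qed.

(** A closed condition holding along the ordinary values at s = 0 passes to the
limit. *)
Lemma dyn_cvg_dist (F : set_system R) (FF : ProperFilter F) f c l e :
  dyn_cvg F f c -> (\forall t \near F, `|f t 0 - l| <= e) -> `|c - l| <= e.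
Proof.
move=> Hc Hl; apply/ler_addgt0Pr => r r0.
have [t [/= K1 K2]] := filter_ex (filterI (Hc _ r0) Hl).
by have := K1 0 J0; move: K2; rewrite !ler_norml; lra.
Qed.

Definition has_dyn_limits al f := forall t, (al < t%:E)%E ->
  (exists c, dyn_cvg t^'- f c) /\ (exists c, dyn_cvg t^'+ f c).

Lemma ltal_window al t : (al < t%:E)%E -> exists2 s, s < t & (al < s%:E)%E.
Proof.
case: al => [a| |] at_; last by exists (t - 1); [rewrite gtrBl|exact: ltNyr].
  by exists ((a + t) / 2); move: at_; rewrite !lte_fin; lra.
by move: at_; rewrite ltNge leey.
Qed.

Lemma lte_trans_fin al s t : (al < s%:E)%E -> s <= t -> (al < t%:E)%E.
Proof. by move=> als st; apply: lt_le_trans als _; rewrite lee_fin. Qed.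

(** At the points where the value is not ordinary, ord is itself a left limit, so
the bound has to be transported through a second limit. *)
Lemma ord_cvg_left al f t c : has_dyn_limits al f -> (al < t%:E)%E ->
  dyn_cvg t^'- f c -> ord f @ t^'- --> c.
Proof.
move=> hf alt Hc; apply/cvgrPdist_le => e e0.
have [s0 s0t als0] := ltal_window alt.
have /near_at_leftP[eta eta0 He] := Hc e e0.
apply/near_at_leftP; exists (Num.min eta (t - s0)).
  by rewrite lt_min eta0 subr_gt0.
move=> s ts st; have {ts} [ts s0s] : t - eta < s /\ s0 < s.
  have : Num.min eta (t - s0) <= eta by rewrite ge_min lexx.
  have : Num.min eta (t - s0) <= t - s0 by rewrite ge_min lexx orbT.
  by split; lra.
rewrite distrC /ord; case: ifPn => _; first by apply: He => //; exact: J0.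
have [[l Hl] _] := hf s (lte_trans_fin als0 (ltW s0s)).
rewrite (dyn_limE _ Hl); apply: dyn_cvg_dist Hl _.
apply/near_at_leftP; exists (s - (t - eta)); first by rewrite subr_gt0.
by move=> r sr rs; apply: He; [lra|lra|exact: J0].
Qed.

Lemma ord_cvg_right al f t c : has_dyn_limits al f -> (al < t%:E)%E ->
  dyn_cvg t^'+ f c -> ord f @ t^'+ --> c.
Proof.
move=> hf alt Hc; apply/cvgrPdist_le => e e0.
have /near_at_rightP[eta eta0 He] := Hc e e0.
apply/near_at_rightP; exists eta => // s ts st.
rewrite distrC /ord; case: ifPn => _; first by apply: He => //; exact: J0.
have [[l Hl] _] := hf s (lte_trans_fin alt (ltW ts)).
rewrite (dyn_limE _ Hl); apply: dyn_cvg_dist Hl _.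
apply/near_at_leftP; exists (s - t); first by rewrite subr_gt0.
by move=> r sr rs; apply: He; [lra|lra|exact: J0].
Qed.

Lemma ord_regulated al f t : has_dyn_limits al f -> (al < t%:E)%E ->
  cvg (ord f @ t^'-) /\ cvg (ord f @ t^'+).
Proof.
move=> hf alt; have [[c Hc] [d Hd]] := hf t alt.
split; apply/cvg_ex.
- by exists c; exact: (ord_cvg_left hf alt Hc).
- by exists d; exact: (ord_cvg_right hf alt Hd).
Qed.

Lemma ordinary_total_variation (h : R -> R) : ordinary h ->
  total_variation Nhlf hlf h = 0%E.
Proof.
move=> oh; have hE x : x \in `[Nhlf, hlf] -> h x = h 0.
  by rewrite in_itv/= -JE; exact: oh.
rewrite nondecreasing_total_variation.
- by rewrite (oh _ Jhlf) (oh _ JNhlf) subrr.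
- exact/ltW/NhlfLhlf.
- by move=> x y xJ yJ _; rewrite !hE.
Qed.

Definition value_var g t : R := fine (total_variation Nhlf hlf (g t)).

Definition jump g t : R := g t hlf - g t Nhlf.

Lemma var_ge0 (h : R -> R) : (0 <= var Nhlf%:E hlf%:E h)%E.
Proof.
apply: ereal_sup_ubound; exists 0%N, (fun=> 0); split=> // [k _|].
  by rewrite /oitv /= !lte_fin; have := @hlf_gt0 R; lra.
by rewrite big_ord0.
Qed.

Section sBV.
Variables (al : \bar R) (g : dynfun R).
Hypothesis gBV : is_sBVloc al +oo%E g.

Lemma sBV_window c d : (al < c%:E)%E -> c <= d -> exists c' d',
  [/\ (al < c'%:E)%E, c' < c, d < d' & is_sBV c'%:E d'%:E g].
Proof.
move=> alc cd; have [c' c'c alc'] := ltal_window alc.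
exists c', (d + 1); split=> //; first by rewrite ltrDl.
by apply: gBV => //; [lra|exact: ltry].
Qed.

Lemma sBV_sG t : (al < t%:E)%E -> [/\ isACJ (g t),
  dyn_cvg t^'- g (g t Nhlf) & dyn_cvg t^'+ g (g t hlf)].
Proof.
move=> alt; have [c' [d' [_ c't td' [[_ H] _ _]]]] := sBV_window alt (lexx t).
by apply: H; rewrite /oitv /= !lte_fin.
Qed.

Lemma sBV_has_dyn_limits : has_dyn_limits al g.
Proof.
by move=> t /sBV_sG[_ h1 h2]; split; [exists (g t Nhlf)|exists (g t hlf)].
Qed.

(** For elements of sBV the left limit is the initial value of the dynamic value,
at continuity points as well as at jumps. *)
Lemma sBV_ord t : (al < t%:E)%E -> ord g t = g t Nhlf.
Proof.
move=> /sBV_sG[_ h1 _]; rewrite /ord; case: asboolP => [og|_].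
  by rewrite (og _ JNhlf).
exact: dyn_limE h1.
Qed.

Lemma sBV_llim t : (al < t%:E)%E -> llim (ord g) t = g t Nhlf.
Proof.
move=> alt; have [_ h1 _] := sBV_sG alt; apply/cvg_lim => //.
exact: (ord_cvg_left sBV_has_dyn_limits alt h1).
Qed.

Lemma sBV_rlim t : (al < t%:E)%E -> rlim (ord g) t = g t hlf.
Proof.
move=> alt; have [_ _ h1] := sBV_sG alt; apply/cvg_lim => //.
exact: (ord_cvg_right sBV_has_dyn_limits alt h1).
Qed.

(** The dynamic value is ordinary, hence without variation, off the
discontinuities; at a discontinuity its variation is a term of a finite sum. *)
Lemma sBV_TV_var c d t : is_sBV c%:E d%:E g -> c < t < d ->
  (total_variation Nhlf hlf (g t) <=
     if t \in disc c%:E d%:E g then var Nhlf%:E hlf%:E (g t) else 0)%E /\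
  bounded_variation Nhlf hlf (g t).
Proof.
move=> [[_ sG] _ sV] ctd; have tI : oitv c%:E d%:E t by rewrite /oitv /= !lte_fin; apply/andP.
have [ac _ _] := sG t tI.
have TVle : (total_variation Nhlf hlf (g t) <=
     if t \in disc c%:E d%:E g then var Nhlf%:E hlf%:E (g t) else 0)%E.
  case: ifPn => [_|td]; first exact: total_variation_J_le_var.
  rewrite ordinary_total_variation//.
  have /contrapT[] : ~ ~ dyn_continuous_at g t.
    by move=> tn; move: td; rewrite mem_set.
  by [].
split=> //; apply/(bounded_variationP _ (ltW NhlfLhlf)).
rewrite ge0_fin_numE ?total_variation_ge0 ?(ltW NhlfLhlf)//.
apply: le_lt_trans TVle _; case: ifPn => [td|_]; last exact: ltry.
apply: le_lt_trans sV; apply: esum_ge; exists [set t].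
  by split=> // s ->; rewrite inE in td.
by rewrite fsbig_set1.
Qed.

Lemma sBV_bounded_variation t : (al < t%:E)%E -> bounded_variation Nhlf hlf (g t).
Proof.
move=> alt; have [c' [d' [_ c't td' H]]] := sBV_window alt (lexx t).
by have [] := sBV_TV_var H (introT andP (conj c't td')).
Qed.

Lemma value_varE t : (al < t%:E)%E -> (total_variation Nhlf hlf (g t) = (value_var g t)%:E)%E.
Proof.
move=> alt; rewrite /value_var fineK//; apply/(bounded_variationP _ (ltW NhlfLhlf)).
exact: sBV_bounded_variation.
Qed.

Lemma value_var_ge0 t : 0 <= value_var g t.
Proof. by apply: fine_ge0; apply: total_variation_ge0; exact/ltW/NhlfLhlf. Qed.

Lemma jump_le_value_var t : (al < t%:E)%E -> `|jump g t| <= value_var g t.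
Proof.
move=> alt; rewrite -lee_fin -value_varE//.
by apply: total_variation_ge; exact/ltW/NhlfLhlf.
Qed.

Lemma value_var_summable c d : (al < c%:E)%E -> abs_summable `[c, d]%classic (value_var g).
Proof.
move=> alc; have [cd|dc] := leP c d; last first.
  by rewrite set_itv_ge ?bnd_simp -?ltNge// /abs_summable esum_set0 ltry.
have [c' [d' [_ c't td' H]]] := sBV_window alc cd.
have [_ _ sV] := H; apply: le_lt_trans sV.
rewrite /abs_summable esum_mkcond [leRHS]esum_mkcond; apply: le_esum => t _.
case: ifPn => [|_]; last first.
  by case: ifPn => // _; exact: var_ge0.
rewrite inE /= in_itv/= => /andP[ct td].
have [|+ _] := @sBV_TV_var c' d' t H; first by rewrite (lt_le_trans c't)// (le_lt_trans td).
by rewrite value_varE ?(lte_trans_fin alc ct)// ger0_norm ?value_var_ge0.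
Qed.

End sBV.
End dyn.

(** * The continuous part *)

Section cont.
Context {R : realType}.
Implicit Types (c t s e x y : R).
Local Notation hlf := (2^-1 : R).
Local Notation Nhlf := (- 2^-1 : R).
Variables (al : \bar R) (g : dynfun R).
Hypothesis gBV : is_sBVloc al +oo%E g.
Variable c0 : R.
Hypothesis alc0 : (al < c0%:E)%E.
Local Notation H := (cont_part c0 (ord g)).

Lemma al_ge t : c0 <= t -> (al < t%:E)%E.
Proof. exact: lte_trans_fin. Qed.

Lemma value_var_summableW (A : set R) d : A `<=` `[c0, d]%classic -> abs_summable A (value_var g).
Proof. by move=> Ad; apply: abs_summable_sub Ad _; exact: (value_var_summable gBV). Qed.

Lemma jump_summableW (A : set R) d : A `<=` `[c0, d]%classic ->
  abs_summable A (jump g).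
Proof.
move=> Ad; apply: (@abs_summable_le _ A (jump g) (value_var g)); last exact: value_var_summableW Ad.
by move=> t /Ad; rewrite /= in_itv/= => /andP[ct _]; apply: (jump_le_value_var gBV); exact: al_ge.
Qed.

Lemma cont_partE t : c0 <= t -> H t = g t Nhlf - ssum `[c0, t[%classic (jump g).
Proof.
move=> ct; rewrite /cont_part (sBV_llim gBV (al_ge ct)); congr (_ - _).
apply: eq_ssum => s; rewrite /= in_itv/= => /andP[cs _].
by rewrite (sBV_llim gBV (al_ge cs)) (sBV_rlim gBV (al_ge cs)).
Qed.

(** Between x and y the continuous part moves by the increment from x+ to y-, less
the jumps strictly in between. *)
Lemma cont_part_incr x y : c0 <= x -> x < y ->
  H y - H x = g y Nhlf - g x hlf - ssum `]x, y[%classic (jump g).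
Proof.
move=> cx xy; have cy := le_trans cx (ltW xy).
rewrite !cont_partE//.
have -> : `[c0, y[%classic = `[c0, x[%classic `|` ([set x] `|` `]x, y[%classic) :> set R.
  rewrite setU1itv ?bnd_simp//.
  apply/seteqP; split=> t /=; rewrite !in_itv/=.
    by move=> /andP[-> ->]; rewrite andbT; case: (ltP t x); [left|right].
  case=> /andP[h1 h2]; first by rewrite h1 (lt_trans h2).
  by rewrite h2 (le_trans cx).
have sub A : A `<=` `[c0, y]%classic -> abs_summable A (jump g).
  exact: jump_summableW.
rewrite ssumU; first rewrite ssumU.
- have -> : ssum [set x] (jump g) = jump g x.
    rewrite ssumE /psum !esum_set1 ?lee_fin ?maxr0_ge0//=; exact: maxr0B.
  rewrite /jump; ring.
- by apply/seteqP; split=> // t [-> /=]; rewrite in_itv/= ltxx.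
- apply: sub => t [->|] /=; rewrite in_itv/= ?cx ?(ltW xy)// => /andP[h1 h2].
  by rewrite in_itv/= (ltW h2) (le_trans cx)// ltW.
- apply/seteqP; split=> // t [] /=; rewrite in_itv/= => /andP[_ tx] [tE|].
    by move: tx; rewrite tE ltxx.
  by rewrite /= in_itv/= => /andP[/(lt_trans tx)]; rewrite ltxx.
- apply: sub => t [|[->|]] /=; rewrite !in_itv/= ?cx ?(ltW xy)// => /andP[h1 h2].
    by rewrite h1 ltW// (lt_trans h2).
  by rewrite (ltW h2) (le_trans cx)// ltW.
Qed.

Lemma psum_value_var_add x y : c0 <= x -> x < y ->
  psum `]x, y[%classic (value_var g) + psum `[c0, x[%classic (value_var g) <= psum `[c0, y[%classic (value_var g).
Proof.
move=> cx xy; have sub A : A `<=` `[c0, y]%classic -> abs_summable A (value_var g).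
  exact: value_var_summableW.
have AB : `]x, y[%classic `|` `[c0, x[%classic `<=` `[c0, y[%classic.
  move=> t [] /=; rewrite !in_itv/= => /andP[h1 h2].
    by rewrite h2 (le_trans cx)// ltW.
  by rewrite h1 (lt_trans h2).
have sAB : abs_summable `[c0, y[%classic (value_var g).
  by apply: sub => t /=; rewrite !in_itv/= => /andP[-> /ltW ->].
rewrite -psumU.
- apply: psum_sub => // t _; exact: value_var_ge0.
- apply/seteqP; split=> // t [] /=; rewrite !in_itv/= => /andP[h1 _] /andP[_ h2].
  by move: (lt_trans h1 h2); rewrite ltxx.
- by move=> t _; exact: value_var_ge0.
- exact: abs_summable_sub sAB.
Qed.

Lemma ssum_jump_le (A : set R) d : A `<=` `[c0, d]%classic ->
  `|ssum A (jump g)| <= psum A (value_var g).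
Proof.
move=> Ad; apply: abs_ssum_le; last exact: value_var_summableW Ad.
by move=> t /Ad; rewrite /= in_itv/= => /andP[ct _]; apply: (jump_le_value_var gBV); exact: al_ge.
Qed.

(** Near t, the increment from t+ (or to t-) is small by the one-sided limits, and
the jumps strictly between t and s are small because their sum converges. *)
Lemma cont_part_cont t e : c0 <= t -> 0 < e -> exists2 eta, 0 < eta &
  forall s, c0 <= s -> `|s - t| < eta -> `|H s - H t| <= e.
Proof.
move=> ct e0; have alt := al_ge ct.
have e20 : 0 < e / 2 by rewrite divr_gt0.
have [_ /(_ _ e20)/near_at_leftP[e1 e10 H1] /(_ _ e20)/near_at_rightP[e2 e20' H2]] := sBV_sG gBV alt.
have [e3 e30 H3] := @psum_local _ `[c0, t + 1]%classic (value_var g) t _ e20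
  (fun s _ => value_var_ge0 g s) (value_var_summable gBV (t + 1) alc0).
exists (Num.min (Num.min e1 e2) (Num.min e3 1)).
  by rewrite !lt_min e10 e20' e30 ltr01.
move=> s cs; rewrite !lt_min => /andP[/andP[se1 se2] /andP[se3 s1]].
have [st|ts|->] := ltgtP s t; last by rewrite subrr normr0 ltW.
- rewrite distrC cont_part_incr//.
  have K1 := H1 s _ st hlf Jhlf.
  have A1 : `]s, t[%classic `<=` `[c0, t + 1]%classic.
    by move=> r /=; rewrite !in_itv/=; move: cs; lra.
  have K3 := H3 `]s, t[%classic A1.
  have K4 := ssum_jump_le A1.
  have {}K3 : psum `]s, t[%classic (value_var g) <= e / 2.
    apply: K3 => r /=; rewrite in_itv/= => /andP[h1 h2].
    rewrite ltr0_norm ?subr_lt0//; move: se3; rewrite ltr0_norm ?subr_lt0//.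
    by move=> h; apply/andP; split; lra.
  have {}K1 : `|g s hlf - g t Nhlf| <= e / 2.
    by apply: K1; move: se1; rewrite ltr0_norm ?subr_lt0//; lra.
  by move: K1 K4; rewrite !ler_norml; lra.
- rewrite cont_part_incr//.
  have K1 := H2 s ts _ Nhlf JNhlf.
  have A1 : `]t, s[%classic `<=` `[c0, t + 1]%classic.
    move: s1; rewrite gtr0_norm ?subr_gt0// => s1.
    by move=> r /=; rewrite !in_itv/=; move: ct; lra.
  have K3 := H3 `]t, s[%classic A1.
  have K4 := ssum_jump_le A1.
  have {}K3 : psum `]t, s[%classic (value_var g) <= e / 2.
    apply: K3 => r /=; rewrite in_itv/= => /andP[h1 h2].
    rewrite gtr0_norm ?subr_gt0//; move: se3; rewrite gtr0_norm ?subr_gt0//.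
    by move=> h; apply/andP; split; lra.
  have {}K1 : `|g s Nhlf - g t hlf| <= e / 2.
    by apply: K1; move: se2; rewrite gtr0_norm ?subr_gt0//; lra.
  by move: K1 K4; rewrite !ler_norml; lra.
Qed.

(** A partition sum is at most the variation of the ordinary part plus the sum of
the variations of all the dynamic values. *)
Lemma cont_part_bv d : c0 < d -> bounded_variation c0 d H.
Proof.
move=> cd; have [c' [d' [alc' c'c dd' [_ [_ vfin] _]]]] := sBV_window gBV alc0 (ltW cd).
pose M := fine (var c'%:E d'%:E (ord g)).
exists (M + psum `[c0, d[%classic (value_var g)) => _ [s sp <-].
pose t k := nth d (c0 :: s) k.
have [sp1 /eqP sp2] := sp.
have t_lt k : (k < size s)%N -> t k < t k.+1.
  by move=> ks; have /(pathP d) := sp1; apply.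
have t_le : {in [pred k | (k <= size s)%N] &, {homo t : i j / (i <= j)%N >-> i <= j}}.
  move=> i j; rewrite !inE => si sj ij.
  by rewrite /t (@lt_sorted_leq_nth _ _ d (c0 :: s) sp1).
have tJ k : (k <= size s)%N -> c0 <= t k <= d.
  move=> ks; apply/andP; split.
    by apply: (t_le 0%N k); rewrite ?inE.
  have -> : d = t (size s) by rewrite -[LHS]sp2 (last_nth d).
  by apply: (t_le k (size s)); rewrite ?inE.
rewrite /variation big_mkord.
pose Psi x := psum `[c0, x[%classic (value_var g).
apply: (@le_trans _ _ (\sum_(k < size s) (`|llim (ord g) (t k.+1) - rlim (ord g) (t k)|
     + (Psi (t k.+1) - Psi (t k))))).
  apply: ler_sum => k _; rewrite /= -/(t k.+1) -/(t k).
  have /andP[h1 h2] := tJ k (ltnW (ltn_ord k)).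
  have /andP[h3 h4] := tJ k.+1 (ltn_ord k).
  have tt := t_lt k (ltn_ord k).
  rewrite cont_part_incr// (sBV_llim gBV (al_ge h3)) (sBV_rlim gBV (al_ge h1)).
  rewrite (le_trans (ler_normB _ _))// lerD2l.
  have A1 : `]t k, t k.+1[%classic `<=` `[c0, d]%classic.
    by move=> r /=; rewrite !in_itv/=; lra.
  rewrite (le_trans (ssum_jump_le A1))// lerBrDr.
  exact: psum_value_var_add.
rewrite big_split/= lerD//.
  have vf : var c'%:E d'%:E (ord g) \is a fin_num.
    rewrite ge0_fin_numE//; apply: ereal_sup_ubound; exists 0%N, (fun=> d).
    split=> //; last by rewrite big_ord0.
    by move=> k _; rewrite /oitv /= !lte_fin; split=> //; exact: lt_trans cd.
  rewrite /M -lee_fin fineK//; apply: ereal_sup_ubound; exists (size s), t.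
  split=> //; move=> k /tJ /andP[h1 h2]; rewrite /oitv /= !lte_fin; split.
    exact: lt_le_trans h1.
  exact: le_lt_trans dd'.
rewrite (sum_increments (size s) t Psi).
have Psi0 : Psi c0 = 0.
  by rewrite /Psi set_itv_ge ?bnd_simp ?ltxx// /psum esum_set0.
rewrite {2}/t /= Psi0 subr0.
have -> : t (size s) = d by rewrite -[RHS]sp2 (last_nth d).
by [].
Qed.

Definition cont_var t : R := fine (total_variation c0 t H).

Lemma cont_var_incr x y : c0 <= x -> x <= y -> `|H y - H x| <= cont_var y - cont_var x.
Proof.
move=> cx xy; have bv : bounded_variation c0 (y + 1) H by apply: cont_part_bv; lra.
have y1 : y <= y + 1 by rewrite lerDl.
have bvx : bounded_variation c0 x H by apply: bounded_variationl cx (le_trans xy y1) bv.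
have bvxy : bounded_variation x y H.
  apply: (bounded_variationl xy y1); exact: (bounded_variationr cx (le_trans xy y1) bv).
rewrite /cont_var (total_variationD _ cx xy) fineD; try exact/bounded_variationP.
rewrite [leRHS]addrC addKr -lee_fin fineK ?total_variation_ge//.
exact/bounded_variationP.
Qed.

Lemma cont_var_cont d t e : c0 < d -> c0 <= t -> t <= d -> 0 < e ->
  exists2 eta, 0 < eta & forall s, c0 <= s -> s <= d -> `|s - t| < eta ->
    `|cont_var s - cont_var t| <= e.
Proof.
move=> cd ct td e0.
have cH : {within `[c0, d], continuous H}.
  apply/subspace_continuousP => x; rewrite /= in_itv/= => /andP[cx xd].
  apply/cvgrPdist_le => r r0; have [eta eta0 He] := cont_part_cont cx r0.
  apply/nbhs_ballP; exists eta => //= y /=; rewrite /ball/= in_itv/= => xy /andP[cy _].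
  by rewrite distrC He// distrC.
have /subspace_continuousP/(_ t) := total_variation_continuous cd cH (cont_part_bv cd).
rewrite /= in_itv/= ct td => /(_ isT)/cvgrPdist_le/(_ e e0)/nbhs_ballP[eta /= eta0 He].
exists eta => // s cs sd st; rewrite distrC; apply: He.
  by rewrite /ball/= distrC.
by rewrite /= in_itv/= cs.
Qed.

End cont.

(** * Integration against the continuous part *)

Section int_dcont.
Context {R : realType}.
Implicit Types (c d t s e x y L : R).
Variables (al : \bar R) (g : dynfun R).
Hypothesis gBV : is_sBVloc al +oo%E g.

Lemma cont_part_indep c0 c1 x y : (al < c0%:E)%E -> (al < c1%:E)%E ->
  c0 <= x -> c1 <= x -> c0 <= y -> c1 <= y ->
  cont_part c0 (ord g) y - cont_part c0 (ord g) x =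
  cont_part c1 (ord g) y - cont_part c1 (ord g) x.
Proof.
move=> al0 al1 c0x c1x c0y c1y; have [xy|yx|->] := ltgtP x y.
- by rewrite (cont_part_incr gBV al0)// (cont_part_incr gBV al1).
- have := cont_part_incr gBV al0 c0y yx; have := cont_part_incr gBV al1 c1y yx.
  lra.
- by rewrite !subrr.
Qed.

(** Partitions with tags in the open interval avoid the values of p at c and d. *)
Lemma RS_zero (p : R -> R) c d L : (al < c%:E)%E -> c <= d ->
  is_RS_integral p (cont_part c (ord g)) c d L ->
  (forall t, c < t < d -> p t = 0) -> L = 0.
Proof.
move=> alc; rewrite le_eqVlt => /predU1P[->|cd] HL p0.
  apply: (RS_unique (lexx d) HL); apply/is_RS_integralP => e e0; exists 1 => // N tau xi T.
  rewrite subr0 /RS_sum big1 ?normr0// => k _.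
  have [t_le tc] := tagged_itv T.
  have tE i : (i <= N)%N -> tau i = d by move=> /tc /andP[? ?]; apply/le_anti/andP.
  by rewrite !tE ?(ltnW (ltn_ord k))// subrr mulr0.
have := @RS_bound _ c d _ (cont_var g c) cd (fun x y cx xy _ => cont_var_incr gBV alc cx xy) p L 0 0 HL.
rewrite !mul0r subr0 normr_le0 => H; apply/eqP/H => t /p0 ->.
by rewrite subrr normr0.
Qed.

Lemma RS_cont_part_ex (p : R -> R) c d : (al < c%:E)%E -> c <= d ->
  (forall t, (al < t%:E)%E -> cvg (p @ t^'-) /\ cvg (p @ t^'+)) ->
  exists L, is_RS_integral p (cont_part c (ord g)) c d L.
Proof.
move=> alc; rewrite le_eqVlt => /predU1P[->|cd] rp.
  exists 0; apply/is_RS_integralP => e e0; exists 1 => // N tau xi T.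
  rewrite subr0 /RS_sum big1 ?normr0// => k _.
  have [t_le tc] := tagged_itv T.
  have tE i : (i <= N)%N -> tau i = d by move=> /tc /andP[? ?]; apply/le_anti/andP.
  by rewrite !tE ?(ltnW (ltn_ord k))// subrr mulr0.
apply: (@RS_regulated _ c d _ (cont_var g c) cd) => [x y cx xy _|t e ct td e0|t ct _].
- exact: (cont_var_incr gBV).
- exact: (cont_var_cont gBV).
- by apply: rp; exact: lte_trans_fin ct.
Qed.

(** Outside of [c, d] the integrand vanishes, so enlarging the interval adds two
zero integrals. *)
Lemma RS_widen (p : R -> R) C D c d L L' : (al < C%:E)%E ->
  C <= c -> c <= d -> d <= D ->
  (forall t, (al < t%:E)%E -> cvg (p @ t^'-) /\ cvg (p @ t^'+)) ->
  (forall t, (al < t%:E)%E -> p t != 0 -> c <= t <= d) ->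
  is_RS_integral p (cont_part c (ord g)) c d L ->
  is_RS_integral p (cont_part C (ord g)) C D L' -> L' = L.
Proof.
move=> alC Cc cd dD rp p0 HL HL'.
have alc := lte_trans_fin alC Cc; have ald := lte_trans_fin alc cd.
have pz t : (al < t%:E)%E -> ~ (c <= t <= d) -> p t = 0.
  by move=> alt tn; apply/eqP; apply: contra_notT tn; exact: p0.
have HL2 : is_RS_integral p (cont_part C (ord g)) c d L.
  apply: eq_RS HL => // s t /andP[cs sd] /andP[ct td].
  by apply: cont_part_indep => //; exact: le_trans Cc _.
have [L1 HL1] := RS_cont_part_ex alC Cc rp.
have [L3 HL3] := RS_cont_part_ex ald dD rp.
have HL3' : is_RS_integral p (cont_part C (ord g)) d D L3.
  apply: eq_RS HL3 => // s t /andP[cs sd] /andP[ct td].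
  by apply: cont_part_indep => //; rewrite (le_trans Cc)// (le_trans cd).
have [L12 HL12] := RS_cont_part_ex alC (le_trans Cc cd) rp.
rewrite (RS_cat (le_trans Cc cd) dD HL12 HL3' HL') (RS_cat Cc cd HL1 HL2 HL12).
rewrite (RS_zero alC Cc HL1) => [|t /andP[Ct tc]]; last first.
  by apply: pz; [exact: lte_trans_fin (ltW Ct)|rewrite leNgt tc].
rewrite (RS_zero ald dD HL3) => [|t /andP[dt tD]]; last first.
  by apply: pz; [exact: lte_trans_fin (ltW dt)|rewrite (leNgt t) dt andbF].
by rewrite add0r addr0.
Qed.

(** The intervals allowed by the definition all give the same value, as can be
seen on a common larger interval. *)
Lemma int_dcont_ex (p : R -> R) c d : (al < c%:E)%E -> c < d ->
  (forall t, (al < t%:E)%E -> cvg (p @ t^'-) /\ cvg (p @ t^'+)) ->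
  (forall t, (al < t%:E)%E -> p t != 0 -> c <= t <= d) ->
  is_RS_integral p (cont_part c (ord g)) c d (int_dcont al +oo%E p (ord g)).
Proof.
move=> alc cd rp p0; have [L HL] := RS_cont_part_ex alc (ltW cd) rp.
suff -> : int_dcont al +oo%E p (ord g) = L by [].
rewrite /int_dcont; case: xgetP => [L' _ [c' [d' [c'd' sub p0' HL']]]|/(_ L) []]; last first.
  exists c, d; split=> // t; last by case=> ? _; exact: p0.
  by rewrite /= in_itv/= => /andP[ct _]; split; [exact: lte_trans_fin ct|exact: ltry].
have alc' : (al < c'%:E)%E.
  by have [] : oitv al +oo%E c' by apply: sub; rewrite /= in_itv/= lexx ltW.
pose C := Num.min c c'; pose D := Num.max d d'.
have alC : (al < C%:E)%E by rewrite /C; have [cc|cc] := leP c c'.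
have CD : C <= D by rewrite /C /D ge_min !le_max (ltW cd).
have [L'' HL''] := RS_cont_part_ex alC CD rp.
rewrite -(RS_widen alC _ (ltW cd) _ rp p0 HL HL''); last 2 first.
- by rewrite /C ge_min lexx.
- by rewrite /D le_max lexx.
symmetry; apply: (RS_widen alC _ (ltW c'd') _ rp _ HL' HL'').
- by rewrite /C ge_min lexx orbT.
- by rewrite /D le_max lexx orbT.
- by move=> t alt; apply: p0'; split=> //; exact: ltry.
Qed.

Lemma int_dcont0 (p : R -> R) : (forall t, (al < t%:E)%E -> p t = 0) ->
  (exists t, (al < t%:E)%E) -> int_dcont al +oo%E p (ord g) = 0.
Proof.
move=> p0 [c alc]; have cd : c < c + 1 by rewrite ltrDl.
apply: (RS_zero alc (ltW cd) (int_dcont_ex alc cd _ _)).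
- move=> t alt; split; apply/cvg_ex; exists 0; apply: cvg_near_cst.
    have [s st als] := ltal_window alt; apply/near_at_leftP.
    exists (t - s); first by rewrite subr_gt0.
    by move=> r tr rt; rewrite p0//; apply: lte_trans_fin als _; lra.
  apply/near_at_rightP; exists 1 => // r tr _; rewrite p0//.
  by apply: lte_trans_fin alt _; exact: ltW.
- by move=> t /p0 ->; rewrite eqxx.
- by move=> t /andP[ct _]; rewrite p0//; apply: lte_trans_fin alc _; exact: ltW.
Qed.

End int_dcont.

(** * The two families of test functions *)

Section tests.
Context {R : realType}.
Implicit Types (c d t s e x y a b : R) (al : \bar R) (p q f : dynfun R).
Local Notation hlf := (2^-1 : R).
Local Notation Nhlf := (- 2^-1 : R).

Definition chi a b s : R := (a < s < b)%R%:R.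

Lemma chi_left a b s : exists l, exists2 eta, 0 < eta &
  forall r, s - eta < r -> r < s -> chi a b r = l.
Proof.
have [sa|as_] := leP s a.
  exists 0, 1 => // r _ rs; rewrite /chi; have -> : (a < r) = false by apply/negP; lra.
  by [].
have [sb|bs] := leP s b.
  exists 1, (s - a); [lra|move=> r h1 h2; rewrite /chi].
  by have -> : a < r < b by lra.
exists 0, (s - b); [lra|move=> r h1 h2; rewrite /chi].
by have -> : (a < r < b) = false by apply/negP; lra.
Qed.

Lemma chi_right a b s : exists l, exists2 eta, 0 < eta &
  forall r, s < r -> r < s + eta -> chi a b r = l.
Proof.
have [sa|as_] := ltP s a.
  exists 0, (a - s); [lra|move=> r h1 h2; rewrite /chi].
  by have -> : (a < r < b) = false by apply/negP; lra.
have [sb|bs] := ltP s b.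
  exists 1, (b - s); [lra|move=> r h1 h2; rewrite /chi].
  by have -> : a < r < b by lra.
exists 0, 1 => // r h1 h2; rewrite /chi.
by have -> : (a < r < b) = false by apply/negP; lra.
Qed.

Lemma chi_cvg_left a b s : cvg (chi a b @ s^'-).
Proof.
have [l [eta eta0 H]] := chi_left a b s; apply/cvg_ex; exists l.
by apply: cvg_near_cst; apply/near_at_leftP; exists eta.
Qed.

Lemma chi_cvg_right a b s : cvg (chi a b @ s^'+).
Proof.
have [l [eta eta0 H]] := chi_right a b s; apply/cvg_ex; exists l.
by apply: cvg_near_cst; apply/near_at_rightP; exists eta.
Qed.

Lemma isG_chi a b : isG Nhlf%:E hlf%:E (chi a b).
Proof.
split=> [|t _||] /=; [|split| |].
- by exists 1 => t _; rewrite /chi; case: (_ && _); rewrite /= ?normr1 ?normr0.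
- exact: chi_cvg_left.
- exact: chi_cvg_right.
- exact: chi_cvg_right.
- exact: chi_cvg_left.
Qed.

Lemma isG_cst (k : R) : isG Nhlf%:E hlf%:E (fun=> k).
Proof.
split=> [|t _||] /=; [|split| |]; try exact: is_cvg_cst.
by exists `|k|.
Qed.

Lemma dyn_cvg_near (F : set_system R) (FF : Filter F) f c :
  (\forall t \near F, forall s, J s -> f t s = c) -> dyn_cvg F f c.
Proof.
move=> H e e0; apply: filterS H => t Ht s Js.
by rewrite Ht// subrr normr0 ltW.
Qed.

(** The last hypothesis places the support in the compact interval [c, d], which
also makes the limits at the ends of (al, +oo) vanish. *)
Lemma is_testI al c d p : (al < c%:E)%E -> c <= d ->
  (forall t, isG Nhlf%:E hlf%:E (p t)) -> has_dyn_limits al p ->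
  (forall t s, J s -> ~ (c <= t <= d) -> p t s = 0) -> is_test al +oo%E p.
Proof.
move=> alc cd pG plim p0.
have suppcd : supp al +oo%E p `<=` `[c, d]%classic.
  have /closure_id -> : closed `[c, d]%classic by exact: interval_closed.
  apply: closure_subset.
  move=> t [_ [s Js pts]]; rewrite /= in_itv/=; apply: contra_neqP pts => tn.
  by apply: p0.
split; last first.
- move=> t /suppcd; rewrite /= in_itv/= => /andP[ct _].
  by split; [exact: lte_trans_fin ct|exact: ltry].
- apply: subclosed_compact suppcd; first exact: closed_closure.
  exact: segment_compact.
- split=> [t _|t []||]; [exact: pG|by move=> alt _; exact: plim| |].
  + exists 0; move: alc; case: al {plim suppcd} => [a| |] alc.
    * apply: (@dyn_cvg_near a^'+); near=> t => s Js; apply: p0 => // /andP[ct _].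
      have : t < c by near: t; apply: nbhs_right_lt; rewrite -lte_fin.
      by rewrite ltNge ct.
    * by move: alc; rewrite ltNge leey.
    * apply: (@dyn_cvg_near (ninfty_nbhs R)); near=> t => s Js; apply: p0 => // /andP[ct _].
      have : t < c by near: t; apply: nbhs_ninfty_lt; exact: num_real.
      by rewrite ltNge ct.
  + exists 0; apply: (@dyn_cvg_near (pinfty_nbhs R)).
    near=> t => s Js; apply: p0 => // /andP[_ td].
    have : d < t by near: t; apply: nbhs_pinfty_gt; exact: num_real.
    by rewrite ltNge td.
Unshelve. all: by end_near. Qed.

Definition itv_test c d : dynfun R := fun t _ => chi c d t.

Lemma itv_test_lim al c d : has_dyn_limits al (itv_test c d).
Proof.
move=> t _; split.
  have [l [eta eta0 H]] := chi_left c d t; exists l; apply: dyn_cvg_near.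
  by apply/near_at_leftP; exists eta => // r h1 h2 s _; exact: H.
have [l [eta eta0 H]] := chi_right c d t; exists l; apply: dyn_cvg_near.
by apply/near_at_rightP; exists eta => // r h1 h2 s _; exact: H.
Qed.

Lemma itv_test_test al c d : (al < c%:E)%E -> c <= d -> is_test al +oo%E (itv_test c d).
Proof.
move=> alc cd; apply: (is_testI alc cd) => [t||t s _ tn].
- exact: isG_cst.
- exact: itv_test_lim.
- rewrite /itv_test /chi; have -> : (c < t < d) = false; last by [].
  by apply/negP => /andP[/ltW h1 /ltW h2]; apply: tn; rewrite h1.
Qed.

Definition jump_test (tau s1 s2 : R) : dynfun R :=
  fun t s => if t == tau then chi s1 s2 s else 0.

Lemma jump_test_test al tau s1 s2 : (al < tau%:E)%E ->
  is_test al +oo%E (jump_test tau s1 s2).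
Proof.
move=> alt; apply: (is_testI alt (lexx tau)) => [t|t _|t s _ tn].
- rewrite /jump_test; case: eqP => _; first exact: isG_chi.
  exact: isG_cst.
- split; exists 0; apply: dyn_cvg_near.
    apply/near_at_leftP; exists (if t <= tau then 1 else t - tau).
      by case: ifPn => //; rewrite -ltNge subr_gt0.
    move=> r h1 h2 s _; rewrite /jump_test ifF//; apply/eqP => rt.
    by move: h1; rewrite rt; case: ifPn; rewrite -?ltNge => ?; lra.
  apply/near_at_rightP; exists (if tau <= t then 1 else tau - t).
    by case: ifPn => //; rewrite -ltNge subr_gt0.
  move=> r h1 h2 s _; rewrite /jump_test ifF//; apply/eqP => rt.
  by move: h2; rewrite rt; case: ifPn; rewrite -?ltNge => ?; lra.
- rewrite /jump_test ifF//; apply/eqP => tE; apply: tn.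
  by rewrite tE lexx.
Qed.

Lemma itv_test_ge0 c d t s : 0 <= itv_test c d t s.
Proof. by rewrite /itv_test /chi; case: (_ && _). Qed.

Lemma jump_test_ge0 tau s1 s2 t s : 0 <= jump_test tau s1 s2 t s.
Proof. by rewrite /jump_test /chi; case: eqP => // _; case: (_ && _). Qed.

Lemma ord_itv_test c d t : ord (itv_test c d) t = chi c d t.
Proof. by rewrite /ord asboolT. Qed.

(** The test function is nonzero at a single time, with value 0 at the initial
point of J, so its ordinary part is zero: it only sees the jump at tau. *)
Lemma ord_jump_test0 q tau s1 s2 t : Nhlf <= s1 ->
  ord (fun t s => q t s * jump_test tau s1 s2 t s) t = 0.
Proof.
move=> s1J; rewrite /ord; case: asboolP => [oq|noq].
  rewrite -(oq _ JNhlf) /jump_test; case: eqP => _; last by rewrite mulr0.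
  by rewrite /chi ltNge s1J/= mulr0.
have [tt|tt] := eqVneq t tau; last first.
  by exfalso; apply: noq => s Js; rewrite /jump_test (negbTE tt) !mulr0.
apply: dyn_limE; apply: dyn_cvg_near; apply/near_at_leftP; exists 1 => // r _ rt s _.
by rewrite /jump_test ifF ?mulr0//; apply/eqP => rE; move: rt; rewrite rE tt ltxx.
Qed.

Lemma dyn_cvgM (F : set_system R) (FF : Filter F) f q a b :
  dyn_cvg F f a -> dyn_cvg F q b -> dyn_cvg F (fun t s => f t s * q t s) (a * b).
Proof.
move=> Hf Hq e e0.
pose M := `|a| + `|b| + 1; have M0 : 0 < M by rewrite ltr_wpDl// addr_ge0.
pose r := Num.min 1 (e / M).
have r0 : 0 < r by rewrite lt_min ltr01 divr_gt0.
apply: filterS (filterI (Hf _ r0) (Hq _ r0)) => t [h1 h2] s Js.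
have {}h1 := h1 s Js; have {}h2 := h2 s Js.
have -> : f t s * q t s - a * b = (f t s - a) * (q t s - b) + a * (q t s - b) +
   (f t s - a) * b by ring.
have r1 : r <= 1 by rewrite ge_min lexx.
have rM : r * M <= e.
  by rewrite -ler_pdivlMr// ge_min lexx orbT.
apply: le_trans rM; rewrite (le_trans (ler_normD _ _))//.
have H1 : `|(f t s - a) * (q t s - b)| <= r.
  rewrite normrM -[leRHS]mulr1 ler_pM//; exact: le_trans r1.
have H2 : `|a * (q t s - b)| <= `|a| * r by rewrite normrM ler_wpM2l.
have H3 : `|(f t s - a) * b| <= r * `|b| by rewrite normrM ler_wpM2r.
have := ler_normD ((f t s - a) * (q t s - b)) (a * (q t s - b)).
have -> : r * M = `|a| * r + r * `|b| + r by rewrite /M; ring.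
lra.
Qed.

Lemma has_dyn_limitsM al f q : has_dyn_limits al f -> has_dyn_limits al q ->
  has_dyn_limits al (fun t s => f t s * q t s).
Proof.
move=> Hf Hq t alt; have [[a Ha] [b Hb]] := Hf t alt; have [[a' Ha'] [b' Hb']] := Hq t alt.
by split; [exists (a * a'); exact: (dyn_cvgM _ Ha Ha')|exists (b * b'); exact: (dyn_cvgM _ Hb Hb')].
Qed.

Lemma ord_mul_itv_test0 q c d t : ~ (c < t < d) ->
  ord (fun t s => q t s * itv_test c d t s) t = 0.
Proof.
move=> tn; have chi0 : chi c d t = 0 by rewrite /chi; case: (boolP (c < t < d)).
rewrite /ord; case: asboolP => [_|[]]; first by rewrite /itv_test chi0 mulr0.
by move=> s _; rewrite /itv_test chi0 !mulr0.
Qed.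

(** Where the product is not ordinary, its ordinary part is a left limit of values
taken inside (c, d). *)
Lemma ord_mul_itv_test al q c d t b e : (al < c%:E)%E -> c < t < d ->
  has_dyn_limits al q ->
  (forall t s, c < t < d -> J s -> `|q t s - b| <= e) ->
  `|ord (fun t s => q t s * itv_test c d t s) t - b| <= e.
Proof.
move=> alc ctd ql qb; set f := fun t s => _.
have fE r s : c < r < d -> f r s = q r s by move=> crd; rewrite /f /itv_test /chi crd mulr1.
rewrite /ord; case: asboolP => _; first by rewrite fE//; apply: qb => //; exact: J0.
have ct : c < t by case/andP: ctd.
have [[l Hl] _] := has_dyn_limitsM ql (@itv_test_lim al c d) (lte_trans_fin alc (ltW ct)).
rewrite (dyn_limE _ Hl); apply: dyn_cvg_dist Hl _.
apply/near_at_leftP; exists (t - c); first by rewrite subr_gt0.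
move=> r h1 h2; have crd : c < r < d by have /andP[_ h3] := ctd; lra.
by rewrite -/(f r 0) fE//; apply: qb => //; exact: J0.
Qed.

Lemma Rintegral_eq0 (disp : measure_display) (T : measurableType disp) (mu : {measure set T -> \bar R})
  (D : set T) (F : T -> R) : (forall w, D w -> F w = 0) -> \int[mu]_(w in D) F w = 0.
Proof.
by move=> F0; rewrite /Rintegral integral0_eq// => x /F0 ->.
Qed.

(** As h may fail to be measurable, its integral is squeezed between those of the
constants a - e and a + e. *)
Lemma regular_itv al (h : R -> R) c d a e : (al < c%:E)%E -> c < d ->
  (forall t, c < t < d -> `|h t - a| <= e) ->
  `|regular al +oo%E h (itv_test c d) - a * (d - c)| <= e * (d - c).
Proof.
move=> alc cd ha; rewrite /regular.
set D := oitv al +oo%E.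
have DE : D = [set` Interval (if al is r%:E%E then BRight r else -oo%O) +oo%O].
  apply/seteqP; split=> t; rewrite /D /oitv /=; move: alc.
    case: al {D} => [r| |] /=; rewrite ?lte_fin ?in_itv/=; first by move=> _ [->].
      by rewrite ltNge leey.
    by [].
  case: al {D} => [r| |] /=; rewrite ?lte_fin ?in_itv/=.
  - by move=> _; rewrite andbT => ->; rewrite ltry.
  - by rewrite ltNge leey.
  - by split; [exact: ltNyr|exact: ltry].
have mD : measurable (D : set (measurableTypeR R)) by rewrite DE; exact: measurable_itv.
have mS : measurable (`]c, d[%classic : set (measurableTypeR R)) by exact: measurable_itv.
have DS : D `&` `]c, d[%classic = `]c, d[%classic.
  rewrite setIidr// => x; rewrite /= in_itv/= => /andP[cx _].
  by split; [exact: lte_trans_fin (ltW cx)|exact: ltry].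
have mcd : (@lebesgue_measure R) `]c, d[%classic = (d - c)%:E.
  by apply: etrans (lebesgue_measure_itv `]c, d[) _; rewrite /= lte_fin cd.
have iE (k : R) : \int[lebesgue_measure]_(t in D) (patch (fun=> 0) `]c, d[%classic (fun=> k)) t = k * (d - c).
  by rewrite -Rintegral_mkcondr DS Rintegral_cst//; congr (_ * _); exact: (congr1 fine mcd).
have ii (k : R) : (@lebesgue_measure R).-integrable D
    (EFin \o patch (fun=> 0) `]c, d[%classic (fun=> k)).
  rewrite (_ : EFin \o _ = (EFin \o (fun=> k)) \_ `]c, d[%classic); last first.
    by apply/funext => x; rewrite /= /patch; case: ifP.
  apply/(integrable_restrict _ mS mD); rewrite DS.
  apply: measurable_bounded_integrable => //.
    by apply: le_lt_trans (ltry (d - c)); rewrite -mcd; exact: lexx.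
  exists `|k|; split=> // y ky t _ /=; exact: ltW.
have := ae_le_Rintegral_sandwich mD measurable0 (measure0 _) (ii (a - e)) (ii (a + e)).
move=> /(_ (fun t => h t * ord (itv_test c d) t)) Hs.
suff /Hs : forall x : R, D x -> ~ set0 x ->
   patch (fun=> 0) `]c, d[%classic (fun=> a - e) x <= h x * ord (itv_test c d) x <=
   patch (fun=> 0) `]c, d[%classic (fun=> a + e) x.
  by rewrite !iE ler_norml => /andP[? ?]; apply/andP; split; lra.
move=> x Dx _; rewrite ord_itv_test /chi /patch.
case: ifPn => [|xn].
  rewrite inE /= in_itv/= => xcd; rewrite xcd mulr1.
  by have := ha x xcd; rewrite ler_norml; lra.
have -> : (c < x < d) = false by apply/negP => xcd; move: xn; rewrite mem_set//= in_itv.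
by rewrite mulr0 lexx.
Qed.

End tests.

(** * The derivative tested on intervals and inside jumps *)

Section deriv.
Context {R : realType}.
Implicit Types (c d t s e x y a b : R) (q : dynfun R).
Local Notation hlf := (2^-1 : R).
Local Notation Nhlf := (- 2^-1 : R).
Variables (al : \bar R) (g : dynfun R).
Hypothesis gBV : is_sBVloc al +oo%E g.

Definition value_var_to t s : R := fine (total_variation Nhlf s (g t)).

Lemma value_var_to_hlf t : value_var_to t hlf = value_var g t. Proof. by []. Qed.

Lemma value_var_to_Nhlf t : value_var_to t Nhlf = 0.
Proof. by rewrite /value_var_to total_variationxx. Qed.

Lemma value_var_to_incr t x y : (al < t%:E)%E -> Nhlf <= x -> x <= y -> y <= hlf ->
  `|g t y - g t x| <= value_var_to t y - value_var_to t x.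
Proof.
move=> alt xJ xy yJ; have bv := sBV_bounded_variation gBV alt.
have bvx : bounded_variation Nhlf x (g t).
  exact: (bounded_variationl xJ (le_trans xy yJ) bv).
have bvxy : bounded_variation x y (g t).
  by apply: (bounded_variationl xy yJ); exact: (bounded_variationr xJ (le_trans xy yJ) bv).
rewrite /value_var_to (total_variationD _ xJ xy) fineD; try exact/bounded_variationP.
rewrite [leRHS]addrC addKr -lee_fin fineK ?total_variation_ge//.
exact/bounded_variationP.
Qed.

Lemma value_var_to_nd t x y : (al < t%:E)%E -> Nhlf <= x -> x <= y -> y <= hlf ->
  value_var_to t x <= value_var_to t y.
Proof.
move=> alt xJ xy yJ; rewrite -subr_ge0; exact: le_trans (value_var_to_incr alt xJ xy yJ).
Qed.

Lemma not_disc_value_var t : (al < t%:E)%E -> ~ disc al +oo%E g t -> value_var g t = 0.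
Proof.
move=> alt nd; rewrite /value_var ordinary_total_variation//.
have /contrapT[] : ~ ~ dyn_continuous_at g t; last by [].
by move=> nc; apply: nd; split=> //; split=> //; exact: ltry.
Qed.

Local Notation jint F t := (\int[lebesgue_measure]_(s in @J R) (F t s * derive1 (g t) s)).

Lemma jint_bound (q p : dynfun R) t s1 s2 b e : (al < t%:E)%E ->
  Nhlf <= s1 -> s1 <= s2 -> s2 <= hlf ->
  (forall s, s1 < s < s2 -> `|q t s - b| <= e /\ p t s = q t s) ->
  (forall s, J s -> s < s1 \/ s2 < s -> p t s = 0) ->
  `|jint p t - b * (g t s2 - g t s1)| <= e * (value_var_to t s2 - value_var_to t s1).
Proof.
move=> alt h1 h2 h3 qb p0; have [ac _ _] := sBV_sG gBV alt.
apply: (@jump_integral _ (g t) (q t)) => //.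
- exact: (sBV_bounded_variation gBV alt).
- by move=> s ss; have [? pq] := qb s ss; rewrite pq.
- by move=> s Js ss; rewrite p0// mul0r.
Qed.

(** Tested inside one jump, the derivative of g is an integral over J, and the
factor q may be replaced by a constant b at the cost of e times the variation
of g in between. *)
Lemma deriv_jump q tau s1 s2 b e : (al < tau%:E)%E ->
  Nhlf <= s1 -> s1 <= s2 -> s2 <= hlf ->
  (forall s, s1 < s < s2 -> `|q tau s - b| <= e) ->
  `|deriv_distr al +oo%E g (fun t s => q t s * jump_test tau s1 s2 t s)
     - b * (g tau s2 - g tau s1)| <= e * (value_var_to tau s2 - value_var_to tau s1).
Proof.
move=> alt h1 h2 h3 qb.
pose p : dynfun R := fun t s => q t s * jump_test tau s1 s2 t s; rewrite -/p.
rewrite /deriv_distr (int_dcont0 gBV); last 2 first.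
- by move=> t _; exact: ord_jump_test0.
- by exists tau.
rewrite add0r.
have p0 t : t <> tau -> forall s, p t s = 0.
  by move=> /eqP/negbTE tt s; rewrite /p /jump_test tt mulr0.
have jb : `|jint p tau - b * (g tau s2 - g tau s1)| <= e * (value_var_to tau s2 - value_var_to tau s1).
  apply: (@jint_bound q) => // [s ss|s Js ss].
    by split; [exact: qb|rewrite /p /jump_test eqxx /chi ss mulr1].
  rewrite /p /jump_test eqxx /chi; have -> : (s1 < s < s2) = false.
    by apply/negP => /andP[? ?]; case: ss; lra.
  by rewrite mulr0.
have jp0 : ~ disc al +oo%E g tau -> jint p tau = 0.
  move=> nd; have v0 := not_disc_value_var alt nd.
  have dT0 : value_var_to tau s2 - value_var_to tau s1 = 0.
    have := value_var_to_nd alt (lexx _) h1 (le_trans h2 h3).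
    have := value_var_to_nd alt h1 h2 h3.
    have := value_var_to_nd alt (le_trans h1 h2) h3 (lexx _).
    by rewrite value_var_to_hlf value_var_to_Nhlf v0; lra.
  have := @jint_bound q p tau s1 s2 0 (`|b| + e) alt h1 h2 h3.
  rewrite dT0 mulr0 mul0r subr0 normr_le0 => H; apply/eqP/H => s ss.
    rewrite subr0; split; last by rewrite /p /jump_test eqxx /chi ss mulr1.
    rewrite -[q tau s](subrK b) addrC (le_trans (ler_normD _ _))// lerD2l.
    exact: qb.
  move=> out; rewrite /p /jump_test eqxx /chi; have -> : (s1 < s < s2) = false.
    by apply/negP => /andP[? ?]; case: out; lra.
  by rewrite mulr0.
suff -> : ssum (disc al +oo%E g) (fun t => jint p t) = jint p tau by [].
transitivity (ssum [set tau] (fun t => jint p t)); last first.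
  by rewrite ssumE /psum !esum_set1 ?lee_fin ?maxr0_ge0//; exact: maxr0B.
transitivity (ssum (disc al +oo%E g `&` [set tau]) (fun t => jint p t)).
  symmetry; apply: ssum_widen; first exact: subIsetl.
  move=> t dt tn; apply: Rintegral_eq0 => s Js; rewrite p0 ?mul0r// => tt.
  by apply: tn.
apply: ssum_widen; first exact: subIsetr.
by move=> t -> nd; apply: jp0 => dt; apply: nd.
Qed.

(** The continuous part and each of the jumps inside (c, d) are replaced
separately by b times their increments, with errors e times their variations;
the increments add up to g(d-) - g(c+) and the variations to the weight on the
right. *)
Lemma deriv_itv q c0 c d b e : (al < c0%:E)%E -> c0 <= c -> c < d -> 0 <= e ->
  has_dyn_limits al q ->
  (forall t s, c < t < d -> J s -> `|q t s - b| <= e) ->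
  `|deriv_distr al +oo%E g (fun t s => q t s * itv_test c d t s)
     - b * (g d Nhlf - g c hlf)|
   <= e * (cont_var g c0 d - cont_var g c0 c + psum `]c, d[%classic (value_var g)).
Proof.
move=> al0 c0c cd e0 ql qb.
pose p : dynfun R := fun t s => q t s * itv_test c d t s; rewrite -/p /deriv_distr.
have alc := lte_trans_fin al0 c0c.
have pl : has_dyn_limits al p by apply: has_dyn_limitsM => //; exact: itv_test_lim.
have := int_dcont_ex gBV alc cd (fun t alt => ord_regulated pl alt).
have pz : forall t, (al < t%:E)%E -> ord p t != 0 -> c <= t <= d.
  move=> t alt; apply: contra_neqT => tn; apply: ord_mul_itv_test0.
  by move=> /andP[h1 h2]; move: tn; rewrite !ltW.
move=> /(_ pz) HA.
set A := int_dcont _ _ _ _ in HA *.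
have HA0 : is_RS_integral (ord p) (cont_part c0 (ord g)) c d A.
  apply: eq_RS HA => // s t /andP[cs sd] /andP[ct td].
  by apply: (cont_part_indep gBV) => //; exact: le_trans c0c _.
have hV x y : c <= x -> x <= y -> y <= d ->
    `|cont_part c0 (ord g) y - cont_part c0 (ord g) x| <= cont_var g c0 y - cont_var g c0 x.
  by move=> cx xy _; apply: (cont_var_incr gBV) => //; exact: le_trans cx.
have pb t : c < t < d -> `|ord p t - b| <= e.
  by move=> ctd; exact: (ord_mul_itv_test alc).
have HAb := RS_bound cd hV HA0 pb.
rewrite (cont_part_incr gBV al0 c0c cd) in HAb.
set S := ssum _ _.
have sub : `]c, d[%classic `<=` `[c0, d]%classic.
  by move=> t /=; rewrite !in_itv/= => /andP[h1 h2]; rewrite (ltW h2) (le_trans c0c)// ltW.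
have sv : abs_summable `]c, d[%classic (value_var g) by exact: (value_var_summableW gBV al0 sub).
have sj : abs_summable `]c, d[%classic (jump g) by exact: (jump_summableW gBV al0 sub).
have jb t : c < t < d -> `|jint p t - b * jump g t| <= e * value_var g t.
  move=> ctd; have alt : (al < t%:E)%E.
    by have /andP[/ltW ct _] := ctd; exact: lte_trans_fin alc ct.
  have := @jint_bound q p t Nhlf hlf b e alt (lexx _) (ltW NhlfLhlf) (lexx _).
  rewrite value_var_to_hlf value_var_to_Nhlf subr0; apply=> [s /andP[s1 s2]|s]; last first.
    by rewrite JE => /andP[h1 h2] [|] /lt_geF; rewrite ?h1 ?h2.
  split; last by rewrite /p /itv_test /chi ctd mulr1.
  by apply: qb => //; rewrite JE !ltW.
have jp0 t : ~ disc al +oo%E g t -> c < t < d -> jint p t = 0.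
  move=> nd ctd; have alt : (al < t%:E)%E.
    by have /andP[/ltW ct _] := ctd; exact: lte_trans_fin alc ct.
  have v0 := not_disc_value_var alt nd.
  have : jump g t = 0.
    by apply/eqP; rewrite -normr_le0 -v0; exact: (jump_le_value_var gBV).
  move=> j0; have := jb t ctd; rewrite j0 v0 !mulr0 subr0 normr_le0.
  by move/eqP.
have SE : S = ssum `]c, d[%classic (fun t => jint p t).
  transitivity (ssum (disc al +oo%E g `&` `]c, d[%classic) (fun t => jint p t)).
    symmetry; apply: ssum_widen; first exact: subIsetl.
    move=> t dt tn; apply: Rintegral_eq0 => s Js.
    have -> : p t s = 0; last by rewrite mul0r.
    rewrite /p /itv_test /chi; have -> : (c < t < d) = false; last by rewrite mulr0.
    by apply/negP => ctd; apply: tn; split=> //; rewrite /= in_itv.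
  apply: ssum_widen; first exact: subIsetr.
  by move=> t; rewrite /= in_itv/= => ctd nd; apply: jp0 => // dt; apply: nd.
have sjint : abs_summable `]c, d[%classic (fun t => jint p t).
  apply: (@abs_summable_le _ _ _ (fun t => (`|b| + e) * value_var g t)); last exact: abs_summableZ.
  move=> t; rewrite /= in_itv/= => ctd.
  have alt : (al < t%:E)%E.
    by have /andP[/ltW ct _] := ctd; exact: lte_trans_fin alc ct.
  rewrite -[X in `|X|](subrK (b * jump g t)) addrC (le_trans (ler_normD _ _))//.
  by rewrite mulrDl lerD ?jb// normrM ler_wpM2l// (jump_le_value_var gBV).
have Sb : `|S - b * ssum `]c, d[%classic (jump g)| <= e * psum `]c, d[%classic (value_var g).
  rewrite SE -mulNr -ssumZ// -ssumD//; last exact: abs_summableZ.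
  rewrite -psumZ//; last by move=> t _; exact: value_var_ge0.
  apply: abs_ssum_le; last exact: abs_summableZ.
  by move=> t; rewrite /= in_itv/= => ctd; rewrite mulNr jb.
set SJ := ssum _ (jump g) in HAb Sb *.
have -> : A + S - b * (g d Nhlf - g c hlf) =
    (A - b * (g d Nhlf - g c hlf - SJ)) + (S - b * SJ) by ring.
by rewrite [leRHS]mulrDr (le_trans (ler_normD _ _))// lerD.
Qed.

End deriv.

(** * Euclidean norm and Lipschitz maps *)

Section norm2.
Context {R : realType}.
Variable n : nat.
Implicit Types (x y z : 'cV[R]_n).

Definition dot x y : R := \sum_(i < n) x i 0 * y i 0.

Lemma norm2_ge0 x : 0 <= norm2 x.
Proof. exact: sqrtr_ge0. Qed.

Lemma norm2_sqr x : norm2 x ^+ 2 = dot x x.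
Proof.
rewrite sqr_sqrtr; last by apply: sumr_ge0 => i _; exact: sqr_ge0.
by apply: eq_bigr => i _; rewrite expr2.
Qed.

Lemma dotDr x y z : dot x (y + z) = dot x y + dot x z.
Proof. by rewrite -big_split/=; apply: eq_bigr => i _; rewrite mxE mulrDr. Qed.

Lemma dotC x y : dot x y = dot y x.
Proof. by apply: eq_bigr => i _; rewrite mulrC. Qed.

Lemma dotZr x (k : R) y : dot x (k *: y) = k * dot x y.
Proof. by rewrite /dot mulr_sumr; apply: eq_bigr => i _; rewrite mxE; ring. Qed.

Lemma norm2Z (k : R) x : norm2 (k *: x) = `|k| * norm2 x.
Proof.
rewrite /norm2 -(sqrtr_sqr k) -sqrtrM ?sqr_ge0// mulr_sumr.
by congr Num.sqrt; apply: eq_bigr => i _; rewrite mxE exprMn.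
Qed.

Lemma norm2N x : norm2 (- x) = norm2 x.
Proof. by rewrite -scaleN1r norm2Z normrN1 mul1r. Qed.

Lemma entry_le_norm2 x i : `|x i 0| <= norm2 x.
Proof.
rewrite -sqrtr_sqr; apply: ler_wsqrtr; rewrite (bigD1 i)//= lerDl.
by apply: sumr_ge0 => j _; exact: sqr_ge0.
Qed.

(** Cauchy-Schwarz, from the expansion of the sum of the squares of
norm2 y * x i - norm2 x * y i. *)
Lemma dot_le x y : dot x y <= norm2 x * norm2 y.
Proof.
have [x0|x0] := eqVneq (norm2 x) 0.
  rewrite x0 mul0r /dot big1// => i _.
  by have := entry_le_norm2 x i; rewrite x0 normr_le0 => /eqP ->; rewrite mul0r.
have [y0|y0] := eqVneq (norm2 y) 0.
  rewrite y0 mulr0 /dot big1// => i _.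
  by have := entry_le_norm2 y i; rewrite y0 normr_le0 => /eqP ->; rewrite mulr0.
have xy0 : 0 < norm2 x * norm2 y by rewrite mulr_gt0// lt_neqAle eq_sym ?x0 ?y0 norm2_ge0.
have : 0 <= \sum_(i < n) (norm2 y * x i 0 - norm2 x * y i 0) ^+ 2.
  by apply: sumr_ge0 => i _; exact: sqr_ge0.
have -> : \sum_(i < n) (norm2 y * x i 0 - norm2 x * y i 0) ^+ 2 =
   2 * (norm2 x * norm2 y) * (norm2 x * norm2 y - dot x y).
  transitivity (norm2 y ^+ 2 * dot x x + norm2 x ^+ 2 * dot y y
      - 2 * norm2 x * norm2 y * dot x y).
    rewrite /dot !mulr_sumr -sumrN -!big_split/=; apply: eq_bigr => i _; ring.
  by rewrite -!norm2_sqr; ring.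
by rewrite pmulr_rge0 ?subr_ge0// mulr_gt0.
Qed.

Lemma ler_norm2D x y : norm2 (x + y) <= norm2 x + norm2 y.
Proof.
rewrite -(@ler_pXn2r _ 2)// ?nnegrE ?addr_ge0 ?norm2_ge0//.
rewrite norm2_sqr dotDr dotC dotDr (dotC (x + y)) dotDr -!norm2_sqr (dotC y x).
by have := dot_le x y; rewrite sqrrD mulr2n; lra.
Qed.

Lemma norm2_le_sum x : norm2 x <= \sum_(i < n) `|x i 0|.
Proof.
rewrite -(@ler_pXn2r _ 2)// ?nnegrE ?norm2_ge0 ?sumr_ge0//.
rewrite norm2_sqr [leRHS]expr2 mulr_suml; apply: ler_sum => i _.
rewrite (le_trans (ler_norm _))// normrM ler_wpM2l// (bigD1 i)//= lerDl.
by apply: sumr_ge0.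
Qed.

Lemma norm2_le x (e : R) : (forall i, `|x i 0| <= e) -> norm2 x <= n%:R * e.
Proof.
move=> xe; apply: le_trans (norm2_le_sum x) _.
apply: (@le_trans _ _ (\sum_(i < n) e)); first exact: ler_sum.
by rewrite sumr_const card_ord mulr_natl.
Qed.

Lemma norm2_sub_le x y z : norm2 (x - z) <= norm2 (x - y) + norm2 (y - z).
Proof. by rewrite -[x - z](subrKA y) ler_norm2D. Qed.

Lemma norm2B x y : norm2 (x - y) = norm2 (y - x).
Proof. by rewrite -norm2N opprB. Qed.

(** Expanding the squares, norm2 y ^+ 2 is at most
norm2 x ^+ 2 + 2 (norm2 x) (P + Q). A displacement that is not outward to first
order thus increases the norm by a second order amount only. *)
Lemma norm2_growth x y (P Q : R) : 0 < norm2 x -> dot x (y - x) <= norm2 x * P ->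
  norm2 (y - x) ^+ 2 <= 2 * norm2 x * Q -> 0 <= P -> 0 <= Q ->
  norm2 y <= norm2 x + (P + Q).
Proof.
move=> x0 xP xQ P0 Q0.
rewrite -(@ler_pXn2r _ 2)// ?nnegrE ?addr_ge0 ?norm2_ge0//.
have -> : norm2 y ^+ 2 = norm2 x ^+ 2 + 2 * dot x (y - x) + norm2 (y - x) ^+ 2.
  have yE : y = x + (y - x) by rewrite addrC subrK.
  rewrite {1}yE; set v := y - x; rewrite !norm2_sqr dotDr dotC dotDr (dotC (x + v)) dotDr.
  by rewrite (dotC v x); ring.
rewrite sqrrD mulr2n; have := sqr_ge0 (P + Q); nra.
Qed.

End norm2.

Section lipschitz.
Context {R : realType}.
Variable n : nat.

Lemma mx_norm_entry m (A : 'M[R]_(n, m)) i j : `|A i j| <= `|A|.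
Proof.
by rewrite [leRHS]/Num.norm/= mx_normrE; apply/bigmax_geP; right; exists (i, j).
Qed.

Lemma mx_norm_le m (A : 'M[R]_(n, m)) (e : R) : 0 <= e ->
  (forall i j, `|A i j| <= e) -> `|A| <= e.
Proof.
move=> e0 Ae; rewrite [leLHS]/Num.norm/= mx_normrE; by apply/bigmax_leP; split.
Qed.

Lemma mx_norm_le_norm2 (x : 'cV[R]_n) : `|x| <= norm2 x.
Proof.
apply: mx_norm_le => [|i j]; first exact: norm2_ge0.
by rewrite (ord1 j) entry_le_norm2.
Qed.

Lemma norm2_le_mx_norm (x : 'cV[R]_n) : norm2 x <= n%:R * `|x|.
Proof. by apply: norm2_le => i; exact: mx_norm_entry. Qed.

(** Lipschitz conditions refer to the maximum norm, which is at most the Euclidean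
one. *)
Lemma lipschitz_norm2 m (D : set 'cV[R]_n) (f : 'cV[R]_n -> 'M[R]_(n, m)) :
  [lipschitz f x | x in D] -> exists2 L, 0 < L & forall x y, D x -> D y ->
    forall i j, `|f x i j - f y i j| <= L * norm2 (x - y).
Proof.
move=> [L0 [_ HL]]; pose L := `|L0| + 1.
have L0L : L0 < L by rewrite (le_lt_trans (ler_norm _))// ltrDl.
have L_gt0 : 0 < L by rewrite ltr_wpDl.
exists L => // x y Dx Dy i j; have := HL L L0L (x, y) => /(_ (conj Dx Dy)) /= H.
have := mx_norm_entry (f x - f y) i j; rewrite !mxE => /le_trans; apply.
by apply: le_trans H _; rewrite ler_pM2l// mx_norm_le_norm2.
Qed.

Lemma closed_norm2_ball (c : 'cV[R]_n) (r : R) : closed [set x | norm2 (x - c) <= r].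
Proof.
move=> x /= cx; apply/ler_addgt0Pr => e e0.
have e'0 : 0 < e / n.+1%:R by rewrite divr_gt0.
have [y [/= yc xy]] := cx _ (nbhsx_ballx x _ e'0).
apply: le_trans (norm2_sub_le x y c) _; rewrite addrC lerD//.
apply: le_trans (norm2_le_mx_norm _) _.
move: xy; rewrite -ball_normE /= => /ltW xy.
apply: (@le_trans _ _ (n%:R * (e / n.+1%:R))); first by rewrite ler_wpM2l.
rewrite mulrCA ler_piMr ?(ltW e0)// ler_pdivrMr// mul1r ler_nat.
exact: leqnSn.
Qed.

Lemma norm2_ball_nbhs (c : 'cV[R]_n) (r : R) : 0 < r -> exists U : set 'cV[R]_n,
  [/\ open U, U c & U `<=` [set x | norm2 (x - c) <= r]].
Proof.
move=> r0; have e'0 : 0 < r / n.+1%:R by rewrite divr_gt0.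
exists (ball c (r / n.+1%:R)); split; first exact: ball_open.
  exact: ballxx.
move=> x; rewrite -ball_normE /= => /ltW cx; rewrite norm2B.
apply: le_trans (norm2_le_mx_norm _) _.
apply: (@le_trans _ _ (n%:R * (r / n.+1%:R))); first by rewrite ler_wpM2l.
rewrite mulrCA ler_piMr ?(ltW r0)// ler_pdivrMr// mul1r ler_nat.
exact: leqnSn.
Qed.

Lemma open_norm2_ball (D : set 'cV[R]_n) (c : 'cV[R]_n) : open D -> D c ->
  exists2 r, 0 < r & forall x, norm2 (x - c) < r -> D x.
Proof.
move=> oD Dc; have /nbhs_ballP[r /= r0 rD] := open_nbhs_nbhs (conj oD Dc).
exists r => // x xc; apply: rD; rewrite -ball_normE /=.
by apply: le_lt_trans (mx_norm_le_norm2 _) _; rewrite norm2B.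
Qed.

End lipschitz.

(** * Increments of a solution *)

Section rhs.
Context {R : realType}.
Variable n : nat.
Implicit Types (c d t s e r : R) (al : \bar R) (u x : dynvec R n).
Local Notation hlf := (2^-1 : R).
Local Notation Nhlf := (- 2^-1 : R).

(** Variation of t and of u strictly between c and d, the jumps at the two ends
being left out. The base point c0 only shifts the variation of the continuous
part. *)
Definition itv_weight u c0 c d : R := d - c +
  \sum_(j < n) (cont_var (Defs.comp u j) c0 d - cont_var (Defs.comp u j) c0 c +
                psum `]c, d[%classic (value_var (Defs.comp u j))).

Definition jump_weight u tau s1 s2 : R :=
  \sum_(j < n) (value_var_to (Defs.comp u j) tau s2 - value_var_to (Defs.comp u j) tau s1).

Variables (f : 'cV[R]_n -> 'cV[R]_n) (g : 'cV[R]_n -> 'M[R]_n).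

(** Increment of a solution from c+ to d- if its state were frozen at z. *)
Definition itv_drift u (z : 'cV[R]_n) c d : 'cV[R]_n :=
  (d - c) *: f z + g z *m (u d Nhlf - u c hlf).

Definition jump_drift u (z : 'cV[R]_n) tau s1 s2 : 'cV[R]_n :=
  g z *m (u tau s2 - u tau s1).

Lemma sum_dist (F G E : 'I_n -> R) : (forall j, `|F j - G j| <= E j) ->
  `|\sum_j F j - \sum_j G j| <= \sum_j E j.
Proof.
move=> H; rewrite -sumrB (le_trans (ler_norm_sum _ _ _))//.
exact: ler_sum.
Qed.

(** With e = 0 this computes the right-hand side for a constant state; with e > 0
it compares a moving state with a frozen one. *)
Lemma rhs_itv al u x i c0 c d z e : is_sBVloc_vec al +oo%E u ->
  (al < c0%:E)%E -> c0 <= c -> c < d -> 0 <= e ->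
  (forall j, has_dyn_limits al (fun t s => g (x t s) i j)) ->
  (forall t, c < t < d -> `|f (ordv x t) i 0 - f z i 0| <= e) ->
  (forall j t s, c < t < d -> J s -> `|g (x t s) i j - g z i j| <= e) ->
  `|rhs al +oo%E f g u x i (itv_test c d) - itv_drift u z c d i 0|
    <= e * itv_weight u c0 c d.
Proof.
move=> uBV al0 c0c cd e0 gl fz gz; have alc := lte_trans_fin al0 c0c.
have h1 := regular_itv (h := fun t => f (ordv x t) i 0) alc cd fz.
have h2 j := @deriv_itv _ al (Defs.comp u j) (uBV j) (fun t s => g (x t s) i j)
  c0 c d (g z i j) e al0 c0c cd e0 (gl j) (gz j).
have h3 := sum_dist h2; rewrite -mulr_sumr in h3.
rewrite /rhs /mul_distr /itv_drift /itv_weight !mxE.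
rewrite [X in `|_ - (_ + X)|](_ : _ =
    \sum_j g z i j * (Defs.comp u j d Nhlf - Defs.comp u j c hlf)); last first.
  by apply: eq_bigr => j _; rewrite !mxE.
move: h1 h3; rewrite !ler_norml mulrDr => /andP[a1 a2] /andP[b1 b2].
by apply/andP; split; lra.
Qed.

Lemma regular0 al (h : R -> R) (p : dynfun R) : (forall t, ord p t = 0) ->
  regular al +oo%E h p = 0.
Proof. by move=> p0; apply: Rintegral_eq0 => t _; rewrite p0 mulr0. Qed.

Lemma ord_jump_test tau s1 s2 t : Nhlf <= s1 -> ord (jump_test tau s1 s2) t = 0.
Proof.
move=> s1J; rewrite -[RHS](@ord_jump_test0 _ (fun _ _ => 1) tau s1 s2 t s1J).
by congr ord; apply/funext => r; apply/funext => s; rewrite mul1r.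
Qed.

Lemma rhs_jump al u x i tau s1 s2 z e : is_sBVloc_vec al +oo%E u ->
  (al < tau%:E)%E -> Nhlf <= s1 -> s1 <= s2 -> s2 <= hlf ->
  (forall j s, s1 < s < s2 -> `|g (x tau s) i j - g z i j| <= e) ->
  `|rhs al +oo%E f g u x i (jump_test tau s1 s2) - jump_drift u z tau s1 s2 i 0|
    <= e * jump_weight u tau s1 s2.
Proof.
move=> uBV alt s1J s12 s2J gz.
have h2 j := @deriv_jump _ al (Defs.comp u j) (uBV j) (fun t s => g (x t s) i j)
  tau s1 s2 (g z i j) e alt s1J s12 s2J (gz j).
have := sum_dist h2; rewrite -mulr_sumr /rhs regular0 ?add0r => [|t]; last first.
  exact: ord_jump_test.
rewrite /mul_distr /jump_drift /jump_weight !mxE.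
by congr (`|_ - _| <= _); apply: eq_bigr => j _; rewrite !mxE.
Qed.

Lemma deriv_itv_increment al (h : dynfun R) c d : is_sBVloc al +oo%E h ->
  (al < c%:E)%E -> c < d ->
  deriv_distr al +oo%E h (itv_test c d) = h d Nhlf - h c hlf.
Proof.
move=> hBV alc cd.
have ql : has_dyn_limits al (fun _ _ => 1 : R).
  by move=> t _; split; exists 1; apply: dyn_cvg_near; apply: filterE.
have h11 : `|1 - 1 : R| <= 0 by rewrite subrr normr0.
have := @deriv_itv _ al h hBV (fun _ _ => 1) c c d 1 0 alc (lexx c) cd (lexx 0) ql
  (fun _ _ _ _ => h11).
rewrite mul0r normr_le0 subr_eq0 mul1r => /eqP <-.
by congr (deriv_distr _ _ _); apply/funext => r; apply/funext => s; rewrite mul1r.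
Qed.

Lemma deriv_jump_increment al (h : dynfun R) tau s1 s2 : is_sBVloc al +oo%E h ->
  (al < tau%:E)%E -> Nhlf <= s1 -> s1 <= s2 -> s2 <= hlf ->
  deriv_distr al +oo%E h (jump_test tau s1 s2) = h tau s2 - h tau s1.
Proof.
move=> hBV alt h1 h2 h3.
have h11 : `|1 - 1 : R| <= 0 by rewrite subrr normr0.
have := @deriv_jump _ al h hBV (fun _ _ => 1) tau s1 s2 1 0 alt h1 h2 h3
  (fun _ _ => h11).
rewrite mul0r normr_le0 subr_eq0 mul1r => /eqP <-.
by congr (deriv_distr _ _ _); apply/funext => r; apply/funext => s; rewrite mul1r.
Qed.

Variable D : set 'cV[R]_n.
Variable L : R.
Hypothesis L0 : 0 < L.
Hypothesis fL : forall y z : 'cV[R]_n, D y -> D z ->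
  forall i, `|f y i 0 - f z i 0| <= L * norm2 (y - z).
Hypothesis gL : forall y z : 'cV[R]_n, D y -> D z ->
  forall i j, `|g y i j - g z i j| <= L * norm2 (y - z).

Lemma dyn_cvg_norm2 (F : set_system R) (FF : Filter F) x (l : 'cV[R]_n) e : 0 < e ->
  (forall i, dyn_cvg F (Defs.comp x i) (l i 0)) ->
  \forall t \near F, forall s, J s -> norm2 (x t s - l) <= e.
Proof.
move=> e0 H; have e'0 : 0 < e / n.+1%:R by rewrite divr_gt0.
have : \forall t \near F, forall i, forall s, J s -> `|Defs.comp x i t s - l i 0| <= e / n.+1%:R.
  by apply: filter_forall => i; exact: H.
apply: filterS => t Ht s Js.
apply: (@le_trans _ _ (n%:R * (e / n.+1%:R))).
  by apply: norm2_le => i; rewrite !mxE; exact: Ht.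
rewrite mulrCA ler_piMr ?(ltW e0)// ler_pdivrMr// mul1r ler_nat.
exact: leqnSn.
Qed.

Section trajectory.
Variables (al : \bar R) (x : dynvec R n).
Hypothesis xBV : is_sBVloc_vec al +oo%E x.
Hypothesis xD : forall t s, (al < t%:E)%E -> J s -> D (x t s).

Lemma traj_left t e : (al < t%:E)%E -> 0 < e ->
  \forall r \near t^'-, forall s, J s -> norm2 (x r s - x t Nhlf) <= e.
Proof.
move=> alt e0; apply: dyn_cvg_norm2 => // i.
by have [_] := sBV_sG (xBV i) alt.
Qed.

Lemma traj_right t e : (al < t%:E)%E -> 0 < e ->
  \forall r \near t^'+, forall s, J s -> norm2 (x r s - x t hlf) <= e.
Proof.
move=> alt e0; apply: dyn_cvg_norm2 => // i.
by have [] := sBV_sG (xBV i) alt.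
Qed.

Lemma ordv_traj t : (al < t%:E)%E -> ordv x t = x t Nhlf.
Proof.
by move=> alt; apply/matrixP => i j; rewrite mxE (ord1 j) (sBV_ord (xBV i) alt).
Qed.

(** g is known to be Lipschitz on D only, so the one-sided limits are those of a
trajectory that stays in D. *)
Lemma g_dyn_limits i j : has_dyn_limits al (fun t s => g (x t s) i j).
Proof.
move=> t alt; have [w wt alw] := ltal_window alt.
split; [exists (g (x t Nhlf) i j)|exists (g (x t hlf) i j)] => e e0.
- have eL0 : 0 < e / L by rewrite divr_gt0.
  have : \forall r \near t^'-, (al < r%:E)%E.
    apply/near_at_leftP; exists (t - w); first by rewrite subr_gt0.
    by move=> r h1 _; apply: lte_trans_fin alw _; lra.
  have := traj_left alt eL0; apply: filterS2 => r H alr s Js.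
  apply: le_trans (gL _ _ i j) _; [exact: xD|exact: xD alt JNhlf|].
  by rewrite mulrC -ler_pdivlMr// H.
- have eL0 : 0 < e / L by rewrite divr_gt0.
  have : \forall r \near t^'+, (al < r%:E)%E.
    apply/near_at_rightP; exists 1 => // r h1 _.
    by apply: lte_trans_fin alt _; lra.
  have := traj_right alt eL0; apply: filterS2 => r H alr s Js.
  apply: le_trans (gL _ _ i j) _; [exact: xD|exact: xD alt Jhlf|].
  by rewrite mulrC -ler_pdivlMr// H.
Qed.

Variable u : dynvec R n.
Hypothesis uBV : is_sBVloc_vec al +oo%E u.
Hypothesis xE : forall i, eq_distr al +oo%E (deriv_distr al +oo%E (Defs.comp x i))
  (rhs al +oo%E f g u x i).

(** The increment of x is the derivative of x tested on the indicator of (c, d),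
which the equation equates to the right-hand side. *)
Lemma increment_itv c0 c d z e : (al < c0%:E)%E -> c0 <= c -> c < d -> D z ->
  (forall t s, c < t < d -> J s -> norm2 (x t s - z) <= e) ->
  forall i, `|(x d Nhlf - x c hlf - itv_drift u z c d) i 0| <=
    L * e * itv_weight u c0 c d.
Proof.
move=> al0 c0c cd Dz xz i; have alc := lte_trans_fin al0 c0c.
have alt t : c < t < d -> (al < t%:E)%E.
  by move=> /andP[ct _]; exact: lte_trans_fin alc (ltW ct).
have e0 : 0 <= e.
  have m : c < (c + d) / 2 < d by lra.
  exact: le_trans (norm2_ge0 _) (xz _ _ m J0).
have -> : (x d Nhlf - x c hlf - itv_drift u z c d) i 0 =
  rhs al +oo%E f g u x i (itv_test c d) - itv_drift u z c d i 0.
  rewrite -xE; last exact: itv_test_test alc (ltW cd).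
  by rewrite (deriv_itv_increment (xBV i) alc cd) !mxE.
apply: rhs_itv => //.
- by rewrite mulr_ge0// ltW.
- exact: g_dyn_limits.
- move=> t ctd; rewrite ordv_traj ?alt//.
  apply: le_trans (fL _ _ i) _ => //; first by apply: xD (alt _ ctd) JNhlf.
  by rewrite ler_pM2l// xz//; exact: JNhlf.
- move=> j t s ctd Js; apply: le_trans (gL _ _ i j) _ => //.
    by apply: xD (alt _ ctd) Js.
  by rewrite ler_pM2l// xz.
Qed.

Lemma increment_jump tau s1 s2 z e : (al < tau%:E)%E ->
  Nhlf <= s1 -> s1 <= s2 -> s2 <= hlf -> D z ->
  (forall s, s1 < s < s2 -> norm2 (x tau s - z) <= e) ->
  forall i, `|(x tau s2 - x tau s1 - jump_drift u z tau s1 s2) i 0| <=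
    L * e * jump_weight u tau s1 s2.
Proof.
move=> alt h1 h2 h3 Dz xz i.
have -> : (x tau s2 - x tau s1 - jump_drift u z tau s1 s2) i 0 =
  rhs al +oo%E f g u x i (jump_test tau s1 s2) - jump_drift u z tau s1 s2 i 0.
  rewrite -xE; last exact: jump_test_test.
  by rewrite (deriv_jump_increment (xBV i) alt h1 h2 h3) !mxE.
apply: rhs_jump => // j s ss; apply: le_trans (gL _ _ i j) _ => //.
  by apply: xD => //; rewrite JE; have /andP[? ?] := ss; lra.
by rewrite ler_pM2l// xz.
Qed.

End trajectory.
End rhs.

(** * The clock of the control *)

Section control.
Context {R : realType}.
Variable n : nat.
Implicit Types (c d t s e r : R).
Local Notation hlf := (2^-1 : R).
Local Notation Nhlf := (- 2^-1 : R).
Variables (al : \bar R) (u : dynvec R n) (t0 : R).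
Hypothesis uBV : is_sBVloc_vec al +oo%E u.
Hypothesis al0 : (al < t0%:E)%E.

(** Variation of t and of u from the initial point of the dynamic value at t0 up to
the point s of the dynamic value at t; it is nondecreasing for the lexicographic
order on (t, s). *)
Definition clock t s : R := t - t0 +
  \sum_(j < n) (cont_var (Defs.comp u j) t0 t + psum `[t0, t[%classic (value_var (Defs.comp u j))
     + value_var_to (Defs.comp u j) t s).

Lemma clock_jump t s1 s2 : clock t s2 = clock t s1 + jump_weight u t s1 s2.
Proof.
rewrite /clock /jump_weight -[RHS]addrA; congr (_ + _).
by rewrite -big_split/=; apply: eq_bigr => j _; ring.
Qed.

Lemma psum_value_var_split j c t : t0 <= c -> c < t ->
  psum `[t0, t[%classic (value_var (Defs.comp u j)) = psum `[t0, c[%classic (value_var (Defs.comp u j)) +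
    value_var (Defs.comp u j) c + psum `]c, t[%classic (value_var (Defs.comp u j)).
Proof.
move=> c0 ct; set v := value_var _.
have sub (A : set R) : A `<=` `[t0, t]%classic -> abs_summable A v.
  exact: (value_var_summableW (uBV j) al0).
have v0 (A : set R) r : A r -> 0 <= v r by move=> _; exact: value_var_ge0.
have -> : `[t0, t[%classic = `[t0, c[%classic `|` ([set c] `|` `]c, t[%classic) :> set R.
  rewrite setU1itv ?bnd_simp//.
  apply/seteqP; split=> r /=; rewrite !in_itv/=.
    by move=> /andP[-> ->]; rewrite andbT; case: (ltP r c); [left|right].
  case=> /andP[h1 h2]; first by rewrite h1 (lt_trans h2).
  by rewrite h2 (le_trans c0).
have s2 : [set c] `|` `]c, t[%classic `<=` `[t0, t]%classic.
  move=> r [->|] /=; rewrite !in_itv/= ?c0 ?(ltW ct)// => /andP[h1 h2].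
  by rewrite (ltW h2) (le_trans c0)// ltW.
have s1 : `[t0, c[%classic `|` ([set c] `|` `]c, t[%classic) `<=` `[t0, t]%classic.
  move=> r [|/s2//] /=; rewrite !in_itv/= => /andP[-> h2].
  by rewrite ltW// (lt_trans h2).
rewrite psumU; [rewrite psumU| |exact: v0|exact: sub].
- by rewrite {2}/psum esum_set1 ?lee_fin ?value_var_ge0//= addrA.
- by apply/seteqP; split=> // r [-> /=]; rewrite in_itv/= ltxx.
- exact: v0.
- exact: sub.
- apply/seteqP; split=> // r [] /=; rewrite in_itv/= => /andP[_ tx] [tE|].
    by move: tx; rewrite tE ltxx.
  by rewrite /= in_itv/= => /andP[/(lt_trans tx)]; rewrite ltxx.
Qed.

Lemma clock_itv c t s : t0 <= c -> c < t ->
  clock t s = clock c hlf + (itv_weight u t0 c t + jump_weight u t Nhlf s).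
Proof.
move=> c0 ct; rewrite /clock /itv_weight /jump_weight.
have E j : cont_var (Defs.comp u j) t0 t + psum `[t0, t[%classic (value_var (Defs.comp u j))
     + value_var_to (Defs.comp u j) t s =
  (cont_var (Defs.comp u j) t0 c + psum `[t0, c[%classic (value_var (Defs.comp u j))
     + value_var_to (Defs.comp u j) c hlf) +
  (cont_var (Defs.comp u j) t0 t - cont_var (Defs.comp u j) t0 c +
     psum `]c, t[%classic (value_var (Defs.comp u j))) +
  (value_var_to (Defs.comp u j) t s - value_var_to (Defs.comp u j) t Nhlf).
  rewrite (psum_value_var_split j c0 ct) value_var_to_Nhlf value_var_to_hlf.
  move: (cont_var _ t0 t) (cont_var _ t0 c) (psum `[t0, c[%classic _) (psum `]c, t[%classic _).
  by move: (value_var _ c) (value_var_to _ t s) => *; ring.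
have regroup (X Y Z : R) :
  t - t0 + (X + Y + Z) = c - t0 + X + (t - c + Y + Z) by ring.
by rewrite (eq_bigr _ (fun j _ => E j)) 2!big_split/=; exact: regroup.
Qed.

Lemma jump_weight_ge0 t s1 s2 : (al < t%:E)%E -> Nhlf <= s1 -> s1 <= s2 -> s2 <= hlf ->
  0 <= jump_weight u t s1 s2.
Proof.
move=> alt h1 h2 h3; apply: sumr_ge0 => j _; rewrite subr_ge0.
exact: (value_var_to_nd (uBV j) alt).
Qed.

Lemma itv_weight_ge0 c t : t0 <= c -> c <= t -> 0 <= itv_weight u t0 c t.
Proof.
move=> c0 ct; rewrite addr_ge0 ?subr_ge0// sumr_ge0// => j _.
rewrite addr_ge0//.
  exact: le_trans (normr_ge0 _) (cont_var_incr (uBV j) al0 c0 ct).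
by apply: psum_ge0 => r _; exact: value_var_ge0.
Qed.

(** To the right of c the continuous part of the clock has no time to run, and the
jumps after c are summable, so they are small close to c even when they
accumulate at c. *)
Lemma clock_small c e : t0 <= c -> 0 < e ->
  \forall t \near c^'+, itv_weight u t0 c t + jump_weight u t Nhlf hlf <= e.
Proof.
move=> c0 e0; pose e' := e / (n.+1)%:R / 2.
have e'0 : 0 < e' by rewrite !divr_gt0.
have alc := lte_trans_fin al0 c0.
have H : \forall t \near c^'+, forall j,
    cont_var (Defs.comp u j) t0 t - cont_var (Defs.comp u j) t0 c +
    psum `]c, t[%classic (value_var (Defs.comp u j)) + value_var (Defs.comp u j) t <= e' + e'.
  apply: filter_forall => j.
  have c1 : c <= c + 1 by rewrite lerDl.
  have [e1 e10 H1] := cont_var_cont (uBV j) al0 (le_lt_trans c0 (ltr_pwDr ltr01 (lexx c))) c0 c1 e'0.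
  have sv := value_var_summable (uBV j) (c + 1) al0.
  have [e2 e20 H2] := psum_local c e'0 (fun s _ => value_var_ge0 (Defs.comp u j) s) sv.
  apply/near_at_rightP; exists (Num.min 1 (Num.min e1 e2)).
    by rewrite !lt_min ltr01 e10.
  move=> t ct; rewrite -ltrBlDl !lt_min => /and3P[t1 te1 te2].
  rewrite -addrA lerD//.
    have t1' : t <= c + 1 by lra.
    have := H1 t (le_trans c0 (ltW ct)) t1'; rewrite gtr0_norm ?subr_gt0//.
    by move=> /(_ te1); apply: le_trans; exact: ler_norm.
  have sub : `]c, t]%classic `<=` `[t0, c + 1]%classic.
    by move=> r /=; rewrite !in_itv/=; lra.
  have <- : psum `]c, t]%classic (value_var (Defs.comp u j)) =
      psum `]c, t[%classic (value_var (Defs.comp u j)) + value_var (Defs.comp u j) t.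
    have tE : `]c, t]%classic = `]c, t[%classic `|` [set t] :> set R.
      by rewrite setUitv1 ?bnd_simp.
    rewrite tE psumU.
    - by congr (_ + _); rewrite /psum esum_set1 ?lee_fin ?value_var_ge0.
    - by apply/seteqP; split=> // r [/= + rE]; rewrite rE in_itv/= ltxx andbF.
    - by move=> r _; exact: value_var_ge0.
    - by rewrite -tE; exact: abs_summable_sub sub sv.
  apply: H2 => // r; rewrite /= in_itv/= => /andP[cr rt].
  by rewrite gtr0_norm ?subr_gt0// cr/=; lra.
have H' : \forall t \near c^'+, t - c <= e'.
  apply/near_at_rightP; exists e' => // t _ h; lra.
near=> t.
have ct : c < t by near: t; exact: nbhs_right_gt.
have h1 : t - c <= e' by near: t.
have h2 : forall j, cont_var (Defs.comp u j) t0 t - cont_var (Defs.comp u j) t0 c +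
    psum `]c, t[%classic (value_var (Defs.comp u j)) + value_var (Defs.comp u j) t <= e' + e' by near: t.
rewrite /itv_weight /jump_weight -[leLHS]addrA -big_split/=.
apply: (@le_trans _ _ ((e' + e') + \sum_(j < n) (e' + e'))).
  rewrite lerD//; first by lra.
  by apply: ler_sum => j _; rewrite value_var_to_hlf value_var_to_Nhlf subr0; exact: h2.
rewrite sumr_const card_ord -mulrS.
have -> : e' + e' = e / n.+1%:R by rewrite /e' -splitr.
by rewrite -[leLHS]mulr_natr divfK.
Unshelve. all: by end_near. Qed.

(** The total variation of a continuous function of bounded variation is
continuous. *)
Lemma value_var_to_cont j t s e : (al < t%:E)%E -> J s -> 0 < e -> exists2 eta, 0 < eta &
  forall r, J r -> `|r - s| < eta -> `|value_var_to (Defs.comp u j) t r - value_var_to (Defs.comp u j) t s| <= e.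
Proof.
move=> alt Js e0; set h := Defs.comp u j t.
have [ac _ _] := sBV_sG (uBV j) alt.
have ch : {within `[Nhlf, hlf], continuous h}.
  apply/subspace_continuousP => x xJ; apply/cvgrPdist_le => r r0.
  have [eta eta0 He] := isACJ_unif ac r0.
  apply/nbhs_ballP; exists eta => //= y /=; rewrite /ball/= => xy yJ.
  by apply: He => //; rewrite JE; move: yJ xJ; rewrite /= !in_itv.
have /subspace_continuousP/(_ s) := total_variation_continuous NhlfLhlf ch
  (sBV_bounded_variation (uBV j) alt).
move=> /(_ _)/cvgrPdist_le/(_ e e0) H.
have /H/nbhs_ballP[eta /= eta0 He] : [set` `[Nhlf, hlf]] s.
  by move: Js; rewrite JE /= in_itv.
exists eta => // r Jr rs; rewrite distrC; apply: He.
  by rewrite /ball/= distrC.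
by move: Jr; rewrite JE /= in_itv.
Qed.

Lemma jump_weight_small t s e : (al < t%:E)%E -> J s -> 0 < e ->
  exists2 eta, 0 < eta & forall r, J r -> s < r -> r < s + eta ->
    jump_weight u t s r <= e.
Proof.
move=> alt Js e0; pose e' := e / (n.+1)%:R; have e'0 : 0 < e' by rewrite divr_gt0.
have : \forall r \near s^'+, forall j, J r ->
    value_var_to (Defs.comp u j) t r - value_var_to (Defs.comp u j) t s <= e'.
  apply: filter_forall => j; have [eta eta0 H] := value_var_to_cont j alt Js e'0.
  apply/near_at_rightP; exists eta => // r sr rs Jr.
  apply: le_trans (ler_norm _) _; apply: H => //.
  by rewrite gtr0_norm ?subr_gt0//; lra.
move=> /near_at_rightP[eta eta0 H]; exists eta => // r Jr sr rs.
apply: (@le_trans _ _ (\sum_(j < n) e')); first by apply: ler_sum => j _; exact: H.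
rewrite sumr_const card_ord -mulr_natr /e' mulrAC -mulrA ler_piMr ?(ltW e0)//.
by rewrite ler_pdivrMr// mul1r ler_nat.
Qed.

Variables (f : 'cV[R]_n -> 'cV[R]_n) (g : 'cV[R]_n -> 'M[R]_n).

(** Makes the second order term of the growth of the norm negligible. *)
Lemma itv_drift_le z c t i : t0 <= c -> c < t ->
  `|itv_drift f g u z c t i 0| <= (`|f z| + `|g z|) * itv_weight u t0 c t.
Proof.
move=> c0 ct; rewrite /itv_drift /itv_weight !mxE.
have du j : `|(u t Nhlf - u c hlf) j 0| <= cont_var (Defs.comp u j) t0 t -
    cont_var (Defs.comp u j) t0 c + psum `]c, t[%classic (value_var (Defs.comp u j)).
  have h1 := cont_part_incr (uBV j) al0 c0 ct.
  have h2 := cont_var_incr (uBV j) al0 c0 (ltW ct).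
  have sub : `]c, t[%classic `<=` `[t0, t]%classic.
    move=> r /=; rewrite !in_itv/= => /andP[cr rt].
    by rewrite (ltW rt) (le_trans c0)// ltW.
  have -> : (u t Nhlf - u c hlf) j 0 =
      (cont_part t0 (ord (Defs.comp u j)) t - cont_part t0 (ord (Defs.comp u j)) c)
      + ssum `]c, t[%classic (jump (Defs.comp u j)).
    by rewrite h1 subrK !mxE.
  by rewrite (le_trans (ler_normD _ _))// lerD//; exact: (ssum_jump_le (uBV j) al0 sub).
have f0 := normr_ge0 (f z); have g0 := normr_ge0 (g z).
have h1 : `|(t - c) * f z i 0| <= `|f z| * (t - c).
  by rewrite normrM gtr0_norm ?subr_gt0// mulrC ler_wpM2r ?subr_ge0 ?(ltW ct)// mx_norm_entry.
set S := \sum_(j < n) (cont_var _ _ _ - _ + _).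
have h2 : `|\sum_j g z i j * (u t Nhlf - u c hlf) j 0| <= `|g z| * S.
  rewrite (le_trans (ler_norm_sum _ _ _))// mulr_sumr; apply: ler_sum => j _.
  by rewrite normrM ler_pM ?mx_norm_entry.
have S0 : 0 <= S.
  by apply: sumr_ge0 => j _; apply: le_trans (du j); exact: normr_ge0.
rewrite (le_trans (ler_normD _ _))// (le_trans (lerD h1 h2))//.
have ct0 : 0 <= t - c by rewrite subr_ge0 ltW.
by have := mulr_ge0 f0 S0; have := mulr_ge0 g0 ct0; rewrite !mulrDr !mulrDl; lra.
Qed.

Lemma jump_drift_le z t s1 s2 i : (al < t%:E)%E ->
  Nhlf <= s1 -> s1 <= s2 -> s2 <= hlf ->
  `|jump_drift g u z t s1 s2 i 0| <= (`|f z| + `|g z|) * jump_weight u t s1 s2.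
Proof.
move=> alt h1 h2 h3; have w0 := jump_weight_ge0 alt h1 h2 h3.
apply: (@le_trans _ _ (`|g z| * jump_weight u t s1 s2)); last first.
  by rewrite mulrDl lerDr mulr_ge0.
rewrite /jump_drift /jump_weight !mxE (le_trans (ler_norm_sum _ _ _))// mulr_sumr.
apply: ler_sum => j _; rewrite normrM ler_pM ?mx_norm_entry//.
by rewrite !mxE; exact: (value_var_to_incr (uBV j)).
Qed.

End control.

(** * One step along the barrier *)

Section barrier.
Context {R : realType}.
Variable n : nat.
Implicit Types (y z : 'cV[R]_n) (e w : R).

(** Here y0 is the position relative to the centre, at height dl above the sphere
of radius r, y1 the next position, and v the increment frozen at the projection
of y0 on the sphere, which points inwards. The error is proportional to dl, as
the state stays within 2 dl of the projection, and the smallness condition on w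
makes the square of the displacement at most 2 r dl w. *)
Lemma sphere_step (y0 y1 v : 'cV[R]_n) (r dl L K w : R) : 0 < r -> 0 < dl ->
  0 < L -> 0 <= K -> 0 <= w -> norm2 y0 = r + dl ->
  (forall i, `|(y1 - y0 - v) i 0| <= L * (2 * dl) * w) ->
  dot y0 v <= 0 -> (forall i, `|v i 0| <= K * w) ->
  (n%:R * (K + L * (2 * dl))) ^+ 2 * w <= 2 * r * dl ->
  norm2 y1 <= r + dl * (1 + (n%:R * L * 2 + 1) * w).
Proof.
move=> r0 dl0 L0 K0 w0 y0E ve y0v vK small.
have n0 : 0 <= n%:R :> R by [].
have P0 : 0 <= n%:R * (L * (2 * dl) * w) by rewrite !mulr_ge0 ?(ltW L0) ?(ltW dl0).
have Q0 : 0 <= dl * w by rewrite mulr_ge0// ltW.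
have := @norm2_growth R n y0 y1 (n%:R * (L * (2 * dl) * w)) (dl * w).
rewrite y0E => /(_ (addr_gt0 r0 dl0)) H.
suff : norm2 y1 <= r + dl + (n%:R * (L * (2 * dl) * w) + dl * w).
  by move=> /le_trans; apply; rewrite le_eqVlt; apply/orP; left; apply/eqP; ring.
apply: H => //.
  rewrite -[y1 - y0](subrK v) dotDr.
  have := dot_le y0 (y1 - y0 - v); rewrite y0E => h1.
  have h2 : (r + dl) * norm2 (y1 - y0 - v) <= (r + dl) * (n%:R * (L * (2 * dl) * w)).
    by rewrite ler_pM2l ?addr_gt0// norm2_le.
  by lra.
have h : norm2 (y1 - y0) <= n%:R * (K + L * (2 * dl)) * w.
  rewrite -mulrA; apply: norm2_le => i.
  rewrite -[y1 - y0](subrK v) mxE mulrDl [leRHS]addrC.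
  by rewrite (le_trans (ler_normD _ _))// lerD.
apply: (@le_trans _ _ ((n%:R * (K + L * (2 * dl)) * w) ^+ 2)).
  by rewrite ler_pXn2r ?nnegrE ?norm2_ge0// (le_trans (norm2_ge0 _) h).
have -> : (n%:R * (K + L * (2 * dl)) * w) ^+ 2 = (n%:R * (K + L * (2 * dl))) ^+ 2 * w * w by ring.
apply: (@le_trans _ _ (2 * r * dl * w)); first by rewrite ler_wpM2r.
have := mulr_ge0 (mulr_ge0 (ltW dl0) w0) (ltW dl0); nra.
Qed.

(** Below the barrier, continuity suffices. On the barrier, with the excess E over
r, the growth E (1 + C w) of sphere_step is at most E exp(C w). The factor 2 E
leaves a margin E for the motion of the state during the step. *)
Lemma barrier_step (y0 : 'cV[R]_n) (r L eps T : R) (K : 'cV[R]_n -> R) :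
  0 < r -> 0 < L -> 0 < eps -> (forall z, 0 <= K z) ->
  norm2 y0 <= r + eps * expR ((n%:R * L * 2 + 1) * T) ->
  exists2 eta, 0 < eta & forall w y1, 0 <= w -> w <= eta ->
    norm2 (y1 - y0) <= eta ->
    (forall z e, norm2 z = r -> norm2 (y0 - z) + eta <= e -> exists v,
      [/\ forall i, `|(y1 - y0 - v) i 0| <= L * e * w, dot z v <= 0 &
          forall i, `|v i 0| <= K z * w]) ->
    norm2 y1 <= r + eps * expR ((n%:R * L * 2 + 1) * (T + w)).
Proof.
set C := n%:R * L * 2 + 1 => r0 L0 eps0 K0.
have C0 : 0 < C by rewrite ltr_wpDl// !mulr_ge0// ltW.
set E := eps * expR (C * T); have E0 : 0 < E by rewrite mulr_gt0 ?expR_gt0.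
have Ew w : eps * expR (C * (T + w)) = E * expR (C * w).
  by rewrite mulrDr expRD mulrA.
rewrite le_eqVlt => /predU1P[y0E|gap]; last first.
  exists (r + E - norm2 y0); first by rewrite subr_gt0.
  move=> w y1 w0 _ y1y0 _; rewrite Ew.
  have h1 : norm2 y1 <= norm2 y0 + norm2 (y1 - y0).
    by rewrite -{1}[y1](subrK y0) addrC ler_norm2D.
  have h2 : E <= E * expR (C * w).
    by rewrite ler_peMr ?(ltW E0)// -expR0 ler_expR mulr_ge0// ltW.
  by lra.
(* z is the radial projection on the sphere, at distance E *)
pose k := r / (r + E); pose z := k *: y0.
have rE0 : 0 < r + E by rewrite addr_gt0.
have k0 : 0 < k by rewrite divr_gt0.
have zr : norm2 z = r by rewrite norm2Z gtr0_norm// y0E divfK// gt_eqF.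
have y0z : norm2 (y0 - z) = E.
  have -> : y0 - z = (1 - k) *: y0 by rewrite scalerBl scale1r.
  have k1 : 1 - k = E / (r + E) by rewrite /k; field; rewrite gt_eqF.
  by rewrite norm2Z k1 gtr0_norm ?divr_gt0// y0E divfK// gt_eqF.
(* the bound on w is the smallness condition of sphere_step *)
pose A := (n%:R * (K z + L * (2 * E))) ^+ 2.
have A0 : 0 <= A by exact: sqr_ge0.
have A1 : 0 < A + 1 by rewrite ltr_wpDl.
pose q := 2 * r * E / (A + 1).
have q0 : 0 < q.
  by apply: divr_gt0 A1; apply: mulr_gt0 E0; rewrite mulr_gt0.
exists (Num.min E q); first by rewrite lt_min E0.
move=> w y1 w0; rewrite le_min => /andP[_ wA] _.
move=> H; have [|v [vE zv vK]] := H z (2 * E) zr.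
  by rewrite y0z mulr_natl mulr2n lerD2l ge_min lexx.
have y0v : dot y0 v <= 0.
  by move: zv; rewrite dotC dotZr pmulr_rle0// dotC.
rewrite Ew; apply: le_trans (sphere_step r0 E0 L0 (K0 z) w0 y0E vE y0v vK _) _.
  move: wA; rewrite ler_pdivlMr// => wA.
  by apply: le_trans wA; rewrite mulrC ler_wpM2l// lerDl.
by rewrite lerD2l ler_pM2l// expR_ge1Dx// mulr_ge0// ltW.
Qed.

End barrier.

(** * The trap *)

Section trap.
Context {R : realType}.
Variable n : nat.
Implicit Types (c d t s e : R) (z : 'cV[R]_n).
Local Notation hlf := (2^-1 : R).
Local Notation Nhlf := (- 2^-1 : R).
Variables (f : 'cV[R]_n -> 'cV[R]_n) (g : 'cV[R]_n -> 'M[R]_n).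
Variables (D : set 'cV[R]_n) (L : R).
Hypothesis L0 : 0 < L.
Hypothesis fL : forall y z : 'cV[R]_n, D y -> D z ->
  forall i, `|f y i 0 - f z i 0| <= L * norm2 (y - z).
Hypothesis gL : forall y z : 'cV[R]_n, D y -> D z ->
  forall i j, `|g y i j - g z i j| <= L * norm2 (y - z).
Variables (al : \bar R) (x u : dynvec R n) (t0 : R).
Hypothesis xBV : is_sBVloc_vec al +oo%E x.
Hypothesis xD : forall t s, (al < t%:E)%E -> J s -> D (x t s).
Hypothesis uBV : is_sBVloc_vec al +oo%E u.
Hypothesis xE : forall i, eq_distr al +oo%E (deriv_distr al +oo%E (Defs.comp x i))
  (rhs al +oo%E f g u x i).
Hypothesis al0 : (al < t0%:E)%E.

Lemma traj_jump_cont t s e : (al < t%:E)%E -> J s -> 0 < e ->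
  exists2 eta, 0 < eta & forall r, J r -> `|r - s| < eta ->
    norm2 (x t r - x t s) <= e.
Proof.
move=> alt Js e0; have e'0 : 0 < e / n.+1%:R by rewrite divr_gt0.
have : \forall r \near s, forall i, J r -> `|x t r i 0 - x t s i 0| <= e / n.+1%:R.
  apply: (@filter_forall _ _ (fun i r => J r -> `|x t r i 0 - x t s i 0| <= e / n.+1%:R)
    (nbhs s)) => i; have [ac _ _] := sBV_sG (xBV i) alt.
  have [eta eta0 H] := isACJ_unif ac e'0.
  apply/nbhs_ballP; exists eta => //= r; rewrite /ball/= distrC => rs Jr.
  exact: H.
move=> /nbhs_ballP[eta /= eta0 H]; exists eta => // r Jr rs.
apply: (@le_trans _ _ (n%:R * (e / n.+1%:R))).
  apply: norm2_le => i; rewrite !mxE; apply: H => //.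
  by rewrite /ball/= distrC.
rewrite mulrCA ler_piMr ?(ltW e0)// ler_pdivrMr// mul1r ler_nat.
exact: leqnSn.
Qed.

(** Real induction on s inside one dynamic value, continuity in s taking care of
limits from the left. *)
Lemma jump_induction (xs : 'cV[R]_n) t (B : R -> R) : (al < t%:E)%E ->
  (forall s s', Nhlf <= s -> s <= s' -> s' <= hlf -> B s <= B s') ->
  norm2 (x t Nhlf - xs) <= B Nhlf ->
  (forall b, Nhlf <= b -> b < hlf -> norm2 (x t b - xs) <= B b ->
    exists2 eta, 0 < eta & forall s, b < s -> s < b + eta -> s <= hlf ->
      norm2 (x t s - xs) <= B s) ->
  forall s, J s -> norm2 (x t s - xs) <= B s.
Proof.
move=> alt Bnd init step s; rewrite JE => /andP[s1 s2]; move: s s1 s2.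
apply: (@real_induction _ (fun s => norm2 (x t s - xs) <= B s)) => [_|b|b].
- exact: init.
- move=> bN bh H; have Jb : J b by rewrite JE (ltW bN).
  apply/ler_addgt0Pr => e e0; have [eta eta0 He] := traj_jump_cont alt Jb e0.
  pose q := Num.max Nhlf (b - eta / 2).
  have qb : q < b by rewrite gt_max bN/= ltrBlDr ltrDl divr_gt0.
  have Nq : Nhlf <= q by rewrite le_max lexx.
  have bq : b - eta / 2 <= q by rewrite le_max lexx orbT.
  have Jq : J q by rewrite JE Nq/= (le_trans (ltW qb)).
  apply: le_trans (norm2_sub_le _ (x t q) _) _; rewrite [leLHS]addrC; apply: lerD.
    exact: le_trans (H _ Nq qb) (Bnd _ _ Nq (ltW qb) bh).
  rewrite norm2B; apply: He => //; rewrite distrC gtr0_norm ?subr_gt0//.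
  by rewrite ltrBlDr -ltrBlDl (lt_le_trans _ bq)// ltrD2l ltrN2 ltr_pdivrMr// ltr_pMr// ltrDl.
- by move=> bN bh H; exact: step (H b bN (lexx b)).
Qed.

Variables (xs : 'cV[R]_n) (r : R).
Hypothesis r0 : 0 < r.
Hypothesis sphereD : forall z, norm2 z = r -> D (xs + z).
Hypothesis itv_inward : forall z c t, norm2 z = r -> t0 <= c -> c < t ->
  dot z (itv_drift f g u (xs + z) c t) <= 0.
Hypothesis jump_inward : forall z t s1 s2, norm2 z = r -> t0 < t ->
  Nhlf <= s1 -> s1 <= s2 -> s2 <= hlf ->
  dot z (jump_drift g u (xs + z) t s1 s2) <= 0.

Section eps.
Variable eps : R.
Hypothesis eps0 : 0 < eps.

Definition barrier t s := r + eps * expR ((n%:R * L * 2 + 1) * clock u t0 t s).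

Let C0 : 0 < n%:R * L * 2 + 1 :> R.
Proof. by rewrite ltr_wpDl// !mulr_ge0// ltW. Qed.

Lemma barrier_nd t s t' s' : clock u t0 t s <= clock u t0 t' s' ->
  barrier t s <= barrier t' s'.
Proof. by rewrite /barrier lerD2l (ler_pM2l eps0) ler_expR (ler_pM2l C0). Qed.

Let K z := `|f (xs + z)| + `|g (xs + z)|.
Let K0 z : 0 <= K z. Proof. by rewrite addr_ge0. Qed.

Lemma barrier_jump t : t0 < t -> norm2 (x t Nhlf - xs) <= barrier t Nhlf ->
  forall s, J s -> norm2 (x t s - xs) <= barrier t s.
Proof.
move=> tt0 init; have alt := lte_trans_fin al0 (ltW tt0).
apply: (jump_induction alt (B := barrier t) _ init) => [s s' s1 ss' s2|b bN bh Hb].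
  apply: barrier_nd; rewrite (clock_jump u t0 t s s') lerDl.
  exact: (jump_weight_ge0 uBV alt).
have Jb : J b by rewrite JE bN ltW.
have [eta eta0 step] := barrier_step r0 L0 eps0 K0 Hb.
have [e1 e10 H1] := jump_weight_small uBV alt Jb eta0.
have [e2 e20 H2] := traj_jump_cont alt Jb eta0.
exists (Num.min e1 e2); first by rewrite lt_min e10.
move=> q bq; rewrite -ltrBlDl lt_min => /andP[q1 q2] qh.
have Jq : J q by rewrite JE qh (le_trans bN) ?ltW.
have w0 := jump_weight_ge0 uBV alt bN (ltW bq) qh.
rewrite /barrier (clock_jump u t0 t b q).
have dE : x t q - xs - (x t b - xs) = x t q - x t b by rewrite opprB addrA subrK.
apply: step.
- exact: w0.
- by apply: H1 => //; rewrite -ltrBlDl.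
- by rewrite dE; apply: H2 => //; rewrite gtr0_norm ?subr_gt0.
move=> z e zr ze; exists (jump_drift g u (xs + z) t b q); split.
- rewrite dE; apply: (increment_jump L0 gL xBV xD uBV xE alt bN (ltW bq) qh (sphereD zr)).
  move=> s /andP[bs sq]; rewrite (le_trans _ ze)// opprD addrA.
  rewrite [leRHS]addrC.
  have := norm2_sub_le (x t s - xs) (x t b - xs) z.
  move/le_trans; apply; rewrite lerD2r.
  rewrite opprB addrA subrK; apply: H2.
    by rewrite JE (ltW (le_lt_trans bN bs)) (ltW (lt_le_trans sq qh)).
  by rewrite gtr0_norm ?subr_gt0// (lt_trans _ q2)// ltrD2r.
- exact: jump_inward zr tt0 bN (ltW bq) qh.
- by move=> i; exact: (jump_drift_le uBV f g (xs + z) i alt bN (ltW bq) qh).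
Qed.

(** The stretch from t+ to (q, s) consists of the open interval (t, q) followed by
the beginning of the dynamic value at q; its frozen increments and weights add
up. *)
Lemma barrier_right t : t0 <= t -> norm2 (x t hlf - xs) <= barrier t hlf ->
  \forall t' \near t^'+, forall s, J s -> norm2 (x t' s - xs) <= barrier t' s.
Proof.
move=> tt0 init; have alt := lte_trans_fin al0 tt0.
have [eta eta0 step] := barrier_step r0 L0 eps0 K0 init.
have /near_at_rightP[e1 e10 H1] := clock_small uBV al0 tt0 eta0.
have /near_at_rightP[e2 e20 H2] := traj_right xBV alt eta0.
apply/near_at_rightP; exists (Num.min e1 e2); first by rewrite lt_min e10.
move=> q tq; rewrite -ltrBlDl lt_min => /andP[q1 q2] s Js.
have alq := lte_trans_fin alt (ltW tq).
move: (Js); rewrite JE => /andP[s1 s2].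
have w1 := itv_weight_ge0 uBV al0 tt0 (ltW tq).
have w2 := jump_weight_ge0 uBV alq (lexx _) s1 s2.
have w3 := jump_weight_ge0 uBV alq s1 s2 (lexx _).
rewrite /barrier (clock_itv uBV al0 s tt0 tq).
have dE : x q s - xs - (x t hlf - xs) = x q s - x t hlf by rewrite opprB addrA subrK.
have near' t' s' : t < t' -> t' <= q -> J s' -> norm2 (x t' s' - x t hlf) <= eta.
  by move=> h1 h2 Js'; apply: H2 => //; rewrite -ltrBlDl (le_lt_trans _ q2)// lerD2r.
apply: step.
- by rewrite addr_ge0.
- have q1' : q < t + e1 by rewrite -ltrBlDl.
  apply: le_trans (H1 _ tq q1'); rewrite lerD2l.
  rewrite -(lerD2l (clock u t0 q Nhlf)) -!clock_jump (clock_jump u t0 q s hlf).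
  by rewrite lerDl.
- by rewrite dE near'.
move=> z e zr ze.
have close t' s' : t < t' -> t' <= q -> J s' -> norm2 (x t' s' - (xs + z)) <= e.
  move=> h1 h2 Js'; rewrite (le_trans _ ze)// opprD addrA [leRHS]addrC.
  have := norm2_sub_le (x t' s' - xs) (x t hlf - xs) z.
  move/le_trans; apply; rewrite lerD2r.
  by rewrite opprB addrA subrK near'.
exists (itv_drift f g u (xs + z) t q + jump_drift g u (xs + z) q Nhlf s); split.
- move=> i; rewrite dE.
  have h1 := increment_itv L0 fL gL xBV xD uBV xE al0 tt0 tq (sphereD zr) (e := e) _ i.
  have h2 := increment_jump L0 gL xBV xD uBV xE alq (lexx _) s1 s2 (sphereD zr) (e := e) _ i.
  have -> : x q s - x t hlf - (itv_drift f g u (xs + z) t q + jump_drift g u (xs + z) q Nhlf s)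
    = (x q Nhlf - x t hlf - itv_drift f g u (xs + z) t q) +
      (x q s - x q Nhlf - jump_drift g u (xs + z) q Nhlf s).
    by apply/matrixP => k l; rewrite !mxE; ring.
  rewrite mxE mulrDr (le_trans (ler_normD _ _))// lerD//.
    by apply: h1 => t' s' /andP[h3 h4]; apply: close => //; exact: ltW.
  by apply: h2 => s' /andP[h3 h4]; apply: close => //; rewrite JE (ltW h3)/= (ltW (lt_le_trans h4 s2)).
- by rewrite dotDr -[leRHS]addr0 lerD// ?itv_inward// jump_inward// (le_lt_trans tt0).
- move=> i; rewrite mxE mulrDr (le_trans (ler_normD _ _))// lerD//.
    exact: (itv_drift_le uBV al0).
  exact: (jump_drift_le uBV).
Qed.

(** Times t are compared through all their dynamic values at once: a limit from
the left reaches the initial point of the dynamic value at b, barrier_jump runs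
through it, and barrier_right leaves it. *)
Lemma barrier_all : (forall s, J s -> norm2 (x t0 s - xs) <= r) ->
  forall t, t0 <= t -> forall s, J s -> norm2 (x t s - xs) <= barrier t s.
Proof.
move=> init t tt0; move: {2}t (lexx t) => d; move: t tt0.
apply: (@real_induction _ (fun t => forall s, J s -> norm2 (x t s - xs) <= barrier t s))
  => [_ s Js|b tb bd H|b tb bd H].
- by rewrite (le_trans (init s Js))// lerDl mulr_ge0 ?ltW ?expR_gt0.
- have alb := lte_trans_fin al0 (ltW tb).
  apply: barrier_jump => //; apply/ler_addgt0Pr => e e0.
  have /near_at_leftP[eta eta0 He] := traj_left xBV alb e0.
  pose q := Num.max t0 (b - eta / 2).
  have qb : q < b by rewrite gt_max tb/= ltrBlDr ltrDl divr_gt0.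
  have tq : t0 <= q by rewrite le_max lexx.
  have bq : b - eta / 2 <= q by rewrite le_max lexx orbT.
  apply: le_trans (norm2_sub_le _ (x q hlf) _) _; rewrite [leLHS]addrC; apply: lerD.
    apply: le_trans (H _ tq qb _ Jhlf) (barrier_nd _).
    rewrite (clock_itv uBV al0 Nhlf tq qb) lerDl addr_ge0//.
      exact: (itv_weight_ge0 uBV al0 tq (ltW qb)).
    by apply: (jump_weight_ge0 uBV alb) => //; exact: ltW (NhlfLhlf).
  rewrite norm2B; apply: He => //; last exact: Jhlf.
  by rewrite (lt_le_trans _ bq)// ltrD2l ltrN2 ltr_pdivrMr// ltr_pMr// ltrDl.
- have /near_at_rightP[eta eta0 He] := barrier_right tb (H b tb (lexx b) _ Jhlf).
  by exists eta => // t bt te _; exact: He.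
Qed.

End eps.

Lemma sphere_trap : (forall s, J s -> norm2 (x t0 s - xs) <= r) ->
  forall t, t0 <= t -> forall s, J s -> norm2 (x t s - xs) <= r.
Proof.
move=> init t tt0 s Js; apply/ler_addgt0Pr => e e0.
have E0 := expR_gt0 ((n%:R * L * 2 + 1) * clock u t0 t s).
have := barrier_all (divr_gt0 e0 E0) init tt0 Js.
by rewrite /barrier divfK// gt_eqF.
Qed.

End trap.

(** * Frozen increments, equilibrium and the initial jump *)

Section constant_state.
Context {R : realType}.
Variable n : nat.
Implicit Types (c d t s e : R) (z : 'cV[R]_n).
Local Notation hlf := (2^-1 : R).
Local Notation Nhlf := (- 2^-1 : R).
Variables (f : 'cV[R]_n -> 'cV[R]_n) (g : 'cV[R]_n -> 'M[R]_n).
Variables (al : \bar R) (u : dynvec R n).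
Hypothesis uBV : is_sBVloc_vec al +oo%E u.

Lemma rhs_cst_itv z i c t : (al < c%:E)%E -> c < t ->
  rhs al +oo%E f g u (cst_dyn z) i (itv_test c t) = itv_drift f g u z c t i 0.
Proof.
move=> alc ct; apply/eqP; rewrite -subr_eq0 -normr_le0.
rewrite -[leRHS](mul0r (itv_weight u c c t)).
apply: rhs_itv => //.
- by move=> j r _; split; exists (g z i j); move=> e e0; apply: filterE => q q' _;
    rewrite subrr normr0 ltW.
- move=> r _; rewrite (_ : ordv (cst_dyn z) r = z) ?subrr ?normr0//.
  apply/matrixP => k l; rewrite mxE (ord1 l) /ord ifT//.
  by apply/asboolP => s _.
- by move=> *; rewrite subrr normr0.
Qed.

Lemma rhs_cst_jump z i t s1 s2 : (al < t%:E)%E ->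
  Nhlf <= s1 -> s1 <= s2 -> s2 <= hlf ->
  rhs al +oo%E f g u (cst_dyn z) i (jump_test t s1 s2) = jump_drift g u z t s1 s2 i 0.
Proof.
move=> alt h1 h2 h3; apply/eqP; rewrite -subr_eq0 -normr_le0.
rewrite -[leRHS](mul0r (jump_weight u t s1 s2)).
by apply: rhs_jump => // *; rewrite subrr normr0.
Qed.

(** The derivative of a constant vanishes, so the equation for xs reduces, inside
a jump, to the vanishing of the frozen increment. *)
Lemma equilibrium_jump (xs : 'cV[R]_n) t s1 s2 :
  is_sBVloc_vec al +oo%E (cst_dyn xs) ->
  (forall i, eq_distr al +oo%E (deriv_distr al +oo%E (Defs.comp (cst_dyn xs) i))
     (rhs al +oo%E f g u (cst_dyn xs) i)) ->
  (al < t%:E)%E -> Nhlf <= s1 -> s1 <= s2 -> s2 <= hlf ->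
  jump_drift g u xs t s1 s2 = 0.
Proof.
move=> xsBV xsE alt h1 h2 h3; apply/matrixP => i j; rewrite (ord1 j).
rewrite -(rhs_cst_jump xs i alt h1 h2 h3) -xsE; last exact: jump_test_test.
by rewrite (deriv_jump_increment (xsBV i) alt h1 h2 h3) /Defs.comp /cst_dyn subrr mxE.
Qed.

End constant_state.

Section inward.
Context {R : realType}.
Variable n : nat.
Implicit Types (c d t s e : R) (z : 'cV[R]_n).
Local Notation hlf := (2^-1 : R).
Local Notation Nhlf := (- 2^-1 : R).
Variables (f : 'cV[R]_n -> 'cV[R]_n) (g : 'cV[R]_n -> 'M[R]_n).
Variables (al : \bar R) (u : dynvec R n) (t0 : R).
Hypothesis uBV : is_sBVloc_vec al +oo%E u.
Hypothesis al0 : (al < t0%:E)%E.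
Variables (x z : 'cV[R]_n).
Hypothesis xz_le0 : distr_le0 t0%:E +oo%E
  (fun p => \sum_(i < n) z i 0 * rhs t0%:E +oo%E f g u (cst_dyn x) i p).

Let uBV0 : is_sBVloc_vec t0%:E +oo%E u.
Proof.
by move=> i c d cd t0c dy; apply: uBV => //; exact: lt_trans al0 t0c.
Qed.

Lemma dot_jump_drift t s1 s2 : t0 < t -> Nhlf <= s1 -> s1 <= s2 -> s2 <= hlf ->
  dot z (jump_drift g u x t s1 s2) <= 0.
Proof.
move=> tt0 h1 h2 h3; have alt : (t0%:E < t%:E)%E by rewrite lte_fin.
have := xz_le0 (jump_test_test s1 s2 alt) (fun r s _ _ => jump_test_ge0 t s1 s2 r s).
by congr (_ <= 0); apply: eq_bigr => i _; rewrite (rhs_cst_jump f g uBV0).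
Qed.

(** For t0 < c this is the hypothesis tested on the indicator of (c, t). For
c = t0, that indicator is not supported inside (t0, +oo): the interval is cut at
a point close to t0, and the first piece is as small as one likes. *)
Lemma dot_itv_drift c t : t0 <= c -> c < t -> dot z (itv_drift f g u x c t) <= 0.
Proof.
have open_case c' : t0 < c' -> c' < t -> dot z (itv_drift f g u x c' t) <= 0.
  move=> cc0 ct; have alc : (t0%:E < c'%:E)%E by rewrite lte_fin.
  have := xz_le0 (itv_test_test alc (ltW ct)) (fun r s _ _ => itv_test_ge0 c' t r s).
  by congr (_ <= 0); apply: eq_bigr => i _; rewrite (rhs_cst_itv f g uBV0).
rewrite le_eqVlt => /predU1P[<- {c} t0t|]; last exact: open_case.
apply/ler_addgt0Pr => e e0; rewrite add0r.
pose K := norm2 z * (n%:R * (`|f x| + `|g x|)).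
have K0 : 0 <= K by rewrite !mulr_ge0 ?norm2_ge0// addr_ge0.
have eK : 0 < e / (K + 1) by rewrite divr_gt0// ltr_wpDl.
have /near_at_rightP[eta eta0 H] := clock_small uBV al0 (lexx t0) eK.
pose c := Num.min (t0 + eta / 2) ((t0 + t) / 2).
have ct : c < t by rewrite gt_min; apply/orP; right; lra.
have tc : t0 < c by rewrite lt_min; apply/andP; split; lra.
have ce : c < t0 + eta by rewrite gt_min; apply/orP; left; lra.
have -> : itv_drift f g u x t0 t = itv_drift f g u x t0 c +
    (jump_drift g u x c Nhlf hlf + itv_drift f g u x c t).
  rewrite /itv_drift /jump_drift.
  have -> : u t Nhlf - u t0 hlf =
    (u c Nhlf - u t0 hlf) + ((u c hlf - u c Nhlf) + (u t Nhlf - u c hlf)).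
    by apply/matrixP => i j; rewrite !mxE; ring.
  rewrite !mulmxDr (_ : t - t0 = (c - t0) + (t - c)); last by ring.
  by rewrite scalerDl; apply/matrixP => i j; rewrite !mxE; ring.
rewrite (dotDr z (itv_drift f g u x t0 c)) (dotDr z (jump_drift g u x c Nhlf hlf)).
have h1 := open_case c tc ct.
have h2 := dot_jump_drift tc (lexx _) (ltW NhlfLhlf) (lexx _).
have h3 : dot z (itv_drift f g u x t0 c) <= K * (e / (K + 1)).
  apply: le_trans (dot_le _ _) _; rewrite -mulrA ler_wpM2l ?norm2_ge0//.
  rewrite -mulrA; apply: norm2_le => i.
  apply: le_trans (itv_drift_le uBV al0 f g x i (lexx t0) tc) _.
  rewrite ler_wpM2l ?addr_ge0//; apply: le_trans (H c tc ce); rewrite lerDl.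
  by apply: (jump_weight_ge0 uBV (lt_trans al0 _)); rewrite ?lte_fin// ltW// NhlfLhlf.
have h4 : K * (e / (K + 1)) <= e.
  by rewrite mulrCA ler_piMr ?(ltW e0)// ler_pdivrMr ?ltr_wpDl// mul1r lerDl.
rewrite (le_trans _ (le_trans h3 h4))// -[leRHS]addr0 lerD2l -[leRHS]addr0.
exact: lerD h2 h1.
Qed.

End inward.

Section initial_jump.
Context {R : realType}.
Variable n : nat.
Implicit Types (c d t s e : R).
Local Notation hlf := (2^-1 : R).
Local Notation Nhlf := (- 2^-1 : R).
Variables (f : 'cV[R]_n -> 'cV[R]_n) (g : 'cV[R]_n -> 'M[R]_n).
Variables (D : set 'cV[R]_n) (L : R).
Hypothesis L0 : 0 < L.
Hypothesis gL : forall y z : 'cV[R]_n, D y -> D z ->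
  forall i j, `|g y i j - g z i j| <= L * norm2 (y - z).
Variables (al : \bar R) (x u : dynvec R n).
Hypothesis xBV : is_sBVloc_vec al +oo%E x.
Hypothesis xD : forall t s, (al < t%:E)%E -> J s -> D (x t s).
Hypothesis uBV : is_sBVloc_vec al +oo%E u.
Hypothesis xE : forall i, eq_distr al +oo%E (deriv_distr al +oo%E (Defs.comp x i))
  (rhs al +oo%E f g u x i).
Variables (xs : 'cV[R]_n) (t : R).
Hypothesis Dxs : D xs.
Hypothesis alt : (al < t%:E)%E.
Hypothesis xs_jump : forall s1 s2, Nhlf <= s1 -> s1 <= s2 -> s2 <= hlf ->
  jump_drift g u xs t s1 s2 = 0.

(** Gronwall inequality with respect to the variation of u(t): the increment
frozen at xs being 0, what remains is the Lipschitz error, proportional to the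
distance to xs. The bound m may be any positive number, and so the distance is
allowed to vanish initially. *)
Lemma jump_growth m : 0 < m -> norm2 (x t Nhlf - xs) <= m -> forall s, J s ->
  norm2 (x t s - xs) <= m * expR (n%:R * L * 2 * jump_weight u t Nhlf s).
Proof.
move=> m0 init; set C := n%:R * L * 2.
have C0 : 0 <= C by rewrite !mulr_ge0// ltW.
have jwD s s' : jump_weight u t Nhlf s' = jump_weight u t Nhlf s + jump_weight u t s s'.
  by rewrite /jump_weight -big_split/=; apply: eq_bigr => j _; rewrite addrC addrA subrK.
pose B s := m * expR (C * jump_weight u t Nhlf s).
have B0 s : 0 < B s by rewrite mulr_gt0// expR_gt0.
have BD s s' : B s' = B s * expR (C * jump_weight u t s s').
  by rewrite /B (jwD s s') mulrDr expRD mulrA.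
apply: (jump_induction xBV (xs := xs) alt (B := B)) => [s s' s1 ss' s2||b bN bh Hb].
- rewrite (BD s s') ler_peMr ?(ltW (B0 s))// -expR0 ler_expR mulr_ge0//.
  exact: (jump_weight_ge0 uBV alt).
- rewrite /B; have -> : jump_weight u t Nhlf Nhlf = 0.
    by rewrite /jump_weight big1// => j _; rewrite subrr.
  by rewrite mulr0 expR0 mulr1.
have Jb : J b by rewrite JE bN ltW.
have [eta eta0 H] := traj_jump_cont xBV alt Jb (B0 b).
exists eta; first exact: eta0.
move=> s bs; rewrite -ltrBlDl => se sh.
have Js : J s by rewrite JE sh (le_trans bN) ?ltW.
have near_xs s' : b < s' < s -> norm2 (x t s' - xs) <= 2 * B b.
  move=> /andP[bs' s's]; rewrite mulr_natl mulr2n.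
  apply: le_trans (norm2_sub_le _ (x t b) _) _; apply: lerD; last exact: Hb.
  apply: H.
    by rewrite JE (ltW (le_lt_trans bN bs')) (ltW (lt_le_trans s's sh)).
  by rewrite gtr0_norm ?subr_gt0// (lt_trans _ se)// ltrD2r.
have inc := increment_jump L0 gL xBV xD uBV xE alt bN (ltW bs) sh Dxs near_xs.
rewrite (xs_jump bN (ltW bs) sh) in inc.
have w0 := jump_weight_ge0 uBV alt bN (ltW bs) sh.
apply: le_trans (norm2_sub_le _ (x t b) _) _; rewrite [leLHS]addrC (BD b s).
apply: (@le_trans _ _ (B b * (1 + C * jump_weight u t b s))); last first.
  by rewrite ler_pM2l// expR_ge1Dx// mulr_ge0.
rewrite mulrDr mulr1; apply: lerD; first exact: Hb.
rewrite (_ : B b * (C * _) = n%:R * (L * (2 * B b) * jump_weight u t b s)); last first.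
  by rewrite /C; ring.
by apply: norm2_le => i; rewrite -[x t s - _]subr0.
Qed.

End initial_jump.

(** * Stability *)

Theorem theorem7 (R : realType) (n : nat) (a : \bar R) (t0 : R)
  (D : set 'cV[R]_n) (f : 'cV[R]_n -> 'cV[R]_n) (g : 'cV[R]_n -> 'M[R]_n)
  (u : dynvec R n) (xs : 'cV[R]_n)
  (ht0 : oitv a +oo%E t0)
  (hD : open D)
  (hf : [lipschitz f x | x in D])
  (hg : [lipschitz g x | x in D])
  (hu : is_sBVloc_vec a +oo%E u)
  (hsigma : forall tau, discv a +oo%E u tau -> sigma u tau <> 0)
  (hxs : is_equilibrium D f g u a xs)
  (hle : forall (x : 'cV[R]_n) (l : nat), (0 < l)%N -> D x ->
     norm2 (x - xs) = l%:R^-1 ->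
     distr_le0 t0%:E +oo%E
       (fun p => \sum_(i < n)
          (x - xs) i 0 * rhs t0%:E +oo%E f g u (cst_dyn x) i p)) :
  uniformly_stable D f g u a t0 xs.
Proof.
have [Dxs [xsBV _ xsE]] := hxs; have [at0 _] := ht0.
have [r r0 rD] := open_norm2_ball hD Dxs.
have [m] := ltr_add_invr r0; rewrite add0r => mr.
pose rad k : R := (k + m).+1%:R^-1.
have rad0 k : 0 < rad k by rewrite invr_gt0.
have rad_le j k : (j <= k)%N -> rad k <= rad j.
  by move=> jk; rewrite lef_pV2 ?posrE// ler_nat ltnS leq_add2r.
have radD k (y : 'cV[R]_n) : norm2 (y - xs) <= rad k -> D y.
  move=> yk; apply: rD; apply: le_lt_trans mr.
  by rewrite (le_trans yk)// lef_pV2 ?posrE// ler_nat ltnS leq_addl.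
exists (fun k => [set y | norm2 (y - xs) <= rad k]); split.
- by move=> k; exact: closed_norm2_ball.
- move=> k; split=> [y /= yk|y]; last exact: radD.
  by rewrite (le_trans yk)// rad_le.
- move=> k; have [U [oU Uxs Uk]] := norm2_ball_nbhs xs (rad0 k).
  by exists U, setT; split=> //; exact: openT.
move=> l.
have [Lf Lf0 HLf] := lipschitz_norm2 hf; have [Lg Lg0 HLg] := lipschitz_norm2 hg.
pose L := Lf + Lg; have L0 : 0 < L by rewrite addr_gt0.
have fL (y z : 'cV[R]_n) : D y -> D z -> forall i, `|f y i 0 - f z i 0| <= L * norm2 (y - z).
  move=> Dy Dz i; rewrite (le_trans (HLf y z Dy Dz i 0))// ler_wpM2r ?norm2_ge0//.
  by rewrite lerDl ltW.
have gL (y z : 'cV[R]_n) : D y -> D z -> forall i j, `|g y i j - g z i j| <= L * norm2 (y - z).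
  move=> Dy Dz i j; rewrite (le_trans (HLg y z Dy Dz i j))// ler_wpM2r ?norm2_ge0//.
  by rewrite lerDr ltW.
(* greatest factor by which the jump at t0 can expand the distance to xs *)
pose E := expR (n%:R * L * 2 * jump_weight u t0 (- 2^-1) 2^-1).
have E0 : 0 < E by exact: expR_gt0.
have [q] := ltr_add_invr (divr_gt0 (rad0 l) E0); rewrite add0r ltr_pdivlMr// => ql.
exists (l + q)%N; first exact: leq_addr.
move=> al x aal alt0 [xBV xD xE] /= xM.
have uBV : is_sBVloc_vec al +oo%E u.
  by move=> i c d cd alc doo; apply: hu => //; exact: le_lt_trans aal alc.
have xD' t s : (al < t%:E)%E -> J s -> D (x t s).
  by move=> alt; apply: xD; split=> //=; rewrite ltry.
have x0E : left_val x t0 = x t0 (- 2^-1).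
  apply/matrixP => i j; rewrite mxE (ord1 j).
  have [_ h _] := sBV_sG (xBV i) alt0.
  exact: (dyn_limE _ h).
have init s : J s -> norm2 (x t0 s - xs) <= rad l.
  have eq_jump := equilibrium_jump hu xsBV xsE at0.
  rewrite x0E in xM => Js; apply: le_trans (jump_growth L0 gL xBV xD' uBV xE Dxs alt0
    eq_jump (rad0 (l + q)%N) xM Js) _.
  have small : rad (l + q)%N <= q.+1%:R^-1.
    by rewrite lef_pV2 ?posrE// ler_nat ltnS -addnA addnCA leq_addr.
  move: Js; rewrite JE => /andP[s1 s2].
  have C0 : 0 <= n%:R * L * 2 by rewrite mulr_ge0// mulr_ge0// ltW.
  have jw : jump_weight u t0 (- 2^-1) s <= jump_weight u t0 (- 2^-1) 2^-1.
    rewrite -subr_ge0; have := jump_weight_ge0 uBV alt0 s1 s2 (lexx _).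
    by congr (0 <= _); rewrite /jump_weight -sumrB; apply: eq_bigr => j _; ring.
  apply: le_trans (ltW ql); apply: ler_pM small _.
  - exact: ltW (rad0 _).
  - exact: expR_ge0.
  - by rewrite ler_expR ler_wpM2l.
have sphere_norm (z : 'cV[R]_n) : norm2 z = rad l -> norm2 (xs + z - xs) = rad l.
  by rewrite addrAC subrr add0r.
have sphereD (z : 'cV[R]_n) : norm2 z = rad l -> D (xs + z).
  by move=> /sphere_norm zl; apply: (radD l); rewrite zl.
have sphere_le0 (z : 'cV[R]_n) : norm2 z = rad l -> distr_le0 t0%:E +oo%E
    (fun p => \sum_(i < n) z i 0 * rhs t0%:E +oo%E f g u (cst_dyn (xs + z)) i p).
  move=> zl; have := hle _ _ (ltn0Sn (l + m)) (sphereD z zl) (sphere_norm z zl).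
  by rewrite addrAC subrr add0r.
move=> t s tt0 Js; apply: (sphere_trap L0 fL gL xBV xD' uBV xE alt0 (rad0 l) sphereD) => //.
- by move=> z c d zl c0 cd; exact: (dot_itv_drift uBV alt0 (sphere_le0 z zl)).
- by move=> z d s1 s2 zl d0 h1 h2 h3; exact: (dot_jump_drift uBV alt0 (sphere_le0 z zl)).
Qed.
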